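(* Let $0<q<1$. The vector space $\mathcal{A}(S^4_q)$ has an orthonormal basis $|l,m_1,m_2;j\rangle$ with $$l\in\mathbb{N},\qquad j=0,1,\ldots,l,\qquad j-|m_1|\in\mathbb{N},\qquad l-j-|m_2|\in 2\mathbb{N}.$$ Let $L^2(S^4_q)$ be the Hilbert space completion of $\mathcal{A}(S^4_q)$. Modulo a unitary equivalence, the left regular representation of $\mathcal{A}(S^4_q)$ is given by \begin{align*} x_0|l,m_1,m_2;j\rangle &=A_{j,m_1}C^+_{l,j,m_2}|l+1,m_1,m_2;j+1\rangle +A_{j,m_1}C^-_{l,j,m_2}|l-1,m_1,m_2;j+1\rangle \\ &\quad +A_{j-1,m_1}C^-_{l+1,j-1,m_2}|l+1,m_1,m_2;j-1\rangle +A_{j-1,m_1}C^+_{l-1,j-1,m_2}|l-1,m_1,m_2;j-1\rangle, \\ x_1|l,m_1,m_2;j\rangle &=B^+_{j,m_1}C^+_{l,j,m_2}|l+1,m_1+1,m_2;j+1\rangle +B^+_{j,m_1}C^-_{l,j,m_2}|l-1,m_1+1,m_2;j+1\rangle \\ &\quad +B^-_{j,m_1}C^-_{l+1,j-1,m_2}|l+1,m_1+1,m_2;j-1\rangle +B^-_{j,m_1}C^+_{l-1,j-1,m_2}|l-1,m_1+1,m_2;j-1\rangle, \\ x_2|l,m_1,m_2;j\rangle &=D^+_{l,j,m_2}|l+1,m_1,m_2+1;j\rangle +D^-_{l,j,m_2}|l-1,m_1,m_2+1;j\rangle, \end{align*} with coefficients \begin{align*} A_{j,m_1} &=q^{m_1-1}\sqrt{\frac{[j+m_1+1][j-m_1+1]}{[2j+1][2j+3]}},\\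 B^+_{j,m_1} &=q^{-j+m_1-1/2}\sqrt{\frac{[j+m_1+1][j+m_1+2]}{[2j+1][2j+3]}},\qquad B^-_{j,m_1} =-q^{j+m_1+1/2}\sqrt{\frac{[j-m_1][j-m_1-1]}{[2j-1][2j+1]}},\\ C^+_{l,j,m_2} &=q^{m_2-1}\sqrt{\frac{[l+j+m_2+3][l+j-m_2+3]}{[2l+3][2l+5]}},\qquad C^-_{l,j,m_2} =-q^{m_2-1}\sqrt{\frac{[l-j+m_2][l-j-m_2]}{[2l+1][2l+3]}},\\ D^+_{l,j,m_2} &=q^{-l+m_2-3/2}\sqrt{\frac{[l+j+m_2+3][l-j+m_2+2]}{[2l+3][2l+5]}},\\ D^-_{l,j,m_2} &=q^{l+m_2+3/2}\sqrt{\frac{[l-j-m_2][l+j-m_2+1]}{[2l+1][2l+3]}}. \end{align*}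
   Context: Notation: $\mathbb{N}=\{0,1,2,\dots\}$, $[z]:=(q^z-q^{-z})/(q-q^{-1})$. A ket whose labels are not admissible is understood to be $0$. The algebra: $\mathcal{A}(S^4_q)$ is the unital $*$-algebra generated by $x_0=x_0^*$, $x_1,x_2,x_1^*,x_2^*$ with relations $x_ix_j=q^2x_jx_i$ for $0\le i<j\le 2$; $x_i^*x_j=q^2x_jx_i^*$ for $i\neq j$; $[x_1^*,x_1]=(1-q^4)x_0^2$; $[x_2^*,x_2]=x_1^*x_1-q^4x_1x_1^*$; $x_0^2+x_1x_1^*+x_2x_2^*=1$. The symmetry: $\mathcal{U}=U_q(so(5))$ is the Hopf $*$-algebra generated by $K_i=K_i^*$, $K_i^{-1}$, $E_i$, $F_i:=E_i^*$ ($i=1,2$) with relations $[K_1,K_2]=0$, $K_iK_i^{-1}=K_i^{-1}K_i=1$, $[E_i,F_j]=\delta_{ij}\frac{K_j^2-K_j^{-2}}{q^j-q^{-j}}$, $K_iE_iK_i^{-1}=q^iE_i$, $K_iE_jK_i^{-1}=q^{-1}E_j$ for $i\ne j$, $E_1E_2^2-(q^2+q^{-2})E_2E_1E_2+E_2^2E_1=0$, $E_1^3E_2-(q^2+1+q^{-2})(E_1^2E_2E_1-E_1E_2E_1^2)-E_2E_1^3=0$, and their adjoints; $\Delta K_i=K_i\otimes K_i$, $\Delta E_i=E_i\otimes K_i+K_i^{-1}\otimes E_i$, $\epsilon(K_i)=1$, $\epsilon(E_i)=0$, $S(K_i)=K_i^{-1}$, $S(E_i)=-q^iE_i$. $\mathcal{A}(S^4_q)$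 is a left $\mathcal{U}$-module $*$-algebra (that is $h\triangleright ab=(h_{(1)}\triangleright a)(h_{(2)}\triangleright b)$, $h\triangleright 1=\epsilon(h)1$, $h\triangleright a^*=\{S(h)^*\triangleright a\}^*$) via $K_i\triangleright x_i=qx_i$ ($i=1,2$), $K_2\triangleright x_1=q^{-1}x_1$, $E_1\triangleright x_0=q^{-1/2}x_1$, $E_2\triangleright x_1=x_2$, $F_1\triangleright x_1=q^{1/2}[2]x_0$, $F_1\triangleright x_0=-q^{-3/2}x_1^*$, $F_2\triangleright x_2=x_1$, while $K_i\triangleright x_j=x_j$, $E_i\triangleright x_j=0$, $F_i\triangleright x_j=0$ in all other cases (the action on $x_i^*$ being determined by compatibility with $*$). For $l\in\mathbb{N}$ let $V_l$ be the irreducible $*$-representation $\sigma_l$ of $\mathcal{U}$ with orthonormal basis $|l,m_1,m_2;j\rangle$ (labels as in the claim) and $K_1|l,m_1,m_2;j\rangle=q^{m_1}|l,m_1,m_2;j\rangle$, $K_2|l,m_1,m_2;j\rangle=q^{m_2-m_1}|l,m_1,m_2;j\rangle$, $E_1|l,m_1,m_2;j\rangle=\sqrt{[j-m_1][j+m_1+1]}\,|l,m_1+1,m_2;j\rangle$, $E_2|l,m_1,m_2;j\rangle=\sqrt{[j-m_1+1][j-m_1+2]}\,a_l(j,m_2)|l,m_1-1,m_2+1;j+1\rangle+\sqrt{[j+m_1][j+m_1-1]}\,c_l(j,m_2)|l,m_1-1,m_2+1;j-1\rangle$, where $a_l(j,m_2)=\frac{1}{[2]}\sqrt{\frac{[l-j-m_2][l+j+m_2+3]}{[2j+1][2j+3]}}$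 and $c_l(j,m_2)=\frac{1}{[2]}\sqrt{\frac{[l-j+m_2+2][l+j-m_2+1]}{[2j-1][2j+1]}}$; $F_i$ acts as the adjoint of $E_i$. It is known that $\mathcal{A}(S^4_q)\simeq\bigoplus_{l\in\mathbb{N}}V_l$ as left $\mathcal{U}$-modules; the kets in the claim are the vectors corresponding to these basis vectors of the $V_l$'s. The inner product on $\mathcal{A}(S^4_q)$ is $\langle a,b\rangle=\varphi(a^*b)$, with $\varphi$ the $\mathcal{U}$-invariant faithful state on $\mathcal{A}(S^4_q)$ (the linear functional with $\varphi(1)=1$ and $\varphi(h\triangleright a)=\epsilon(h)\varphi(a)$, coming from the Haar functional). The left regular representation is the representation of $\mathcal{A}(S^4_q)$ on itself by left multiplication. *)

(* Defs.v *)
From HB Require Import structures.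
From mathcomp Require Import all_boot all_order all_algebra.
From mathcomp Require Import all_classical all_reals all_analysis.
From mathcomp Require Import complex.

Set Implicit Arguments.
Unset Strict Implicit.
Unset Printing Implicit Defensive.

Import Order.TTheory GRing.Theory Num.Theory.
Import numFieldNormedType.Exports.

Local Open Scope ring_scope.
Local Open Scope complex_scope.
Local Open Scope quotient_scope.

(* The unital *-algebra over C generated by X subject to a family of relations:
   *-algebra terms over X modulo the congruence generated by the *-algebra
   axioms and the relations.  Since the congruence is compatible with the
   involution, the adjoints of the relations hold as well. *)
Section Presentation.
Variables (C : numClosedFieldType) (X : Type).

Inductive sterm : Type :=
  | SGen of X
  | SCst of C
  | SAdd of sterm & sterm
  | SMul of sterm & sterm
  | SStar of sterm.

Definition SScale (c : C) (t : sterm) := SMul (SCst c) t.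
Definition SOpp (t : sterm) := SScale (- 1) t.
Definition SSub (s t : sterm) := SAdd s (SOpp t).

HB.instance Definition _ := gen_eqMixin sterm.
HB.instance Definition _ := gen_choiceMixin sterm.

Variable rel : sterm -> sterm -> Prop.

Inductive scong : sterm -> sterm -> Prop :=
  | sc_refl t : scong t t
  | sc_sym s t : scong s t -> scong t s
  | sc_trans s t u : scong s t -> scong t u -> scong s u
  | sc_addl s s' t : scong s s' -> scong (SAdd s t) (SAdd s' t)
  | sc_mull s s' t : scong s s' -> scong (SMul s t) (SMul s' t)
  | sc_mulr s t t' : scong t t' -> scong (SMul s t) (SMul s t')
  | sc_star s t : scong s t -> scong (SStar s) (SStar t)
  | sc_addA s t u : scong (SAdd s (SAdd t u)) (SAdd (SAdd s t) u)
  | sc_addC s t : scong (SAdd s t) (SAdd t s)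
  | sc_add0 t : scong (SAdd (SCst 0) t) t
  | sc_addN t : scong (SAdd (SOpp t) t) (SCst 0)
  | sc_mulA s t u : scong (SMul s (SMul t u)) (SMul (SMul s t) u)
  | sc_mul1 t : scong (SMul (SCst 1) t) t
  | sc_mulDl s t u : scong (SMul (SAdd s t) u) (SAdd (SMul s u) (SMul t u))
  | sc_mulDr s t u : scong (SMul s (SAdd t u)) (SAdd (SMul s t) (SMul s u))
  | sc_cstD a b : scong (SCst (a + b)) (SAdd (SCst a) (SCst b))
  | sc_cstM a b : scong (SCst (a * b)) (SMul (SCst a) (SCst b))
  | sc_cstC a t : scong (SMul (SCst a) t) (SMul t (SCst a))
  | sc_starK t : scong (SStar (SStar t)) t
  | sc_starD s t : scong (SStar (SAdd s t)) (SAdd (SStar s) (SStar t))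
  | sc_starM s t : scong (SStar (SMul s t)) (SMul (SStar t) (SStar s))
  | sc_starC a : scong (SStar (SCst a)) (SCst (Num.conj a))
  | sc_rel s t : rel s t -> scong s t.

Definition scongb (s t : sterm) : bool := `[< scong s t >].

Lemma scongb_refl : reflexive scongb.
Proof. by move=> t; apply/asboolP; apply: sc_refl. Qed.
Lemma scongb_sym : symmetric scongb.
Proof. by move=> s t; apply/asboolP/asboolP => /sc_sym. Qed.
Lemma scongb_trans : transitive scongb.
Proof.
by move=> t s u /asboolP st /asboolP tu; apply/asboolP; apply: sc_trans st tu.
Qed.

Canonical scong_equiv :=
  EquivRel scongb scongb_refl scongb_sym scongb_trans.

Definition presented := {eq_quot scong_equiv}.
HB.instance Definition _ := Choice.on presented.
HB.instance Definition _ := EqQuotient.on presented.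

Definition pr (t : sterm) : presented := \pi_presented t.

Lemma prP s t : pr s = pr t <-> scong s t.
Proof. by split=> [/eqmodP/asboolP|?]; last by apply/eqmodP/asboolP. Qed.

Lemma pr_surj (a : presented) : pr (repr a) = a.
Proof. exact: reprK. Qed.

Lemma repr_pr t : scong (repr (pr t)) t.
Proof. by apply/prP; rewrite pr_surj. Qed.

Definition padd (a b : presented) := pr (SAdd (repr a) (repr b)).
Definition pmul (a b : presented) := pr (SMul (repr a) (repr b)).
Definition pscale (c : C) (a : presented) := pr (SScale c (repr a)).
Definition pstar (a : presented) := pr (SStar (repr a)).

Lemma padd_pr s t : padd (pr s) (pr t) = pr (SAdd s t).
Proof.
apply/prP; apply: sc_trans (sc_addl _ (repr_pr s)) _.
apply: sc_trans (sc_addC _ _) _; apply: sc_trans (sc_addl _ (repr_pr t)) _.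
exact: sc_addC.
Qed.

Lemma pmul_pr s t : pmul (pr s) (pr t) = pr (SMul s t).
Proof.
by apply/prP; apply: sc_trans (sc_mull _ (repr_pr s)) (sc_mulr _ (repr_pr t)).
Qed.

Lemma pscale_pr c t : pscale c (pr t) = pr (SScale c t).
Proof. by apply/prP; apply: sc_mulr; apply: repr_pr. Qed.

Lemma pstar_pr t : pstar (pr t) = pr (SStar t).
Proof. by apply/prP; apply: sc_star; apply: repr_pr. Qed.

Lemma presented_ind (P : presented -> Prop) :
  (forall t, P (pr t)) -> forall a, P a.
Proof. by move=> Pt a; rewrite -(pr_surj a). Qed.

Let pE := (padd_pr, pmul_pr, pscale_pr, pstar_pr).

Local Ltac lift1 := elim/presented_ind=> ?.

Lemma paddA : associative padd.
Proof. by do 3!lift1; rewrite !pE; apply/prP/sc_addA. Qed.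
Lemma paddC : commutative padd.
Proof. by do 2!lift1; rewrite !pE; apply/prP/sc_addC. Qed.
Lemma padd0 : left_id (pr (SCst 0)) padd.
Proof. by lift1; rewrite !pE; apply/prP/sc_add0. Qed.
Lemma paddN : left_inverse (pr (SCst 0)) (pscale (- 1)) padd.
Proof. by lift1; rewrite !pE; apply/prP/sc_addN. Qed.

HB.instance Definition _ := GRing.isZmodule.Build presented
  paddA paddC padd0 paddN.

Lemma pmulA : associative pmul.
Proof. by do 3!lift1; rewrite !pE; apply/prP/sc_mulA. Qed.
Lemma pmul1l : left_id (pr (SCst 1)) pmul.
Proof. by lift1; rewrite !pE; apply/prP/sc_mul1. Qed.
Lemma pmul1r : right_id (pr (SCst 1)) pmul.
Proof.
by lift1; rewrite !pE; apply/prP; apply: sc_trans (sc_sym (sc_cstC _ _)) (sc_mul1 _).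
Qed.
Lemma pmulDl : left_distributive pmul +%R.
Proof. by do 3!lift1; rewrite /+%R /= !pE; apply/prP/sc_mulDl. Qed.
Lemma pmulDr : right_distributive pmul +%R.
Proof. by do 3!lift1; rewrite /+%R /= !pE; apply/prP/sc_mulDr. Qed.

HB.instance Definition _ := GRing.Zmodule_isPzRing.Build presented
  pmulA pmul1l pmul1r pmulDl pmulDr.

Lemma pscaleA a b v : pscale a (pscale b v) = pscale (a * b) v.
Proof.
elim/presented_ind: v => t; rewrite !pE; apply/prP.
apply: sc_trans (sc_mulA _ _ _) _; apply: sc_mull; exact: sc_sym (sc_cstM _ _).
Qed.
Lemma pscale1 : left_id 1 pscale.
Proof. by lift1; rewrite !pE; apply/prP/sc_mul1. Qed.
Lemma pscaleDr : right_distributive pscale +%R.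
Proof. by move=> c; do 2!lift1; rewrite /+%R /= !pE; apply/prP/sc_mulDr. Qed.
Lemma pscaleDl v : {morph pscale^~ v : a b / a + b}.
Proof.
elim/presented_ind: v => t a b; rewrite {2}/+%R /= !pE; apply/prP.
apply: sc_trans (sc_mull _ (sc_cstD _ _)) _; exact: sc_mulDl.
Qed.

HB.instance Definition _ := GRing.Zmodule_isLmodule.Build C presented
  pscaleA pscale1 pscaleDr pscaleDl.

Lemma presented_scaleAl (c : C) (a b : presented) : c *: (a * b) = c *: a * b.
Proof.
elim/presented_ind: a => s; elim/presented_ind: b => t.
by rewrite /*:%R /*%R /= !pE; apply/prP/sc_mulA.
Qed.
Lemma presented_scaleAr (c : C) (a b : presented) : c *: (a * b) = a * (c *: b).
Proof.
elim/presented_ind: a => s; elim/presented_ind: b => t.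
rewrite /*:%R /*%R /= !pE; apply/prP.
apply: sc_trans (sc_mulA _ _ _) _; apply: sc_trans (sc_mull _ (sc_cstC _ _)) _.
exact: sc_sym (sc_mulA _ _ _).
Qed.

Definition gen (x : X) : presented := pr (SGen x).
Definition star (a : presented) : presented := pstar a.

Lemma prD s t : pr (SAdd s t) = pr s + pr t.
Proof. by rewrite -padd_pr. Qed.
Lemma prM s t : pr (SMul s t) = pr s * pr t.
Proof. by rewrite -pmul_pr. Qed.
Lemma prZ c t : pr (SScale c t) = c *: pr t.
Proof. by rewrite -pscale_pr. Qed.
Lemma prC c : pr (SCst c) = c *: (1 : presented).
Proof.
rewrite -[1]/(pr (SCst 1)) -prZ; apply/prP.
by rewrite -[X in SCst X]mulr1; apply: sc_cstM.
Qed.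
Lemma prN t : pr (SOpp t) = - pr t.
Proof. by rewrite prZ scaleN1r. Qed.
Lemma prB s t : pr (SSub s t) = pr s - pr t.
Proof. by rewrite prD prN. Qed.
Lemma prS t : pr (SStar t) = star (pr t).
Proof. by rewrite /star pstar_pr. Qed.
Lemma pr_rel s t : rel s t -> pr s = pr t.
Proof. by move=> st; apply/prP/sc_rel. Qed.

Fixpoint seval (f : X -> C) (t : sterm) : C :=
  match t with
  | SGen x => f x
  | SCst c => c
  | SAdd s t => seval f s + seval f t
  | SMul s t => seval f s * seval f t
  | SStar t => Num.conj (seval f t)
  end.

Lemma seval_cong f : (forall s t, rel s t -> seval f s = seval f t) ->
  forall s t, scong s t -> seval f s = seval f t.
Proof.
move=> frel s t; elim=> //=.
- by move=> ? ? ? _ -> _ ->.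
- by move=> ? ? ? _ ->.
- by move=> ? ? ? _ ->.
- by move=> ? ? ? _ ->.
- by move=> ? ? _ ->.
- by move=> *; rewrite addrA.
- by move=> *; rewrite addrC.
- by move=> *; rewrite add0r.
- by move=> *; rewrite mulN1r addNr.
- by move=> *; rewrite mulrA.
- by move=> *; rewrite mul1r.
- by move=> *; rewrite mulrDl.
- by move=> *; rewrite mulrDr.
- by move=> *; rewrite mulrC.
- by move=> *; rewrite conjCK.
- by move=> *; rewrite rmorphD.
- by move=> *; rewrite rmorphM mulrC.
Qed.

Lemma presented_nontrivial f :
  (forall s t, rel s t -> seval f s = seval f t) -> (1 : presented) != 0.
Proof.
move=> frel; apply/eqP => /prP/(seval_cong frel)/= /eqP.
by rewrite oner_eq0.
Qed.

End Presentation.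

Declare Scope sterm_scope.
Delimit Scope sterm_scope with sterm.
Bind Scope sterm_scope with sterm.
Notation "s + t" := (SAdd s t) : sterm_scope.
Notation "s - t" := (SSub s t) : sterm_scope.
Notation "s * t" := (SMul s t) : sterm_scope.
Notation "c *: t" := (SScale c%R t) : sterm_scope.
Notation "t ^*" := (SStar t) : sterm_scope.
Notation "0" := (SCst _ 0%R) : sterm_scope.
Notation "1" := (SCst _ 1%R) : sterm_scope.

(* All arguments of the bracket [z] below are integers. *)
Definition qint (R : realType) (q : R) (z : int) : R :=
  (q ^ z - q ^ (- z)) / (q - q^-1).

Inductive scoord := c0 | c1 | c2.
Coercion nat_of_scoord (i : scoord) : nat :=
  match i with c0 => 0 | c1 => 1 | c2 => 2 end.

Section Sphere.
Variables (R : realType) (q : R).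
Local Notation x := (@SGen R[i] scoord).
Local Notation Q := (q%:C).

Inductive sphere_rel : sterm R[i] scoord -> sterm R[i] scoord -> Prop :=
  | sr_x0 : sphere_rel ((x c0)^*) (x c0)
  | sr_xx (i j : scoord) : (i < j)%N ->
      sphere_rel (x i * x j) (Q ^+ 2 *: (x j * x i))
  | sr_xsx (i j : scoord) : i <> j ->
      sphere_rel ((x i)^* * x j) (Q ^+ 2 *: (x j * (x i)^*))
  | sr_x1 : sphere_rel ((x c1)^* * x c1 - x c1 * (x c1)^*)
      ((1 - Q ^+ 4) *: (x c0 * x c0))
  | sr_x2 : sphere_rel ((x c2)^* * x c2 - x c2 * (x c2)^*)
      ((x c1)^* * x c1 - Q ^+ 4 *: (x c1 * (x c1)^*))
  | sr_sphere :
      sphere_rel (x c0 * x c0 + x c1 * (x c1)^* + x c2 * (x c2)^*) 1.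

Definition qsphere := presented sphere_rel.
HB.instance Definition _ := GRing.PzRing.on qsphere.
HB.instance Definition _ := GRing.Lmodule.on qsphere.

(* nontrivial because of the character x_0, x_1 |-> 0, x_2 |-> 1 *)
Lemma qsphere_nontrivial : (1 : qsphere) != 0.
Proof.
apply: (@presented_nontrivial _ _ _ (fun i => if i is c2 then 1 else 0)).
move=> s t [] /=.
- by rewrite rmorph0.
- by case=> [] [] //= _; rewrite !(mulr0, mul0r).
- by case=> [] [] //= _; rewrite ?(rmorph0, rmorph1) ?(mulr0, mul0r).
- by rewrite rmorph0 !mulr0 addr0.
- by rewrite rmorph0 rmorph1 !mulr0 mulr1 mulN1r subrr addr0.
- by rewrite rmorph0 rmorph1 !mulr0 mulr1 !add0r.
Qed.

HB.instance Definition _ :=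
  GRing.PzSemiRing_isNonZero.Build qsphere qsphere_nontrivial.
HB.instance Definition _ := GRing.Lmodule_isLalgebra.Build R[i] qsphere
  (@presented_scaleAl _ _ sphere_rel).
HB.instance Definition _ := GRing.Lalgebra_isAlgebra.Build R[i] qsphere
  (@presented_scaleAr _ _ sphere_rel).

Definition xgen (i : scoord) : qsphere := gen sphere_rel i.

End Sphere.

(* The two nodes of the Dynkin diagram; node i enters the relations of
   U_q(so(5)) through q ^+ i. *)
Inductive node := n1 | n2.
Coercion nat_of_node (i : node) : nat := match i with n1 => 1 | n2 => 2 end.

Inductive ugen := GK of node | GKinv of node | GE of node.

Section Uqso5.
Variables (R : realType) (q : R).
Local Notation T := (sterm R[i] ugen).
Local Notation K i := (SGen R[i] (GK i)).
Local Notation K' i := (SGen R[i] (GKinv i)).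
Local Notation E i := (SGen R[i] (GE i)).
Local Notation F i := (SStar (SGen R[i] (GE i))).
Local Notation Q := (q%:C).

Inductive uq_rel : T -> T -> Prop :=
  | ur_Kstar i : uq_rel ((K i)^*) (K i)
  | ur_KK : uq_rel (K n1 * K n2) (K n2 * K n1)
  | ur_KKinv i : uq_rel (K i * K' i) 1
  | ur_KinvK i : uq_rel (K' i * K i) 1
  | ur_EF i : uq_rel (E i * F i - F i * E i)
      ((Q ^+ i - Q ^- i)^-1 *: (K i * K i - K' i * K' i))
  | ur_EF0 i j : i <> j -> uq_rel (E i * F j - F j * E i) 0
  | ur_KE i : uq_rel (K i * E i * K' i) (Q ^+ i *: E i)
  | ur_KE' i j : i <> j -> uq_rel (K i * E j * K' i) (Q^-1 *: E j)
  | ur_serre1 : uq_rel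
      (E n1 * E n2 * E n2 - (Q ^+ 2 + Q ^- 2) *: (E n2 * E n1 * E n2)
       + E n2 * E n2 * E n1) 0
  | ur_serre2 : uq_rel
      (E n1 * E n1 * E n1 * E n2
       - (Q ^+ 2 + 1 + Q ^- 2) *: (E n1 * E n1 * E n2 * E n1
                                   - E n1 * E n2 * E n1 * E n1)
       - E n2 * E n1 * E n1 * E n1) 0.

Definition uq := presented uq_rel.
HB.instance Definition _ := GRing.PzRing.on uq.
HB.instance Definition _ := GRing.Lmodule.on uq.

Definition counit_gen (g : ugen) : R[i] := if g is GE _ then 0 else 1.

Lemma counit_rel s t :
  uq_rel s t -> seval counit_gen s = seval counit_gen t.
Proof.
by case=> * /=; rewrite ?rmorph0 ?rmorph1;
   rewrite ?(mulr0, mul0r, addr0, add0r, mulr1, mul1r, subrr).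
Qed.

Lemma uq_nontrivial : (1 : uq) != 0.
Proof. exact: presented_nontrivial counit_rel. Qed.

HB.instance Definition _ := GRing.PzSemiRing_isNonZero.Build uq uq_nontrivial.
HB.instance Definition _ := GRing.Lmodule_isLalgebra.Build R[i] uq
  (@presented_scaleAl _ _ uq_rel).
HB.instance Definition _ := GRing.Lalgebra_isAlgebra.Build R[i] uq
  (@presented_scaleAr _ _ uq_rel).

Definition uK (i : node) : uq := gen uq_rel (GK i).
Definition uKinv (i : node) : uq := gen uq_rel (GKinv i).
Definition uE (i : node) : uq := gen uq_rel (GE i).
Definition uF (i : node) : uq := star (uE i).

(* The *-character with value 1 on K_i and 0 on E_i (see counit_pr). *)
Definition counit (h : uq) : R[i] := seval counit_gen (repr h).

Lemma counit_pr t : counit (pr uq_rel t) = seval counit_gen t.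
Proof. exact: seval_cong counit_rel _ _ (repr_pr _ t). Qed.

(* Graph of the coproduct, the *-homomorphism uq -> uq (x) uq given on the
   generators: coproduct h s means that Delta(h) is the sum of the elementary
   tensors p.1 (x) p.2 for p in s (Sweedler's notation). *)
Inductive coproduct : uq -> seq (uq * uq) -> Prop :=
  | cop_K i : coproduct (uK i) [:: (uK i, uK i)]
  | cop_Kinv i : coproduct (uKinv i) [:: (uKinv i, uKinv i)]
  | cop_E i : coproduct (uE i) [:: (uE i, uK i); (uKinv i, uE i)]
  | cop_cst (c : R[i]) : coproduct c%:A [:: (c%:A, 1)]
  | cop_add h k s t : coproduct h s -> coproduct k t ->
      coproduct (h + k) (s ++ t)
  | cop_mul h k s t : coproduct h s -> coproduct k t ->
      coproduct (h * k) [seq (a.1 * b.1, a.2 * b.2) | a <- s, b <- t]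
  | cop_star h s : coproduct h s ->
      coproduct (star h) [seq (star a.1, star a.2) | a <- s].

(* Graph of the antipode: the antihomomorphism given on the generators, with
   S(S(k)^* )^* = k in any Hopf *-algebra. *)
Inductive antipode : uq -> uq -> Prop :=
  | ant_K i : antipode (uK i) (uKinv i)
  | ant_Kinv i : antipode (uKinv i) (uK i)
  | ant_E i : antipode (uE i) (- (Q ^+ i *: uE i))
  | ant_cst (c : R[i]) : antipode c%:A c%:A
  | ant_add h k h' k' : antipode h h' -> antipode k k' ->
      antipode (h + k) (h' + k')
  | ant_mul h k h' k' : antipode h h' -> antipode k k' ->
      antipode (h * k) (k' * h')
  | ant_star k h : antipode k h -> antipode (star h) (star k).

End Uqso5.

Section Action.
Variables (R : realType) (q : R).
Local Notation A := (qsphere q).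
Local Notation U := (uq q).
Local Notation x := (xgen q).
Local Notation Q := (q%:C).

Local Notation Qpow z := ((q `^ z)%:C).

Record module_star_algebra (act : U -> A -> A) : Prop := ModuleStarAlgebra {
  act_linear_l : forall (c : R[i]) h k a,
    act (c *: h + k) a = c *: act h a + act k a;
  act_linear_r : forall (c : R[i]) h a b,
    act h (c *: a + b) = c *: act h a + act h b;
  act_1 : forall a, act 1 a = a;
  act_M : forall h k a, act (h * k) a = act h (act k a);
  act_mul : forall h s a b, coproduct h s ->
    act h (a * b) = \sum_(p <- s) act p.1 a * act p.2 b;
  act_unit : forall h, act h 1 = (counit h)%:A;
  act_star : forall h k a, antipode h k ->
    act h (star a) = star (act (star k) a)
}.

Record sphere_action (act : U -> A -> A) : Prop := SphereAction {
  sphere_module_star_algebra : module_star_algebra act;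
  act_K : forall i j, act (uK q i) (x j) =
    match i, j with
    | n1, c1 => Q *: x c1
    | n2, c2 => Q *: x c2
    | n2, c1 => Q^-1 *: x c1
    | _, _ => x j
    end;
  act_E : forall i j, act (uE q i) (x j) =
    match i, j with
    | n1, c0 => Qpow (- 2^-1) *: x c1
    | n2, c1 => x c2
    | _, _ => 0
    end;
  act_F : forall i j, act (uF q i) (x j) =
    match i, j with
    | n1, c1 => (Qpow (2^-1) * (qint q 2)%:C) *: x c0
    | n1, c0 => - (Qpow (- (3 / 2)) *: star (x c1))
    | n2, c2 => x c1
    | _, _ => 0
    end
}.

Record invariant_faithful_state (act : U -> A -> A) (phi : {scalar A}) : Prop :=
  InvariantFaithfulState {
  phi_1 : phi 1 = 1;
  phi_invariant : forall h a, phi (act h a) = counit h * phi a;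
  phi_ge0 : forall a, 0 <= phi (star a * a);
  phi_faithful : forall a, phi (star a * a) = 0 -> a = 0
}.

End Action.

Definition admissible (l m1 m2 j : int) : bool :=
  [&& 0 <= l, 0 <= j <= l, `|m1| <= j, `|m2| <= l - j
    & (2 %| l - j - `|m2|)%Z].

Definition label :=
  {x : int * int * int * int | admissible x.1.1.1 x.1.1.2 x.1.2 x.2}.

(* Kets with labels that are not admissible are 0. *)
Definition ket (V : zmodType) (e : label -> V) (l m1 m2 j : int) : V :=
  if insub (l, m1, m2, j) is Some x then e x else 0.

Section Formulas.
Variables (R : realType) (q : R).
Local Notation "[ z ]" := (qint q z) (at level 0, format "[ z ]").
Local Notation sqrt := Num.sqrt.
Local Notation half := (2^-1 : R).
Implicit Types l j m : int.

Definition coefA j m : R :=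
  q ^ (m - 1) *
  sqrt ([j + m + 1] * [j - m + 1] / ([2 * j + 1] * [2 * j + 3])).
Definition coefBp j m : R :=
  q `^ ((- j + m)%:~R - half) *
  sqrt ([j + m + 1] * [j + m + 2] / ([2 * j + 1] * [2 * j + 3])).
Definition coefBm j m : R :=
  - (q `^ ((j + m)%:~R + half)) *
  sqrt ([j - m] * [j - m - 1] / ([2 * j - 1] * [2 * j + 1])).
Definition coefCp l j m : R :=
  q ^ (m - 1) *
  sqrt ([l + j + m + 3] * [l + j - m + 3] / ([2 * l + 3] * [2 * l + 5])).
Definition coefCm l j m : R :=
  - (q ^ (m - 1)) *
  sqrt ([l - j + m] * [l - j - m] / ([2 * l + 1] * [2 * l + 3])).
Definition coefDp l j m : R :=
  q `^ ((- l + m)%:~R - 3 / 2) *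
  sqrt ([l + j + m + 3] * [l - j + m + 2] / ([2 * l + 3] * [2 * l + 5])).
Definition coefDm l j m : R :=
  q `^ ((l + m)%:~R + 3 / 2) *
  sqrt ([l - j - m] * [l + j - m + 1] / ([2 * l + 1] * [2 * l + 3])).

Definition regular_formulas (V : lmodType R[i]) (X : scoord -> V -> V)
    (k : int -> int -> int -> int -> V) : Prop :=
  forall l m1 m2 j, admissible l m1 m2 j ->
  [/\ X c0 (k l m1 m2 j) =
        (coefA j m1 * coefCp l j m2)%:C *: k (l + 1) m1 m2 (j + 1)
      + (coefA j m1 * coefCm l j m2)%:C *: k (l - 1) m1 m2 (j + 1)
      + (coefA (j - 1) m1 * coefCm (l + 1) (j - 1) m2)%:C
          *: k (l + 1) m1 m2 (j - 1)
      + (coefA (j - 1) m1 * coefCp (l - 1) (j - 1) m2)%:C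
          *: k (l - 1) m1 m2 (j - 1),
      X c1 (k l m1 m2 j) =
        (coefBp j m1 * coefCp l j m2)%:C *: k (l + 1) (m1 + 1) m2 (j + 1)
      + (coefBp j m1 * coefCm l j m2)%:C *: k (l - 1) (m1 + 1) m2 (j + 1)
      + (coefBm j m1 * coefCm (l + 1) (j - 1) m2)%:C
          *: k (l + 1) (m1 + 1) m2 (j - 1)
      + (coefBm j m1 * coefCp (l - 1) (j - 1) m2)%:C
          *: k (l - 1) (m1 + 1) m2 (j - 1)
    & X c2 (k l m1 m2 j) =
        (coefDp l j m2)%:C *: k (l + 1) m1 (m2 + 1) j
      + (coefDm l j m2)%:C *: k (l - 1) m1 (m2 + 1) j].

Definition sigma_a l j m : R :=
  [2]^-1 * sqrt ([l - j - m] * [l + j + m + 3] / ([2 * j + 1] * [2 * j + 3])).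
Definition sigma_c l j m : R :=
  [2]^-1 *
  sqrt ([l - j + m + 2] * [l + j - m + 1] / ([2 * j - 1] * [2 * j + 1])).

(* The kets of e transform like the orthonormal bases of the irreducible
   *-representations sigma_l: F_i is the adjoint of E_i for the form ip, for
   which e is orthonormal wherever this is used. *)
Definition sigma_formulas (V : lmodType R[i]) (ip : V -> V -> R[i])
    (K E F : node -> V -> V) (e : label -> V) : Prop :=
  let k := ket e in
  (forall l m1 m2 j, admissible l m1 m2 j ->
    [/\ K n1 (k l m1 m2 j) = (q ^ m1)%:C *: k l m1 m2 j,
        K n2 (k l m1 m2 j) = (q ^ (m2 - m1))%:C *: k l m1 m2 j,
        E n1 (k l m1 m2 j) =
          (sqrt ([j - m1] * [j + m1 + 1]))%:C *: k l (m1 + 1) m2 j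
      & E n2 (k l m1 m2 j) =
          (sqrt ([j - m1 + 1] * [j - m1 + 2]) * sigma_a l j m2)%:C
            *: k l (m1 - 1) (m2 + 1) (j + 1)
        + (sqrt ([j + m1] * [j + m1 - 1]) * sigma_c l j m2)%:C
            *: k l (m1 - 1) (m2 + 1) (j - 1)])
  /\ (forall i (y z : label), ip (e y) (F i (e z)) = ip (E i (e y)) (e z)).

End Formulas.

Definition orthonormal_family (C : numClosedFieldType) (V : lmodType C)
    (ip : V -> V -> C) (I : eqType) (e : I -> V) : Prop :=
  forall x y, ip (e x) (e y) = (x == y)%:R.

Definition fin_span (C : numClosedFieldType) (V : lmodType C) (I : eqType)
    (e : I -> V) : set V :=
  [set v | exists (s : seq I) (c : I -> C), v = \sum_(x <- s) c x *: e x]%classic.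

Definition linear_basis (C : numClosedFieldType) (V : lmodType C) (I : eqType)
    (e : I -> V) : Prop :=
  (forall (s : seq I) (c : I -> C), uniq s ->
     \sum_(x <- s) c x *: e x = 0 -> forall x, x \in s -> c x = 0)
  /\ (forall v, fin_span e v).

Section Completion.
Variables (R : realType) (q : R).
Local Notation A := (qsphere q).

Definition sphere_ip (phi : {scalar A}) (a b : A) : R[i] := phi (star a * b).

(* H, with inner product ip, is the completion of A via the isometry iota. *)
Record hilbert_completion (phi : {scalar A}) (H : completeNormedModType R[i])
    (ip : H -> H -> R[i]) (iota : {linear A -> H}) : Prop :=
  HilbertCompletion {
  ip_linear : forall u (c : R[i]) v w, ip u (c *: v + w) = c * ip u v + ip u w;
  ip_conj : forall u v, ip v u = Num.conj (ip u v);
  ip_norm : forall v, ip v v = `|v| ^+ 2;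
  iota_isometry : forall a b, ip (iota a) (iota b) = sphere_ip phi a b;
  iota_dense : dense (range iota)
}.

(* p is a representation of A on H by bounded operators that extends the left
   multiplication of A on itself. *)
Record left_regular (H : completeNormedModType R[i]) (iota : {linear A -> H})
    (p : A -> H -> H) : Prop := LeftRegular {
  lr_linear : forall a, linear (p a);
  lr_continuous : forall a, continuous (p a);
  lr_1 : forall v, p 1 v = v;
  lr_M : forall a b v, p (a * b) v = p a (p b v);
  lr_rep_linear : forall (c : R[i]) a b v, p (c *: a + b) v = c *: p a v + p b v;
  lr_extends : forall a b, p a (iota b) = iota (a * b)
}.

End Completion.

(* Main.v *)
(* The algebra A is realised on functions on the set of admissible labels by the
   formulas of the theorem, after rescaling the kets so that all coefficients are
   rational in powers of q and vanish on the steps that leave the admissible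
   labels.  The relations of A, and the compatibility of E_i and K_i with the
   generators, then become identities between rational functions of q^l, q^m1,
   q^m2, q^j.
   Write z = x0^2 + x1 x1^* = 1 - x2 x2^*, and x^(-n) for the n-th power of x^*.
   The elements x2^n x1^m x0^c z^k span A and, applied to the vacuum ket v, have
   distinct leading kets for the lexicographic order on (l, j); so a |-> a v is
   injective, and it is onto by induction on (l, j).  This identifies A with the
   model, and its U-module structure with the sum of the V_l.
   Invariance under K_i and E_i forces phi to vanish on all kets but the vacuum.
   Since the formulas for x_i and x_i^* are adjoint to each other, the kets are
   orthogonal.  Finally, the sphere relation bounds left multiplication, which
   therefore extends to the completion. *)

Require Import Defs.
From mathcomp Require Import all_boot all_order all_algebra.
From mathcomp Require Import all_classical all_reals all_analysis.
From mathcomp Require Import complex.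
From mathcomp Require Import ring zify.

Set Implicit Arguments.
Unset Strict Implicit.
Unset Printing Implicit Defensive.

Import Order.TTheory GRing.Theory Num.Theory.
Import numFieldNormedType.Exports.

Local Open Scope ring_scope.
Local Open Scope complex_scope.

(** The algebra is given only by generators and relations, so nothing in it is visibly nonzero, and
    the square roots of the target formulas would obstruct an automatic check of the relations.
    Dividing the ket of label [y] by [sqrt (gnorm y)] meets both: every entry becomes rational, with
    denominators built from [[2]], [[2j+1]] and [[2l+3]], which vanish at no integer label, so
    boundary labels need no separate treatment in these identities. The weight [gnorm] is the one
    for which the entry of a generator along a step and the entry of its adjoint along the reverse
    step are in the ratio of the weights at the two ends. The roots return at the end because a
    coefficient of the theorem is determined by its sign and its square, and its square is the
    product of those two entries. Orthogonality needs no explicit values of [phi] on products: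
    [phi a] is the vacuum coefficient of [a] applied to the vacuum, and the preimage of each ket is
    built together with the effect of its adjoint on that coefficient. *)

Notation idx := (int * int * int * int)%type.

Definition adm (y : idx) := admissible y.1.1.1 y.1.1.2 y.1.2 y.2.

(** * Weighted shift operators on functions of the label *)

Section ShiftOperators.
Context {R : realType}.
Notation V := (idx -> R[i]).

(* The entry [(d, c)] sends the basis vector [y] to [c y] times the basis vector
   [y + d]; vectors are functions of the label, so [oapp] reads [c] at [y - d]. *)
Definition shift_op := seq (idx * (idx -> R)).
Implicit Types (L M : shift_op) (f g : V) (y d : idx).

Definition oapp L f : V :=
  fun y => \sum_(p <- L) (p.2 (y - p.1))%:C * f (y - p.1).
Definition ocoef L d y : R :=
  foldr (fun p s => if p.1 == d then p.2 y + s else s) 0 L.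
Definition oshifts L : seq idx := undup [seq p.1 | p <- L].
Definition ocomp L M : shift_op :=
  [seq (p.1 + r.1, fun y => p.2 (y + r.1) * r.2 y) | p <- L, r <- M].
Definition oscale (c : R) L : shift_op :=
  [seq (p.1, fun y => c * p.2 y) | p <- L].
Definition oid : shift_op := [:: (0, fun => 1)].

Definition supported f := forall y, ~~ adm y -> f y = 0.

(* A conjunction over the finitely many shifts, so that it can be checked one
   rational identity at a time. *)
Definition same_action L M :=
  foldr (fun d P => (forall y, adm y -> ocoef L d y = ocoef M d y) /\ P) True
    (oshifts (L ++ M)).

Lemma oapp_cat L M f : oapp (L ++ M) f = oapp L f + oapp M f.
Proof. by apply/funext => y; rewrite /oapp big_cat. Qed.

Lemma oapp_scale c L f : oapp (oscale c L) f = c%:C *: oapp L f.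
Proof.
apply/funext => y; rewrite /oapp big_map fctE scaler_sumr.
by apply: eq_bigr => p _; rewrite rmorphM -mulrA.
Qed.

Lemma oapp_id f : oapp oid f = f.
Proof. by apply/funext => y; rewrite /oapp big_seq1 /= mul1r subr0. Qed.

Lemma oapp_comp L M f : oapp (ocomp L M) f = oapp L (oapp M f).
Proof.
apply/funext => y; rewrite /oapp big_allpairs_dep.
apply: eq_bigr => p _; rewrite mulr_sumr.
by apply: eq_bigr => r _; rewrite /= rmorphM mulrA opprD addrA subrK.
Qed.

Lemma oapp_linear L c f g : oapp L (c *: f + g) = c *: oapp L f + oapp L g.
Proof.
apply/funext => y; rewrite /oapp !fctE scaler_sumr -big_split /=.
apply: eq_bigr => p _; rewrite mulrDr; congr (_ + _).
by rewrite /*:%R /= mulrCA.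
Qed.

Lemma ocoefE L d y : ocoef L d y = \sum_(p <- L | p.1 == d) p.2 y.
Proof. by elim: L => [|p L IH]; rewrite ?big_nil // big_cons /= IH. Qed.

Lemma ocoef_out L d y : d \notin [seq p.1 | p <- L] -> ocoef L d y = 0.
Proof.
elim: L => //= p L IH; rewrite inE negb_or => /andP[dp /IH ->].
by rewrite eq_sym (negbTE dp).
Qed.

Lemma oapp_coef L (s : seq idx) f y : uniq s ->
  {subset [seq p.1 | p <- L] <= s} ->
  oapp L f y = \sum_(d <- s) (ocoef L d (y - d))%:C * f (y - d).
Proof.
move=> us Ls.
under [RHS]eq_bigr do rewrite ocoefE rmorph_sum mulr_suml.
rewrite (exchange_big_dep xpredT) //= /oapp big_seq [RHS]big_seq.
apply: eq_bigr => p pL; rewrite -big_filter.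
have -> : [seq i <- s | p.1 == i] = [:: p.1].
  rewrite (eq_filter (a2 := pred1 p.1)); last by move=> i /=; rewrite eq_sym.
  by apply: filter_pred1_uniq => //; apply/Ls/map_f.
by rewrite big_seq1.
Qed.

Lemma same_actionP L M :
  same_action L M <-> forall d y, adm y -> ocoef L d y = ocoef M d y.
Proof.
split=> [|LM].
  move=> LM d y ay.
  have [din|dout] := boolP (d \in oshifts (L ++ M)).
    move: din LM ay; rewrite /same_action.
    elim: oshifts => //= e s IH; rewrite inE => /orP[/eqP->|/IH IH'] [] He Hs.
      exact: He.
    exact: IH'.
  move: dout; rewrite mem_undup map_cat mem_cat negb_or => /andP[dL dM].
  by rewrite !ocoef_out.
by rewrite /same_action; elim: oshifts => //= d s IH; split=> // y; apply: LM.
Qed.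

Lemma same_action_oapp L M f : supported f -> same_action L M ->
  oapp L f = oapp M f.
Proof.
move=> sf /same_actionP LM; apply/funext => y.
have us : uniq (oshifts (L ++ M)) := undup_uniq _.
rewrite !(oapp_coef (s := oshifts (L ++ M))) //.
- apply: eq_bigr => d _; have [ady|nady] := boolP (adm (y - d)).
    by rewrite LM.
  by rewrite sf ?mulr0.
- by move=> d dM; rewrite mem_undup map_cat mem_cat dM orbT.
- by move=> d dL; rewrite mem_undup map_cat mem_cat dL.
Qed.

Definition stable L := forall p y, p \in [seq p.1 | p <- L] -> adm y ->
  ~~ adm (y + p) -> ocoef L p y = 0.

Definition delta y : V := fun z => (z == y)%:R.

Lemma supported_oapp L f : stable L -> supported f -> supported (oapp L f).
Proof.
move=> sL sf y nay.
rewrite (oapp_coef (s := oshifts L)) ?undup_uniq//; last first.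
  by move=> d; rewrite mem_undup.
rewrite big_seq big1// => d; rewrite mem_undup => dL.
have [a|na] := boolP (adm (y - d)); last by rewrite sf ?mulr0.
by rewrite sL ?mul0r// subrK.
Qed.

Lemma oapp_delta L y :
  oapp L (delta y) = \sum_(p <- L) (p.2 y)%:C *: delta (y + p.1).
Proof.
apply/funext => z; rewrite /oapp fct_sumE; apply: eq_bigr => p _.
rewrite /delta !fctE; case: (eqVneq z (y + p.1)) => [->|zy].
  by rewrite addrK eqxx.
by rewrite subr_eq (negbTE zy) !mulr0 /*:%R /= mulr0.
Qed.

End ShiftOperators.

(** * The generators as rational shift operators *)

Section Model.
Variables (R : realType) (q : R).
Hypotheses (q_gt0 : 0 < q) (q_lt1 : q < 1).
Local Notation "[ z ]" := (qint q z) (at level 0, format "[ z ]").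
Implicit Types l j m n : int.

(* The formulas of the theorem (resp. of [sigma_l]) for the kets divided by
   [sqrt gnorm], with [gnorm] defined below: the square roots disappear.  The
   labels [(l, m, n, j)] stand for [(l, m_1, m_2, j)]. *)
Definition opx0 : shift_op (R := R) := [::
  ((1, 0, 0, 1), fun '(l, m, n, j) =>
     q ^ (m - 1) * q ^ (n - 1) / ([2 * j + 1] * [2 * l + 3]));
  ((-1, 0, 0, 1), fun '(l, m, n, j) =>
     - (q ^ (m - 1) * q ^ (n - 1) * ([l - j + n] * [l - j - n])
        / ([2 * j + 1] * [2 * l + 3])));
  ((1, 0, 0, -1), fun '(l, m, n, j) =>
     - (q ^ (m - 1) * q ^ (n - 1) * ([j + m] * [j - m])
        / ([2 * j + 1] * [2 * l + 3])));
  ((-1, 0, 0, -1), fun '(l, m, n, j) =>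
     q ^ (m - 1) * q ^ (n - 1) * ([j + m] * [j - m])
     * ([l + j + n + 1] * [l + j - n + 1]) / ([2 * j + 1] * [2 * l + 3]))].

Definition opx1 : shift_op (R := R) := [::
  ((1, 1, 0, 1), fun '(l, m, n, j) =>
     q ^ (m - j) * q ^ (n - 1) / ([2 * j + 1] * [2 * l + 3]));
  ((-1, 1, 0, 1), fun '(l, m, n, j) =>
     - (q ^ (m - j) * q ^ (n - 1) * ([l - j + n] * [l - j - n])
        / ([2 * j + 1] * [2 * l + 3])));
  ((1, 1, 0, -1), fun '(l, m, n, j) =>
     q ^ (m + j + 1) * q ^ (n - 1) * ([j - m] * [j - m - 1])
     / ([2 * j + 1] * [2 * l + 3]));
  ((-1, 1, 0, -1), fun '(l, m, n, j) =>
     - (q ^ (m + j + 1) * q ^ (n - 1) * ([j - m] * [j - m - 1])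
        * ([l + j + n + 1] * [l + j - n + 1]) / ([2 * j + 1] * [2 * l + 3])))].

Definition opx1s : shift_op (R := R) := [::
  ((1, -1, 0, 1), fun '(l, m, n, j) =>
     - (q ^ (m + j) * q ^ (n - 1) / ([2 * j + 1] * [2 * l + 3])));
  ((-1, -1, 0, 1), fun '(l, m, n, j) =>
     q ^ (m + j) * q ^ (n - 1) * ([l - j + n] * [l - j - n])
     / ([2 * j + 1] * [2 * l + 3]));
  ((1, -1, 0, -1), fun '(l, m, n, j) =>
     - (q ^ (m - j - 1) * q ^ (n - 1) * ([j + m] * [j + m - 1])
        / ([2 * j + 1] * [2 * l + 3])));
  ((-1, -1, 0, -1), fun '(l, m, n, j) =>
     q ^ (m - j - 1) * q ^ (n - 1) * ([j + m] * [j + m - 1])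
     * ([l + j + n + 1] * [l + j - n + 1]) / ([2 * j + 1] * [2 * l + 3]))].

Definition opx2 : shift_op (R := R) := [::
  ((1, 0, 1, 0), fun '(l, m, n, j) => q ^ (n - l - 1) / [2 * l + 3]);
  ((-1, 0, 1, 0), fun '(l, m, n, j) =>
     q ^ (n + l + 2) * ([l - j - n] * [l + j - n + 1]) / [2 * l + 3])].

Definition opx2s : shift_op (R := R) := [::
  ((1, 0, -1, 0), fun '(l, m, n, j) => q ^ (n + l + 1) / [2 * l + 3]);
  ((-1, 0, -1, 0), fun '(l, m, n, j) =>
     q ^ (n - l - 2) * ([l + j + n + 1] * [l - j + n]) / [2 * l + 3])].

Definition opE1 : shift_op (R := R) :=
  [:: ((0, 1, 0, 0), fun '(l, m, n, j) => [j - m])].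
Definition opE2 : shift_op (R := R) := [::
  ((0, -1, 1, 1), fun '(l, m, n, j) => [l - j - n] / ([2] * [2 * j + 1]));
  ((0, -1, 1, -1), fun '(l, m, n, j) =>
     [j + m] * [j + m - 1] * [l + j - n + 1] / ([2] * [2 * j + 1]))].
Definition opK1 : shift_op (R := R) := [:: (0, fun '(l, m, n, j) => q ^ m)].
Definition opK2 : shift_op (R := R) :=
  [:: (0, fun '(l, m, n, j) => q ^ (n - m))].

Lemma q_neq0 : q != 0. Proof. by rewrite gt_eqF. Qed.

Lemma expq_neq1 (n : nat) : (0 < n)%N -> q ^+ n - 1 != 0.
Proof. by move=> n0; rewrite subr_eq0 lt_eqF// exprn_ilt1 -?lt0n ?(ltW q_gt0). Qed.

Lemma exprz_neq1 (z : int) : z != 0 -> q ^ z != 1.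
Proof.
case: z => [[|n]|n] //; first by move=> _; rewrite -subr_eq0 expq_neq1.
rewrite NegzE -exprnN => _; rewrite gt_eqF//.
by rewrite invf_gt1 ?exprn_gt0// exprn_ilt1 ?(ltW q_gt0).
Qed.

Lemma exprzN (z : int) : q ^ (- z) = (q ^ z)^-1.
Proof. by rewrite -invr_expz. Qed.
Lemma exprz_double (z : int) : q ^ (2 * z) = q ^ z * q ^ z.
Proof. by rewrite mulr_natl mulr2n expfzDr // q_neq0. Qed.
Lemma exprzD (x y : int) : q ^ (x + y) = q ^ x * q ^ y.
Proof. by rewrite expfzDr // q_neq0. Qed.

Lemma exprz_nat (k : nat) : q ^ (k%:R : int) = q ^+ k.
Proof. by rewrite natz. Qed.

(* The form in which [field] leaves the conditions on [[2j + 1]] and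
   [[2l + 3]], up to a shift of the label. *)
Lemma exprz4_neq1 (z : int) (k : nat) : odd k ->
  (q ^ z) ^+ 2 * q ^+ k * ((q ^ z) ^+ 2 * q ^+ k) - 1 != 0.
Proof.
move=> ok; rewrite subr_eq0.
have -> : (q ^ z) ^+ 2 * q ^+ k * ((q ^ z) ^+ 2 * q ^+ k)
    = q ^ (2 * (2 * z + k%:Z)).
  by rewrite exprz_double exprzD exprz_double -exprnP; ring.
by apply: exprz_neq1; lia.
Qed.

Lemma exprz4_neq1S (z : int) (k : nat) : odd k ->
  (q ^ z * q) ^+ 2 * q ^+ k * ((q ^ z * q) ^+ 2 * q ^+ k) - 1 != 0.
Proof.
move=> ok; have -> : q ^ z * q = q ^ (z + 1) by rewrite exprzD expr1z.
exact: exprz4_neq1.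
Qed.

(** This is [[2z - 1] <> 0] cleared of denominators: [q^(4z)] differs from [q^2] because [2z - 1] is
    odd. *)
Lemma exprz4_neq (z : int) : (q ^ z * q ^ z) ^+ 2 + - q * q != 0.
Proof.
rewrite mulNr subr_eq0.
have -> : (q ^ z * q ^ z) ^+ 2 = q ^ (2 * (2 * z - 1)) * (q * q).
  by rewrite !(exprz_double, exprzD, exprzN, expr1z); field; rewrite q_neq0.
rewrite -subr_eq0 -{2}[q * q]mul1r -mulrBl mulf_neq0 ?mulf_neq0 ?q_neq0//.
by rewrite subr_eq0 exprz_neq1//; lia.
Qed.

Definition exprzE := (exprz_nat, exprzN, exprz_double, exprzD, expr1z, expr0z).

(** The bracket as a rational function of [x = q^z], so that [field] sees only the unknowns [q],
    [q^l], [q^m], [q^n], [q^j]. *)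
Definition br (x : R) : R := (x - x^-1) / (q - q^-1).
Lemma qint_br z : qint q z = br (q ^ z). Proof. by rewrite /br -exprzN. Qed.

Lemma qintE :
  (forall l, [2 * l + 3] = br ((q ^ l) ^+ 2 * q ^+ 3)) *
  ((forall j, [2 * j + 1] = br ((q ^ j) ^+ 2 * q)) *
  (([2] = br (q ^+ 2)) *
  ((forall l j n, [l + j + n + 1] = br (q ^ l * q ^ j * q ^ n * q)) *
  ((forall l j n, [l + j - n + 1] = br (q ^ l * q ^ j / q ^ n * q)) *
  ((forall l j n, [l - j + n] = br (q ^ l / q ^ j * q ^ n)) *
  ((forall l j n, [l - j - n] = br (q ^ l / q ^ j / q ^ n)) *
  ((forall j m, [j - m - 1] = br (q ^ j / q ^ m / q)) *
  ((forall j m, [j + m - 1] = br (q ^ j * q ^ m / q)) *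
  ((forall j m, [j + m] = br (q ^ j * q ^ m)) *
  (forall j m, [j - m] = br (q ^ j / q ^ m)))))))))))%type.
Proof. by do !split => *; rewrite qint_br ?exprzE ?expr2. Qed.

End Model.

Ltac nonzero_condition :=
  repeat (apply/andP; split); rewrite ?oner_eq0 //;
  match goal with
  | H : is_true (?Q != 0) |- is_true (?P != 0) =>
      rewrite (_ : P = Q); [exact: H | ring]
  end.

(** The four powers of [q] are generalised to independent nonzero variables; the facts put in the
    context before that supply the nonvanishing of the denominators. *)
Ltac check_shift q q0 q1 :=
  let l := fresh in let m := fresh in let n := fresh in let j := fresh in
  move=> [[[l m] n] j] _ /=;
  cbn -[GRing.add GRing.mul GRing.opp GRing.zero GRing.one eq_op exprz br
        GRing.inv intmul GRing.natmul GRing.exp];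
  repeat (match goal with |- context [if ?c then _ else _] =>
     let v := eval vm_compute in c in change c with v end; cbv iota);
  rewrite !(qintE q0) ?(exprzD q0) ?exprzN ?(exprzD q0) ?exprzN ?expr1z
    ?expr0z ?exprz_nat /br;
  have := expq_neq1 q0 q1 (n := 4) isT;
  have := expq_neq1 q0 q1 (n := 2) isT; rewrite [q ^+ 2]expr2;
  have := q_neq0 q0;
  have := exprz4_neq1 q0 q1 l (k := 1) isT;
  have := exprz4_neq1 q0 q1 l (k := 3) isT;
  have := exprz4_neq1S q0 q1 l (k := 3) isT;
  have := exprz4_neq1 q0 q1 j (k := 1) isT;
  have := exprz4_neq1S q0 q1 j (k := 1) isT;
  have := exprz4_neq q0 q1 j;
  have := expfz_neq0 l (q_neq0 q0); have := expfz_neq0 m (q_neq0 q0);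
  have := expfz_neq0 n (q_neq0 q0); have := expfz_neq0 j (q_neq0 q0);
  rewrite !expr1; move: (q ^ l) (q ^ m) (q ^ n) (q ^ j)
    => ? ? ? ? ? ? ? ? ? ? ? ? ? ? ? ? ?;
  field; nonzero_condition.

Ltac check_same_action q q0 q1 :=
  rewrite /same_action;
  match goal with |- context [oshifts ?s] =>
    let v := eval vm_compute in (oshifts s) in change (oshifts s) with v end;
  cbn [foldr];
  repeat (match goal with |- True => exact I | |- _ /\ _ => split end);
  check_shift q q0 q1.

(** * The relations of the algebra and of its symmetry, checked in the model *)

Section Relations.
Variables (R : realType) (q : R).
Hypotheses (q0 : 0 < q) (q1 : q < 1).
Local Notation x0 := (opx0 q).
Local Notation x1 := (opx1 q).
Local Notation x2 := (opx2 q).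
Local Notation x1s := (opx1s q).
Local Notation x2s := (opx2s q).
Local Notation E1 := (opE1 q).
Local Notation E2 := (opE2 q).
Local Notation "L * M" := (ocomp L M).
Local Notation "L + M" := (L ++ M).
Local Notation "c *: L" := (oscale c%R L).

Lemma rel_x0x1 : same_action (x0 * x1)
  (q ^+ 2 *: (x1 * x0)).
Proof. check_same_action q q0 q1. Qed.

Lemma rel_x0x2 : same_action (x0 * x2)
  (q ^+ 2 *: (x2 * x0)).
Proof. check_same_action q q0 q1. Qed.

Lemma rel_x1x2 : same_action (x1 * x2)
  (q ^+ 2 *: (x2 * x1)).
Proof. check_same_action q q0 q1. Qed.

Lemma rel_x1sx0 : same_action (x1s * x0)
  (q ^+ 2 *: (x0 * x1s)).
Proof. check_same_action q q0 q1. Qed.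

Lemma rel_x2sx0 : same_action (x2s * x0)
  (q ^+ 2 *: (x0 * x2s)).
Proof. check_same_action q q0 q1. Qed.

Lemma rel_x2sx1s : same_action (x2s * x1s)
  (q ^+ 2 *: (x1s * x2s)).
Proof. check_same_action q q0 q1. Qed.

Lemma rel_x1sx2 : same_action (x1s * x2)
  (q ^+ 2 *: (x2 * x1s)).
Proof. check_same_action q q0 q1. Qed.

Lemma rel_x2sx1 : same_action (x2s * x1)
  (q ^+ 2 *: (x1 * x2s)).
Proof. check_same_action q q0 q1. Qed.

Lemma rel_x1sx1 : same_action (x1s * x1 + -1 *: (x1 * x1s))
  ((1 - q ^+ 4) *: (x0 * x0)).
Proof. check_same_action q q0 q1. Qed.

Lemma rel_x2sx2 : same_action (x2s * x2 + -1 *: (x2 * x2s))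
  (x1s * x1 + -1 *: (q ^+ 4 *: (x1 * x1s))).
Proof. check_same_action q q0 q1. Qed.

Lemma rel_sphere : same_action (x0 * x0 + x1 * x1s + x2 * x2s)
  (@oid R).
Proof. check_same_action q q0 q1. Qed.

(** This and the next nine identities are the coproduct rule [E u = (E.u) K + (K^-1.u) E] for a
    generator or adjoint [u], with [E_1] divided by [q^(1/2)]; this is why [q^-1] stands here where
    the action has [q^(-1/2)]. *)
Lemma rel_E1x0 : same_action (E1 * x0)
  (q^-1 *: (x1 * opK1 q) + x0 * E1).
Proof. check_same_action q q0 q1. Qed.

Lemma rel_E1x1 : same_action (E1 * x1)
  (q^-1 *: (x1 * E1)).
Proof. check_same_action q q0 q1. Qed.

Lemma rel_E1x1s : same_action (E1 * x1s)
  ((- (q * qint q 2)) *: (x0 * opK1 q) + q *: (x1s * E1)).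
Proof. check_same_action q q0 q1. Qed.

Lemma rel_E1x2 : same_action (E1 * x2)
  (x2 * E1).
Proof. check_same_action q q0 q1. Qed.

Lemma rel_E1x2s : same_action (E1 * x2s)
  (x2s * E1).
Proof. check_same_action q q0 q1. Qed.

Lemma rel_E2x0 : same_action (E2 * x0)
  (x0 * E2).
Proof. check_same_action q q0 q1. Qed.

Lemma rel_E2x1 : same_action (E2 * x1)
  (x2 * opK2 q + q *: (x1 * E2)).
Proof. check_same_action q q0 q1. Qed.

Lemma rel_E2x1s : same_action (E2 * x1s)
  (q^-1 *: (x1s * E2)).
Proof. check_same_action q q0 q1. Qed.

Lemma rel_E2x2 : same_action (E2 * x2)
  (q^-1 *: (x2 * E2)).
Proof. check_same_action q q0 q1. Qed.

Lemma rel_E2x2s : same_action (E2 * x2s)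
  ((- q ^+ 2) *: (x1s * opK2 q) + q *: (x2s * E2)).
Proof. check_same_action q q0 q1. Qed.

End Relations.

Ltac admlia :=
  repeat match goal with H : context [adm _] |- _ => revert H end;
  rewrite /adm /admissible /=; lia.

(** * Steps that leave the admissible labels have coefficient zero *)

Section Stability.
Variables (R : realType) (q : R).
Lemma qint0 : qint q 0 = 0.
Proof. by rewrite /qint oppr0 expr0z subrr mul0r. Qed.

(** A step to an inadmissible label meets a bracket with argument zero: if all the arguments are
    nonzero, linear arithmetic (with the parity condition) makes the target admissible. *)
Ltac check_stable :=
  move=> + [[[? ?] ?] ?] => ?; rewrite /= !inE;
  repeat case/orP; move=> /eqP-> ? ?;
  cbn -[GRing.add GRing.mul GRing.opp GRing.zero GRing.one eq_op exprz qint
        GRing.inv intmul GRing.natmul GRing.exp];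
  repeat (match goal with |- context [if ?c then _ else _] =>
     let v := eval vm_compute in c in change c with v end; cbv iota);
  repeat match goal with |- context [qint q ?z] =>
    case: (eqVneq z 0) => [->|?];
    [by rewrite qint0 ?(mul0r, mulr0, oppr0, addr0, invr0)
    | move: (qint q z) => ?] end;
  exfalso; admlia.

Lemma stable_x0 : stable (opx0 q). Proof. check_stable. Qed.
Lemma stable_x1 : stable (opx1 q). Proof. check_stable. Qed.
Lemma stable_x2 : stable (opx2 q). Proof. check_stable. Qed.
Lemma stable_x1s : stable (opx1s q). Proof. check_stable. Qed.
Lemma stable_x2s : stable (opx2s q). Proof. check_stable. Qed.
Lemma stable_E1 : stable (opE1 q). Proof. check_stable. Qed.
Lemma stable_E2 : stable (opE2 q). Proof. check_stable. Qed.
End Stability.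

(** * The presented algebra acting on supported functions *)

Section Representation.
Variables (R : realType) (q : R).
Hypotheses (q0 : 0 < q) (q1 : q < 1).
Notation V := (idx -> R[i]).
Notation T := (sterm R[i] scoord).
Notation A := (qsphere q).
Implicit Types (f g : V) (s t : T) (a b : A).

Definition opgen (i : scoord) (st : bool) : shift_op (R := R) :=
  match i with
  | c0 => opx0 q
  | c1 => if st then opx1s q else opx1 q
  | c2 => if st then opx2s q else opx2 q
  end.

Lemma stable_opgen i st : stable (opgen i st).
Proof.
by case: i st => [] [];
  [exact: stable_x0 | exact: stable_x0 | exact: stable_x1s | exact: stable_x1
  |exact: stable_x2s| exact: stable_x2].
Qed.

(* [ev t true] is the action of the adjoint of [t]. *)
Fixpoint ev (t : T) (st : bool) f : V :=
  match t with
  | SGen i => oapp (opgen i st) f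
  | SCst c => (if st then Num.conj c else c) *: f
  | SAdd s t => ev s st f + ev t st f
  | SMul s t => if st then ev t st (ev s st f) else ev s st (ev t st f)
  | SStar t => ev t (~~ st) f
  end.

Lemma ev_linear t st c f g : ev t st (c *: f + g) = c *: ev t st f + ev t st g.
Proof.
elim: t st f g c => [i|k|s IHs t IHt|s IHs t IHt|t IHt] st f g c /=.
- exact: oapp_linear.
- by rewrite scalerDr !scalerA mulrC.
- by rewrite IHs IHt scalerDr addrACA.
- by case: st; rewrite (IHs, IHt) (IHt, IHs).
- exact: IHt.
Qed.

Lemma ev0 t st : ev t st 0 = 0.
Proof.
have := ev_linear t st (-1) 0 0.
by rewrite !scaleN1r addr0 oppr0 addNr.
Qed.
Lemma evZ t st c f : ev t st (c *: f) = c *: ev t st f.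
Proof. by rewrite -[c *: f]addr0 ev_linear ev0 addr0. Qed.

Lemma evD t st f g : ev t st (f + g) = ev t st f + ev t st g.
Proof. by rewrite -[f in LHS]scale1r ev_linear scale1r. Qed.

Lemma supportedZ c f : supported f -> supported (c *: f).
Proof. by move=> sf y /sf fy; rewrite /= fctE fy scaler0. Qed.
Lemma supportedD f g : supported f -> supported g -> supported (f + g).
Proof. by move=> sf sg y ay; rewrite fctE sf ?sg// addr0. Qed.

Lemma supported_ev t st f : supported f -> supported (ev t st f).
Proof.
elim: t st f => [i|k|s IHs t IHt|s IHs t IHt|t IHt] st f sf /=.
- exact/supported_oapp/sf/stable_opgen.
- exact: supportedZ.
- by apply: supportedD; [apply: IHs|apply: IHt].
- by case: st; [apply/IHt/IHs|apply/IHs/IHt].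
- exact: IHt.
Qed.

Lemma conjC_real (x : R) : Num.conj (x%:C) = x%:C :> R[i].
Proof. exact: conjc_real. Qed.

Lemma oappZ L c f : oapp L (c *: f) = c *: oapp L f.
Proof.
have l0 : oapp L 0 = 0 :> V.
  by apply/funext => y; rewrite /oapp big1// => p _; rewrite mulr0.
by rewrite -[c *: f]addr0 oapp_linear l0 addr0.
Qed.

Lemma ev_scale_real (x : R) t st f :
  ev (SScale x%:C t) st f = x%:C *: ev t st f.
Proof. by case: st => //=; rewrite evZ conjC_real. Qed.

Lemma ev_sub s t st f :
  ev (SSub s t) st f = ev s st f + (- 1)%:C *: ev t st f.
Proof. by rewrite -ev_scale_real rmorphN1. Qed.

(** For [st = true] the adjoint relation is needed, and it is again one of those checked: the
    adjoint of [x0 x1 = q^2 x1 x0], for instance, is [rel_x1sx0]. *)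
Lemma sphere_rel_ev s t : sphere_rel q s t ->
  forall st f, supported f -> ev s st f = ev t st f.
Proof.
have rQ n : (q%:C ^+ n : R[i]) = (q ^+ n)%:C by rewrite rmorphXn.
pose same L M f (sf : supported f) (LM : same_action L M) :=
  same_action_oapp sf LM.
have qc L M L' M' c f : supported f ->
    same_action (ocomp L M) (oscale c (ocomp L' M')) ->
    oapp L (oapp M f) = c%:C *: oapp L' (oapp M' f).
  move=> sf LM; rewrite -oapp_comp (same_action_oapp sf LM).
  by rewrite oapp_scale oapp_comp.
case=> [|i j ij|i j ij|||] st f sf.
- by case: st.
- rewrite rQ ev_scale_real.
  case: i j ij => [] [] ij; try discriminate ij; case: st;
    apply: (qc _ _ _ _ _ _ sf).
  + exact: (rel_x1sx0 q0 q1).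
  + exact: (rel_x0x1 q0 q1).
  + exact: (rel_x2sx0 q0 q1).
  + exact: (rel_x0x2 q0 q1).
  + exact: (rel_x2sx1s q0 q1).
  + exact: (rel_x1x2 q0 q1).
- rewrite rQ ev_scale_real.
  case: i j ij => [] [] ij; try (exfalso; exact: (ij erefl)); case: st;
    apply: (qc _ _ _ _ _ _ sf).
  + exact: (rel_x1sx0 q0 q1).
  + exact: (rel_x0x1 q0 q1).
  + exact: (rel_x2sx0 q0 q1).
  + exact: (rel_x0x2 q0 q1).
  + exact: (rel_x0x1 q0 q1).
  + exact: (rel_x1sx0 q0 q1).
  + exact: (rel_x2sx1 q0 q1).
  + exact: (rel_x1sx2 q0 q1).
  + exact: (rel_x0x2 q0 q1).
  + exact: (rel_x2sx0 q0 q1).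
  + exact: (rel_x1sx2 q0 q1).
  + exact: (rel_x2sx1 q0 q1).
- have -> : 1 - q%:C ^+ 4 = (1 - q ^+ 4)%:C :> R[i] by rewrite rmorphB rQ.
  have := same_action_oapp sf (rel_x1sx1 q0 q1).
  rewrite oapp_cat !oapp_scale !oapp_comp => E.
  by rewrite ev_scale_real ev_sub; case: st; apply: E.
- have := same_action_oapp sf (rel_x2sx2 q0 q1).
  rewrite (oapp_cat (ocomp (opx2s q) _)) (oapp_cat (ocomp (opx1s q) _)).
  rewrite !oapp_scale !oapp_comp => E.
  by rewrite !ev_sub rQ ev_scale_real; case: st; apply: E.
- have := same_action_oapp sf (rel_sphere q0 q1).
  rewrite (oapp_cat (ocomp _ _ ++ _)) (oapp_cat (ocomp (opx0 q) _)).
  rewrite !oapp_comp oapp_id => E.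
  rewrite -[RHS]/((if st then Num.conj 1 else 1) *: f) rmorph1 if_same scale1r.
  by case: st; apply: E.
Qed.

(** The two values of [st] are carried through the induction together because the star rule
    exchanges them. In the product rules the inductive hypothesis is applied to an image vector,
    which is where preservation of supports enters. *)
Lemma scong_ev s t : scong (sphere_rel q) s t ->
  forall st f, supported f -> ev s st f = ev t st f.
Proof.
elim=> {s t} /=.
- by [].
- by move=> s t _ IH st f sf; rewrite IH.
- by move=> s t u _ IH _ IH' st f sf; rewrite IH ?IH'.
- by move=> s s' t _ IH st f sf; rewrite IH.
- move=> s s' t _ IH [] f sf; first by rewrite IH.
  by rewrite IH//; apply: supported_ev.
- move=> s t t' _ IH [] f sf; last by rewrite IH.
  by rewrite IH//; apply: supported_ev.
- by move=> s t _ IH st f sf; rewrite IH.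
- by move=> s t u st f _; rewrite addrA.
- by move=> s t st f _; rewrite addrC.
- by move=> t st f _; rewrite rmorph0 if_same scale0r add0r.
- move=> t [] f _; rewrite ?evZ ?rmorphN1 ?rmorph0 scaleN1r scale0r addNr//.
- by move=> s t u [].
- by move=> t [] f _; rewrite ?rmorph1 scale1r.
- by move=> s t u [] f _; rewrite ?evD.
- by move=> s t u [] f _; rewrite ?evD.
- by move=> a b [] f _; rewrite ?rmorphD scalerDl.
- by move=> a b [] f _; rewrite ?rmorphM scalerA // mulrC.
- by move=> a t [] f _; rewrite evZ.
- by move=> t st f _; rewrite negbK.
- by [].
- by move=> s t [].
- by move=> a [] f _; rewrite /= ?conjCK.
- exact: sphere_rel_ev.
Qed.

(** Evaluation on a chosen representative; by [scong_ev] the choice is immaterial on supported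
    vectors, whence the support conditions from here on. *)
Definition rho a f : V := ev (repr a) false f.
Definition rhoS a f : V := ev (repr a) true f.

Lemma rho_pr t f : supported f -> rho (pr (sphere_rel q) t) f = ev t false f.
Proof. by move=> sf; apply: scong_ev => //; apply: repr_pr. Qed.
Lemma rhoS_pr t f : supported f -> rhoS (pr (sphere_rel q) t) f = ev t true f.
Proof. by move=> sf; apply: scong_ev => //; apply: repr_pr. Qed.

Lemma supported_rho a f : supported f -> supported (rho a f).
Proof. exact: supported_ev. Qed.
Lemma rhoD a b f : supported f -> rho (a + b) f = rho a f + rho b f.
Proof.
move=> sf; elim/presented_ind: a => s; elim/presented_ind: b => t.
by rewrite -prD !rho_pr.
Qed.
Lemma rhoZ c a f : supported f -> rho (c *: a) f = c *: rho a f.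
Proof.
by move=> sf; elim/presented_ind: a => s; rewrite -prZ !rho_pr.
Qed.
Lemma rhoM a b f : supported f -> rho (a * b) f = rho a (rho b f).
Proof.
move=> sf; elim/presented_ind: a => s; elim/presented_ind: b => t.
by rewrite -prM !rho_pr//; apply: supported_ev.
Qed.
Lemma rho1 f : supported f -> rho 1 f = f.
Proof.
move=> sf; rewrite -[1]/(pr (sphere_rel q) (SCst _ 1)) rho_pr//=.
by rewrite scale1r.
Qed.
Lemma rho_star a f : supported f -> rho (star a) f = rhoS a f.
Proof.
by move=> sf; elim/presented_ind: a => s; rewrite -prS rho_pr// rhoS_pr.
Qed.
Lemma rho_xgen i f : supported f -> rho (xgen q i) f = oapp (opgen i false) f.
Proof. by move=> sf; rewrite rho_pr. Qed.
Lemma rho_xgen_star i f : supported f ->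
  rho (star (xgen q i)) f = oapp (opgen i true) f.
Proof. by move=> sf; rewrite rho_star// rhoS_pr. Qed.

End Representation.

(** * Finite linear spans *)

Section FiniteSpan.
Variables (C : numClosedFieldType) (V : lmodType C) (I : eqType) (e : I -> V).

(** Unlike in [fin_span] the list has no repetitions, so each coefficient can be isolated by
    singling out one term. *)
Definition lspan (v : V) :=
  exists (s : seq I) (c : I -> C), uniq s /\ v = \sum_(x <- s) c x *: e x.

Lemma sum_extend (s t : seq I) (F : I -> V) : uniq s -> uniq t ->
  {subset s <= t} ->
  \sum_(x <- s) F x = \sum_(x <- t) (if x \in s then F x else 0).
Proof.
move=> us ut st; rewrite -big_mkcond /= -[RHS]big_filter; apply: perm_big.
apply: uniq_perm => //; first exact: filter_uniq.
by move=> x; rewrite mem_filter andb_idr//; apply: st.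
Qed.

Lemma lspan_linear c u v : lspan u -> lspan v -> lspan (c *: u + v).
Proof.
move=> [s [a [us ->]]] [t [b [ut ->]]].
pose r := undup (s ++ t); have ur : uniq r := undup_uniq _.
have sr : {subset s <= r} by move=> x xs; rewrite mem_undup mem_cat xs.
have tr : {subset t <= r} by move=> x xs; rewrite mem_undup mem_cat xs orbT.
exists r, (fun x => c * (if x \in s then a x else 0)
                    + (if x \in t then b x else 0)); split=> //.
rewrite (sum_extend _ us ur sr) (sum_extend _ ut ur tr) scaler_sumr -big_split.
apply: eq_bigr => x _ /=; rewrite scalerDl -scalerA; congr (_ *: _ + _).
  by case: ifP => //; rewrite scale0r.
by case: ifP => //; rewrite scale0r.
Qed.

Lemma lspan0 : lspan 0.
Proof. by exists [::], (fun=> 0); rewrite big_nil. Qed.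
Lemma lspan_e x : lspan (e x).
Proof. by exists [:: x], (fun=> 1); rewrite big_seq1 scale1r. Qed.
Lemma lspanZ c u : lspan u -> lspan (c *: u).
Proof. by move=> su; rewrite -[_ *: _]addr0; apply/lspan_linear/lspan0. Qed.
Lemma lspanB u v : lspan u -> lspan v -> lspan (u - v).
Proof. by move=> su sv; rewrite -scaleN1r addrC; apply: lspan_linear. Qed.

Lemma lspan_sub (J : eqType) (s : seq J) (c : J -> C) (f : J -> V) :
  (forall x, x \in s -> lspan (f x)) -> lspan (\sum_(x <- s) c x *: f x).
Proof.
elim: s => [|x s IH] sf; first by rewrite big_nil; apply: lspan0.
rewrite big_cons; apply: lspan_linear; first by apply: sf; rewrite inE eqxx.
by apply: IH => y ys; apply: sf; rewrite inE ys orbT.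
Qed.

End FiniteSpan.

(** * The involution, and induction on words *)

Section StarAlgebra.
Variables (C : numClosedFieldType) (X : Type).
Variable rel : sterm C X -> sterm C X -> Prop.
Implicit Types a b : presented rel.

Lemma starD a b : star (a + b) = star a + star b.
Proof.
elim/presented_ind: a => s; elim/presented_ind: b => t.
by rewrite -prD -!prS -prD; apply/prP/sc_starD.
Qed.
Lemma starM a b : star (a * b) = star b * star a.
Proof.
elim/presented_ind: a => s; elim/presented_ind: b => t.
by rewrite -prM -!prS -prM; apply/prP/sc_starM.
Qed.
Lemma starK : involutive (@star _ _ rel).
Proof. by elim/presented_ind => s; rewrite -!prS; apply/prP/sc_starK. Qed.
Lemma starZ c a : star (c *: a) = Num.conj c *: star a.
Proof.
elim/presented_ind: a => s; rewrite -prZ -!prS -prZ; apply/prP.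
apply: sc_trans (sc_starM _ _ _) _.
apply: sc_trans (sc_mulr _ (sc_starC _ _)) _.
exact: sc_sym (sc_cstC _ _ _).
Qed.
Lemma star1 : star (1 : presented rel) = 1.
Proof.
rewrite -[1]/(pr rel (SCst X 1)) -prS; apply/prP.
by rewrite -[X in scong _ _ (SCst _ X)](rmorph1 Num.conj); apply: sc_starC.
Qed.
Lemma star0 : star (0 : presented rel) = 0.
Proof. by have := starZ 0 0; rewrite rmorph0 !scale0r. Qed.
Lemma starN a : star (- a) = - star a.
Proof. by rewrite -scaleN1r starZ rmorphN1 scaleN1r. Qed.
Lemma starB a b : star (a - b) = star a - star b.
Proof. by rewrite starD starN. Qed.

(** The induction on terms proves that left multiplication by a term and by its adjoint both
    preserve [P]; having both settles the star case, where they are swapped. *)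
Lemma presented_word_ind (P : presented rel -> Prop) :
  P 1 -> (forall c a b, P a -> P b -> P (c *: a + b)) ->
  (forall x a, P a -> P (gen rel x * a)) ->
  (forall x a, P a -> P (star (gen rel x) * a)) -> forall a, P a.
Proof.
move=> P1 Plin Pgen Pstar.
have P0 : P 0 by have := Plin (- 1) 1 1 P1 P1; rewrite scaleN1r addNr.
have PZ c a : P a -> P (c *: a).
  by move=> Pa; rewrite -[_ *: _]addr0; apply: Plin.
have PD a b : P a -> P b -> P (a + b).
  by move=> Pa Pb; rewrite -[a]scale1r; apply: Plin.
suff H t : (forall b, P b -> P (pr rel t * b)) /\
           (forall b, P b -> P (star (pr rel t) * b)).
  elim/presented_ind => t; rewrite -[pr _ _]mulr1.
  exact: (proj1 (H t)).
elim: t => [x|c|s [IHs IHs'] t [IHt IHt']|s [IHs IHs'] t [IHt IHt']|t [IH IH']].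
- by split=> b; [apply: Pgen | apply: Pstar].
- rewrite prC starZ star1; split=> b Pb; rewrite -presented_scaleAl mul1r;
  exact: PZ.
- rewrite prD starD; split=> b Pb; rewrite mulrDl; apply: PD; auto.
- rewrite prM starM; split=> b Pb; rewrite -mulrA; auto.
- by rewrite prS starK.
Qed.

End StarAlgebra.

(** * A spanning family of monomials *)

Section SphereAlgebra.
Variables (R : realType) (q : R).
Hypothesis q0 : 0 < q.
Local Notation A := (qsphere q).
Local Notation Q := (q%:C).
Local Notation x := (xgen q).
Local Notation x0 := (xgen q c0).
Local Notation x1 := (xgen q c1).
Local Notation x2 := (xgen q c2).
Implicit Types a b c d : A.

Lemma qC_neq0 : Q != 0.
Proof. by rewrite fmorph_eq0 gt_eqF. Qed.

Let pE := (prZ, prB, prM, prD, prS).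
Lemma star_x0 : star x0 = x0.
Proof. by rewrite -[RHS](pr_rel (sr_x0 q)) prS. Qed.
Lemma xx_comm (i j : scoord) : (i < j)%N -> x i * x j = Q ^+ 2 *: (x j * x i).
Proof. by move=> ij; have := pr_rel (sr_xx q ij); rewrite !pE. Qed.
Lemma xsx_comm (i j : scoord) : i <> j ->
  star (x i) * x j = Q ^+ 2 *: (x j * star (x i)).
Proof. by move=> ij; have := pr_rel (sr_xsx q ij); rewrite !pE. Qed.
Lemma x1s_x1_rel :
  star x1 * x1 = x1 * star x1 + (1 - Q ^+ 4) *: (x0 * x0).
Proof. by have := pr_rel (sr_x1 q); rewrite !pE => <-; rewrite addrC subrK. Qed.
Lemma x2s_x2_rel : star x2 * x2 =
  x2 * star x2 + (star x1 * x1 - Q ^+ 4 *: (x1 * star x1)).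
Proof. by have := pr_rel (sr_x2 q); rewrite !pE => <-; rewrite addrC subrK. Qed.
Lemma sphere_eq : x0 * x0 + x1 * star x1 + x2 * star x2 = 1.
Proof. by have := pr_rel (sr_sphere q); rewrite !pE. Qed.

Definition zsq : A := 1 - x2 * star x2.

Lemma x2_x2s : x2 * star x2 = 1 - zsq.
Proof. by rewrite /zsq opprB addrC subrK. Qed.
Lemma x1_x1s : x1 * star x1 = zsq - x0 * x0.
Proof. by rewrite /zsq -sphere_eq; rewrite addrK addrC addKr. Qed.
Lemma x1s_x1 : star x1 * x1 = zsq - Q ^+ 4 *: (x0 * x0).
Proof.
rewrite x1s_x1_rel x1_x1s scalerBl scale1r.
by rewrite addrA subrK.
Qed.
Lemma x2s_x2 : star x2 * x2 = 1 - Q ^+ 4 *: zsq.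
Proof.
rewrite x2s_x2_rel x2_x2s x1s_x1 x1_x1s scalerBr (opprB (_ *: zsq)).
by rewrite [X in _ + X]addrA subrK addrA subrK.
Qed.

(** The scalar is left unspecified because only spans matter below; being nonzero, it makes the
    relation symmetric. *)
Definition qcomm a b := exists2 k : R[i], k != 0 & a * b = k *: (b * a).

Lemma qcomm_sym a b : qcomm a b -> qcomm b a.
Proof.
by move=> [k k0 kE]; exists k^-1; rewrite ?invr_eq0// kE scalerK.
Qed.
Lemma qcommMr a b c : qcomm a b -> qcomm a c -> qcomm a (b * c).
Proof.
move=> [k k0 kE] [h h0 hE]; exists (k * h); first by rewrite mulf_neq0.
by rewrite mulrA kE -scalerAl -!mulrA hE -scalerAr scalerA.
Qed.
Lemma qcomm1 a : qcomm a 1.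
Proof. by exists 1; rewrite ?oner_eq0// scale1r mulr1 mul1r. Qed.
Lemma qcommX a b n : qcomm a b -> qcomm a (b ^+ n).
Proof.
by move=> ab; elim: n => [|n IH]; [apply: qcomm1|rewrite exprS; apply: qcommMr].
Qed.
Lemma qcomm_star a b : qcomm a b -> qcomm (star a) (star b).
Proof.
move=> [k k0 kE]; apply: qcomm_sym; exists (Num.conj k).
  by rewrite fmorph_eq0.
by rewrite -!starM kE starZ.
Qed.

Lemma Qn_neq0 n : Q ^+ n != 0. Proof. by rewrite expf_neq0 // qC_neq0. Qed.

Lemma qcomm_xx (i j : scoord) : (i < j)%N -> qcomm (x i) (x j).
Proof. by move=> ij; exists (Q ^+ 2); [apply: Qn_neq0 | apply: xx_comm]. Qed.
Lemma qcomm_xsx (i j : scoord) : i <> j -> qcomm (star (x i)) (x j).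
Proof. by move=> ij; exists (Q ^+ 2); [apply: Qn_neq0 | apply: xsx_comm]. Qed.

Lemma star_zsq : star zsq = zsq.
Proof. by rewrite starB star1 starM starK. Qed.
Lemma zsqE : zsq = x0 * x0 + x1 * star x1.
Proof. by rewrite x1_x1s addrC subrK. Qed.

(** By [x2s_x2], [z x2 = x2 - x2 (1 - q^4 z) = q^4 x2 z]. *)
Lemma qcomm_z_x2 : qcomm zsq x2.
Proof.
exists (Q ^+ 4); first exact: Qn_neq0.
rewrite {1}/zsq mulrBl mul1r -mulrA x2s_x2 mulrBr mulr1.
by rewrite opprB addrC subrK scalerAr.
Qed.
(** Expanding [z] as [x0^2 + x1 (star x1)], the term [q^4 x1 x0^2] from moving [x0^2] past [x1]
    cancels the one in [x1 (star x1 x1)]. *)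
Lemma qcomm_z_x1 : qcomm zsq x1.
Proof.
exists 1; rewrite ?oner_eq0// scale1r.
have x01 : x0 * x1 = Q ^+ 2 *: (x1 * x0) by apply: xx_comm.
rewrite {1}zsqE mulrDl -[X in _ + X]mulrA x1s_x1 mulrBr -mulrA x01.
rewrite -scalerAr mulrA x01 -scalerAl scalerA -exprD -mulrA -scalerAr.
by rewrite addrC subrK.
Qed.
Lemma qcomm_z_x0 : qcomm zsq x0.
Proof.
exists 1; rewrite ?oner_eq0// scale1r zsqE mulrDl mulrDr mulrA; congr (_ + _).
rewrite -mulrA xsx_comm// -scalerAr !mulrA scalerAl.
by rewrite -(xx_comm (i := c0) (j := c1)).
Qed.

Definition signed_pow a (n : int) : A :=
  match n with Posz k => a ^+ k | Negz k => star a ^+ k.+1 end.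

Definition nmono (y : int * int * nat * nat) : A :=
  let: (m, n, c, k) := y in
  signed_pow x2 n * (signed_pow x1 m * (x0 ^+ c * zsq ^+ k)).

Lemma qcomm_pow a b n : star a = a -> qcomm a b -> qcomm a (signed_pow b n).
Proof.
move=> sa ab; case: n => k; apply: qcommX => //.
by rewrite -sa; apply: qcomm_star.
Qed.

Lemma qcomm_x1_pow n :
  qcomm x1 (signed_pow x2 n) * qcomm (star x1) (signed_pow x2 n).
Proof.
split; case: n => k; apply: qcommX.
- exact: qcomm_xx.
- by apply: qcomm_sym; apply: qcomm_xsx.
- exact: qcomm_xsx.
- by apply: qcomm_star; apply: qcomm_xx.
Qed.

Local Notation S := (lspan nmono).

Lemma span_swap a b c : qcomm a b -> S (b * (a * c)) -> S (a * (b * c)).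
Proof.
by move=> [k _ kE] Sb; rewrite mulrA kE -scalerAl -mulrA; apply: lspanZ.
Qed.

Lemma lspan_mul a b : (forall y, S (a * nmono y)) -> S b -> S (a * b).
Proof.
move=> Sa [s [k [_ ->]]]; rewrite mulr_sumr.
under eq_bigr do rewrite -scalerAr.
by apply: lspan_sub => y _; apply: Sa.
Qed.

Lemma x0_nmono y : S (x0 * nmono y).
Proof.
case: y => [[[m n] c] k].
apply: span_swap; first by apply: qcomm_pow; [exact: star_x0|exact: qcomm_xx].
have [h h0 hE] := qcomm_pow m star_x0 (@qcomm_xx c0 c1 isT).
rewrite [X in _ * X]mulrA hE -scalerAl -scalerAr; apply: lspanZ.
rewrite -[X in _ * X]mulrA (mulrA x0) -exprS.
exact: (lspan_e nmono (m, n, c.+1, k)).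
Qed.

Lemma z_nmono y : S (zsq * nmono y).
Proof.
case: y => [[[m n] c] k].
apply: span_swap; first exact: qcomm_pow star_zsq qcomm_z_x2.
have [h h0 hE] := qcomm_pow m star_zsq qcomm_z_x1.
have [e e0 eE] := qcommX c qcomm_z_x0.
rewrite [X in _ * X]mulrA hE -scalerAl -scalerAr -[X in _ *: (_ * X)]mulrA.
rewrite (mulrA zsq) eE -!scalerAl -!scalerAr -(mulrA _ zsq) -exprS.
by do 2!apply: lspanZ; apply: (lspan_e nmono (m, n, c, k.+1)).
Qed.

Lemma x2_nmono y : S (x2 * nmono y).
Proof.
case: y => [[[m n] c] k]; rewrite /nmono.
case: n => [n|n]; rewrite (mulrA x2) /=.
  by rewrite -exprS; apply: (lspan_e nmono (m, Posz n.+1, c, k)).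
rewrite exprS (mulrA x2) x2_x2s -(mulrA (1 - zsq)) mulrBl mul1r.
have -> : star x2 ^+ n = signed_pow x2 (- n%:Z) by case: n.
apply: lspanB; first exact: (lspan_e nmono (m, _, c, k)).
exact: (z_nmono (m, _, c, k)).
Qed.

Lemma x2s_nmono y : S (star x2 * nmono y).
Proof.
case: y => [[[m n] c] k]; rewrite /nmono.
case: n => [[|n]|n]; rewrite (mulrA (star x2)) /=.
- by rewrite expr0 mulr1; apply: (lspan_e nmono (m, Negz 0, c, k)).
- rewrite exprS (mulrA (star x2)) x2s_x2 -(mulrA (1 - _)) mulrBl mul1r.
  rewrite -presented_scaleAl.
  apply: lspanB; first exact: (lspan_e nmono (m, Posz n, c, k)).
  by apply: lspanZ; apply: (z_nmono (m, Posz n, c, k)).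
- by rewrite -exprS; apply: (lspan_e nmono (m, Negz n.+1, c, k)).
Qed.

(** The middle factor covers [x1 (star x1)] for [h = 1] and [(star x1) x1] for [h = q^4]. *)
Lemma z_x0x0_nmono (m n : int) (c k : nat) (h : R[i]) :
  S (signed_pow x2 n * ((zsq - h *: (x0 * x0)) *
     (signed_pow x1 m * (x0 ^+ c * zsq ^+ k)))).
Proof.
rewrite mulrBl mulrBr -scalerAl -scalerAr; apply: lspanB.
  apply: span_swap; first exact/qcomm_sym/qcomm_pow/qcomm_z_x2/star_zsq.
  exact: (z_nmono (m, n, c, k)).
apply: lspanZ; apply: span_swap.
  by apply: qcommMr; apply/qcomm_sym/qcomm_pow/qcomm_xx => //; apply: star_x0.
rewrite -mulrA; apply: lspan_mul x0_nmono _; exact: (x0_nmono (m, n, c, k)).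
Qed.

Lemma x1_nmono y : S (x1 * nmono y).
Proof.
case: y => [[[m n] c] k]; apply: span_swap; first exact: (qcomm_x1_pow n).1.
case: m => [m|m]; rewrite (mulrA x1) /=.
  by rewrite -exprS; apply: (lspan_e nmono (Posz m.+1, n, c, k)).
rewrite exprS (mulrA x1 (star x1)) x1_x1s -(mulrA (zsq - _)).
have -> : star x1 ^+ m = signed_pow x1 (- m%:Z) by case: m.
by have := z_x0x0_nmono (- m%:Z) n c k 1; rewrite scale1r.
Qed.

Lemma x1s_nmono y : S (star x1 * nmono y).
Proof.
case: y => [[[m n] c] k]; apply: span_swap; first exact: (qcomm_x1_pow n).2.
case: m => [[|m]|m]; rewrite (mulrA (star x1)) /=.
- by rewrite expr0 mulr1; apply: (lspan_e nmono (Negz 0, n, c, k)).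
- rewrite exprS (mulrA (star x1) x1) x1s_x1 -(mulrA (zsq - _)).
  exact: (z_x0x0_nmono (Posz m) n c k).
- by rewrite -exprS; apply: (lspan_e nmono (Negz m.+1, n, c, k)).
Qed.

(** Left multiplication by a generator either lengthens a power or creates a product of some [x_i]
    with its own adjoint. The latter is a polynomial in [z] and [x0^2], which commute with the other
    factors up to scalars and can be moved into place. *)
Lemma nmono_span a : S a.
Proof.
elim/presented_word_ind: a => [|c a b|[] a|[] a].
- by have := lspan_e nmono (0, 0, 0%N, 0%N); rewrite /= !mulr1.
- exact: lspan_linear.
- exact: lspan_mul x0_nmono.
- exact: lspan_mul x1_nmono.
- exact: lspan_mul x2_nmono.
- rewrite [star _]star_x0; exact: lspan_mul x0_nmono.
- exact: lspan_mul x1s_nmono.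
- exact: lspan_mul x2s_nmono.
Qed.

End SphereAlgebra.

Definition lt_lj (y y' : idx) :=
  y.1.1.1 < y'.1.1.1 \/ y.1.1.1 = y'.1.1.1 /\ y.2 < y'.2.

(** * Nonvanishing of the bracket *)

Section QuantumIntegers.
Variables (R : realType) (q : R).
Hypotheses (q0 : 0 < q) (q1 : q < 1).

Lemma qq_neq0 : q - q^-1 != 0.
Proof.
rewrite subr_eq0; apply/eqP => e; have := expq_neq1 q0 q1 (n := 2) isT.
by rewrite expr2 {2}e divff ?subrr ?eqxx// gt_eqF.
Qed.

Lemma qint_neq0 z : z != 0 -> qint q z != 0.
Proof.
move=> z0; rewrite mulf_neq0 ?invr_eq0 ?qq_neq0// subr_eq0 exprzN; apply/eqP => e.
have z2 : 2 * z != 0 by lia.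
have /eqP[] := exprz_neq1 q0 q1 z2.
by rewrite exprz_double// {2}e divff// expfz_neq0// gt_eqF.
Qed.

End QuantumIntegers.

Ltac coef_neq0 q0 q1 :=
  repeat first
    [ rewrite oppr_eq0 | exact: expfz_neq0 (q_neq0 q0)
    | by apply: (qint_neq0 q0 q1); lia | apply: mulf_neq0 | rewrite invr_eq0 ].
Ltac lower_shift :=
  by move=> ?; rewrite !inE /lt_lj; do ?case/orP; move=> /eqP-> /=; lia.

(** * Leading labels, and injectivity on the vacuum *)

Section Leading.
Variables (R : realType) (q : R).
Hypotheses (q0 : 0 < q) (q1 : q < 1).
Notation V := (idx -> R[i]).
Notation A := (qsphere q).
Local Notation rho := (@rho R q).
Local Notation x := (xgen q).
Implicit Types (f g : V) (y d : idx) (a b : A).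

(* The leading label of a model vector, for the lexicographic order on [(l, j)]. *)
Definition leads f y :=
  f y != 0 /\ forall y', f y' != 0 -> y' = y \/ lt_lj y' y.

(** The lexicographic order is invariant under translation, so the dominant shift of the operator
    moves the leading label. Each generator's list has its dominant shift at the head, with a
    coefficient that vanishes nowhere. *)
Lemma leads_oapp (L : shift_op) p f y : leads f y ->
  p.2 y != 0 -> (forall r, r \in [seq r.1 | r <- L] -> lt_lj r p.1) ->
  leads (oapp (p :: L) f) (y + p.1).
Proof.
move=> [fy fl] py rp; split.
  rewrite /oapp big_cons addrK big_seq big1 ?addr0 => [|r rL].
    by rewrite mulf_neq0// fmorph_eq0.
  apply/eqP; rewrite mulf_eq0; apply/orP; right; apply: contraT => /fl.
  have {}rp : lt_lj r.1 p.1 by apply/rp/map_f.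
  case: p r y rp {py fy fl rL} => [[[[pl pm] pn] pj] pc] [[[[rl rm] rn] rj] rc].
  move=> [[[yl ym] yn] yj]; rewrite /lt_lj /= => rp [] E; last by lia.
  by move: E => [] *; lia.
move=> y' y'n0.
have [r rL fr] : exists2 r, r \in p :: L & f (y' - r.1) != 0.
  apply/hasP; apply: contraNT y'n0 => /hasPn nr.
  rewrite /oapp big_seq big1// => r /nr; rewrite negbK => /eqP->.
  by rewrite mulr0.
have rp' : r.1 = p.1 \/ lt_lj r.1 p.1.
  by move: rL; rewrite inE => /orP[/eqP->|rL]; [left|right; apply/rp/map_f].
case: (fl _ fr) rp' => [/eqP|].
  rewrite subr_eq => /eqP -> [->|]; first by left.
  move: r.1 p.1 => {fr} [[[rl rm] rn] rj] [[[pl pm] pn] pj].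
  by case: y {fy fl py} => [[[yl ym] yn] yj]; rewrite /lt_lj /=; right; lia.
move: r.1 p.1 => {fr} [[[rl rm] rn] rj] [[[pl pm] pn] pj].
case: y y' {fy fl py y'n0} => [[[yl ym] yn] yj] [[[l m] n] j].
by rewrite /lt_lj /= => h [[]|] *; right; lia.
Qed.

Lemma leads_x0 f y : leads f y -> leads (oapp (opx0 q) f) (y + (1, 0, 0, 1)).
Proof.
move=> fy; apply: (leads_oapp (p := (_, _)) fy); last lower_shift.
by case: y {fy} => [[[l m] n] j] /=; coef_neq0 q0 q1.
Qed.
Lemma leads_x1 f y : leads f y -> leads (oapp (opx1 q) f) (y + (1, 1, 0, 1)).
Proof.
move=> fy; apply: (leads_oapp (p := (_, _)) fy); last lower_shift.
by case: y {fy} => [[[l m] n] j] /=; coef_neq0 q0 q1.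
Qed.
Lemma leads_x1s f y :
  leads f y -> leads (oapp (opx1s q) f) (y + (1, -1, 0, 1)).
Proof.
move=> fy; apply: (leads_oapp (p := (_, _)) fy); last lower_shift.
by case: y {fy} => [[[l m] n] j] /=; coef_neq0 q0 q1.
Qed.
Lemma leads_x2 f y : leads f y -> leads (oapp (opx2 q) f) (y + (1, 0, 1, 0)).
Proof.
move=> fy; apply: (leads_oapp (p := (_, _)) fy); last lower_shift.
by case: y {fy} => [[[l m] n] j] /=; coef_neq0 q0 q1.
Qed.
Lemma leads_x2s f y :
  leads f y -> leads (oapp (opx2s q) f) (y + (1, 0, -1, 0)).
Proof.
move=> fy; apply: (leads_oapp (p := (_, _)) fy); last lower_shift.
by case: y {fy} => [[[l m] n] j] /=; coef_neq0 q0 q1.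
Qed.

Lemma rhoB a b f : supported f -> rho (a - b) f = rho a f - rho b f.
Proof. by move=> sf; rewrite rhoD// -scaleN1r rhoZ// scaleN1r. Qed.

(** In [z = 1 - x2 (star x2)] the product raises the leading [l] by 2, so the identity contributes
    only lower labels. *)
Lemma leads_z f y : supported f -> leads f y ->
  leads (rho (zsq q) f) (y + (2, 0, 0, 0)).
Proof.
move=> sf fy; rewrite rhoB// rho1// rhoM// rho_xgen_star//.
rewrite rho_xgen//; last exact/supported_oapp/sf/stable_x2s.
have := leads_x2 (leads_x2s fy).
have -> : y + (1, 0, -1, 0) + (1, 0, 1, 0) = y + (2, 0, 0, 0) :> idx.
  by rewrite -addrA.
move: (oapp _ _) => g [gy gl]; case: fy => fy fl.
have f0 : f (y + (2, 0, 0, 0)) = 0.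
  apply/eqP/contraT => /fl [].
    by move/eqP; rewrite -subr_eq0 addrAC subrr add0r.
  by case: y {fy fl gy gl} => [[[l m] n] j]; rewrite /lt_lj /=; lia.
split; first by rewrite fctE /= f0 sub0r oppr_eq0.
move=> y'; rewrite fctE /=; have [->|fy' _] := eqVneq (f y') 0.
  by rewrite sub0r oppr_eq0; apply: gl.
right; case: (fl _ fy') => [->|].
  by case: y {fy fl gy gl f0} => [[[l m] n] j]; rewrite /lt_lj /=; lia.
case: y y' {fy fl gy gl f0 fy'} => [[[l m] n] j] [[[l' m'] n'] j'].
by rewrite /lt_lj /=; lia.
Qed.

Lemma leads_rhoX a f y (d : idx) k : supported f ->
  (forall g y, supported g -> leads g y -> leads (rho a g) (y + d)) ->
  leads f y -> leads (rho (a ^+ k) f) (y + d *+ k).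
Proof.
move=> sf H fy; elim: k => [|k IH]; first by rewrite expr0 rho1// addr0.
rewrite exprS rhoM// mulrSr addrA; apply: H => //.
exact: supported_rho.
Qed.

Definition vac : V := delta (R := R) 0.
Lemma supported_vac : supported vac.
Proof. by move=> y; rewrite /vac /delta; case: eqVneq => // ->. Qed.

Definition nlead (y : int * int * nat * nat) : idx :=
  let: (m, n, c, k) := y in
  (`|m| + `|n| + c%:Z + 2 * k%:Z, m, n, `|m| + c%:Z).

Lemma leads_nmono (y : int * int * nat * nat) :
  leads (rho (nmono q y) vac) (nlead y).
Proof.
have sv := supported_vac.
have vacl : leads vac 0.
  split=> [|y']; first by rewrite /vac /delta eqxx oner_eq0.
  rewrite /vac /delta; have [->|] := eqVneq y' 0; first by left.
  by rewrite eqxx.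
case: y => [[[m n] c] k]; rewrite /nmono.
rewrite !rhoM//; do ?[exact: supported_rho].
have := leads_rhoX (a := zsq q) k sv leads_z vacl.
set f := rho (_ ^+ k) _ => fl.
have sf : supported f by exact: supported_rho.
have X0 g y : supported g -> leads g y ->
    leads (rho (x c0) g) (y + (1, 0, 0, 1)).
  by move=> sg; rewrite rho_xgen//; apply: leads_x0.
have := leads_rhoX c sf X0 fl.
move: (supported_rho (q := q) (x c0 ^+ c) sf).
move: {f sf fl} (rho _ f) => f sf fl.
pose d1 (i : int) : idx := (1, if (i >= 0) then 1 else -1, 0, 1).
have X1 : leads (rho (signed_pow (x c1) m) f)
    (0 + (2, 0, 0, 0) *+ k + (1, 0, 0, 1) *+ c + d1 m *+ absz m).
  rewrite /d1; case: m => m /=; apply: leads_rhoX => // g y sg.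
    by rewrite rho_xgen//; apply: leads_x1.
  by rewrite rho_xgen_star//; apply: leads_x1s.
move: (supported_rho (q := q) (signed_pow (x c1) m) sf) X1.
move: {f sf fl} (rho _ f) => f sf fl.
pose d2 (i : int) : idx := (1, 0, if (i >= 0) then 1 else -1, 0).
have X2 : leads (rho (signed_pow (x c2) n) f)
    (0 + (2, 0, 0, 0) *+ k + (1, 0, 0, 1) *+ c + d1 m *+ absz m + d2 n *+ absz n).
  rewrite /d2; case: n => n /=; apply: leads_rhoX => // g y sg.
    by rewrite rho_xgen//; apply: leads_x2.
  by rewrite rho_xgen_star//; apply: leads_x2s.
suff <- : 0 + (2, 0, 0, 0) *+ k + (1, 0, 0, 1) *+ c + d1 m *+ absz m
    + d2 n *+ absz n = nlead (m, n, c, k) by [].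
have M (a b c' d : int) i : ((a, b, c', d) : idx) *+ i
    = (a *+ i, b *+ i, c' *+ i, d *+ i).
  by elim: i => // i IH; rewrite !mulrSr IH.
rewrite add0r /d1 /d2 4!M /nlead.
have D (a b c' d a' b' c1' d' : int) : (a, b, c', d) + (a', b', c1', d')
  = (a + a', b + b', c' + c1', d + d') :> idx by [].
rewrite !D {D}.
have nz (a : int) (i : nat) : a *+ i = a * i%:Z by rewrite -mulr_natr natz.
rewrite !nz; case: (lerP 0 m) => hm; case: (lerP 0 n) => hn;
  by congr (_, _, _, _); cbn [fst snd]; lia.
Qed.

Lemma nlead_inj : injective nlead.
Proof.
move=> [[[m n] c] k] [[[m' n'] c'] k'] [] E1 E2 E3 E4; subst.
by congr (_, _, _, _); lia.
Qed.

(** A single number that increases with the lexicographic order on [(l, j)] of [nlead]: as [j <= l],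
    one has [l^2 + j < (l + 1)^2]. *)
Definition nkey (y : int * int * nat * nat) : nat :=
  let: (m, n, c, k) := y in
  (let L := absz m + absz n + c + 2 * k in L * L + (absz m + c))%N.

Lemma lt_nkey (y y' : int * int * nat * nat) :
  lt_lj (nlead y) (nlead y') -> (nkey y < nkey y')%N.
Proof.
case: y y' => [[[m n] c] k] [[[m' n'] c'] k']; rewrite /lt_lj /nlead /nkey /=.
set L := (_ + 2 * k)%N; set L' := (_ + 2 * k')%N.
move=> H; have : (L < L')%N \/ L = L' /\ (absz m + c < absz m' + c')%N by lia.
case=> [LL|[-> ?]]; last by rewrite ltn_add2l.
have : (absz m + c <= L)%N by lia.
have : (L.+1 * L.+1 <= L' * L')%N by rewrite leq_mul.
by nia.
Qed.

Lemma argmax_seq (T : eqType) (s : seq T) (k : T -> nat) : s != [::] ->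
  exists2 i, i \in s & forall j, j \in s -> (k j <= k i)%N.
Proof.
elim: s => // i s IH _; have [->|/IH[j js jm]] := eqVneq s [::].
  by exists i; rewrite ?inE// => j; rewrite inE => /eqP->.
have [le|/ltnW le] := leqP (k i) (k j).
  exists j; first by rewrite inE js orbT.
  by move=> h; rewrite inE => /orP[/eqP->//|]; apply: jm.
exists i; first by rewrite inE eqxx.
by move=> h; rewrite inE => /orP[/eqP->//|/jm hj]; apply: leq_trans le.
Qed.

Lemma rho_sum (I : Type) (s : seq I) (c : I -> R[i]) (a : I -> A) f :
  supported f ->
  rho (\sum_(i <- s) c i *: a i) f = \sum_(i <- s) c i *: rho (a i) f.
Proof.
move=> sf; elim: s => [|i s IH]; last first.
  by rewrite !big_cons rhoD// rhoZ// IH.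
by rewrite !big_nil -(scale0r 0) rhoZ// scale0r.
Qed.

Lemma rho_vac_inj a : rho a vac = 0 -> a = 0.
Proof.
have sv := supported_vac.
have [s [c [us ->]]] := nmono_span q0 a.
rewrite rho_sum// => E; pose s' := [seq i <- s | c i != 0].
have s'0 : s' = [::].
  apply/eqP/contraT => s'n0.
  (* Evaluation at the leading label of a monomial of maximal key, among those with nonzero
     coefficient, kills all the others: one of them reaching that label would have a larger key or
     the same leading label. *)
  have [i is' im] := argmax_seq nkey s'n0.
  move: (is'); rewrite mem_filter => /andP[ci is_].
  move/(congr1 (fun f => f (nlead i))): E.
  rewrite fct_sumE (bigD1_seq i)//= big1_seq => [|j /andP[ji js]].
    rewrite addr0 => /eqP; rewrite fctE mulf_eq0 (negbTE ci) /=.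
    by have [/negbTE->] := leads_nmono i.
  have [cj|cj] := eqVneq (c j) 0; first by rewrite cj scale0r.
  rewrite fctE; apply/eqP; rewrite mulf_eq0 (negbTE cj) /=; apply: contraT.
  have [_ jl] := leads_nmono j => /jl[/nlead_inj/esym/eqP|/lt_nkey].
    by rewrite (negbTE ji).
  by rewrite ltnNge im// mem_filter cj.
rewrite big1_seq// => i /= is_; apply/eqP; rewrite scaler_eq0.
apply/orP; left; apply: contraT => ci.
have : i \in s' by rewrite mem_filter ci.
by rewrite s'0.
Qed.

End Leading.

(** * Norms of the rescaled kets, and adjoint operators *)

Section Weights.
Variables (R : realType) (q : R).
Hypotheses (q0 : 0 < q) (q1 : q < 1).
Notation V := (idx -> R[i]).
Local Notation "[ z ]" := (qint q z) (at level 0, format "[ z ]").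
Implicit Types (y d : idx) (l m n j z : int).

Lemma qint_ge0 z : 0 <= z -> 0 <= [z].
Proof.
move=> z0; have q2 : q - q^-1 < 0.
  by rewrite subr_lt0 (lt_trans q1)// invf_gt1.
rewrite /qint mulr_le0 ?invr_le0 ?(ltW q2)// subr_le0.
case: z z0 => // k _; rewrite exprzN -exprnP.
have qk : q ^+ k <= 1 by rewrite exprn_ile1 ?ltW.
by apply: le_trans qk _; rewrite invf_ge1 ?exprn_gt0// exprn_ile1 ?ltW.
Qed.
Lemma qint_gt0 z : 0 < z -> 0 < [z].
Proof. by move=> z0; rewrite lt_def qint_neq0 ?qint_ge0//; lia. Qed.

Fixpoint qfact_nat (k : nat) : R :=
  if k is k'.+1 then qfact_nat k' * [k%:Z] else 1.
(** The product [[k + a] [k - 2 + a] ...] ending at [[2 + a]] for even [k]. At admissible labels the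
    arguments in [gnorm] are even, and this is the double factorial [[k]!!] for [a = 0] and
    [[k + 1]!!] for [a = 1]. *)
Fixpoint qdfact_nat (a : int) (k : nat) : R :=
  if k is k'.+2 then qdfact_nat a k' * [k%:Z + a] else 1.
Definition qfact z := qfact_nat (absz z).
Definition qdfact a z := qdfact_nat a (absz z).

Lemma qfact_shift z z' : 0 <= z' -> z = z' + 1 -> qfact z = qfact z' * [z].
Proof. by case: z' => // k _ ->; rewrite (_ : Posz k + 1 = Posz k.+1) //; lia. Qed.
Lemma qdfact_shift a z z' : 0 <= z' -> z = z' + 2 ->
  qdfact a z = qdfact a z' * [z + a].
Proof.
case: z' => // k _ ->; rewrite (_ : Posz k + 2 = Posz k.+2) //; lia.
Qed.
Lemma qfact_shift2 z z' : 0 <= z' -> z = z' + 2 ->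
  qfact z = qfact z' * ([z] * [z - 1]).
Proof.
move=> z0 zE; rewrite (@qfact_shift z (z - 1)) ?(@qfact_shift (z - 1) z'); try lia.
by rewrite mulrAC mulrA.
Qed.
Lemma qdfact0_shift z z' : 0 <= z' -> z = z' + 2 ->
  qdfact 0 z = qdfact 0 z' * [z].
Proof. by move=> z0 /(qdfact_shift 0 z0); rewrite addr0. Qed.
Lemma qfact_gt0 z : 0 < qfact z.
Proof.
by rewrite /qfact; elim: absz => //= k IH; rewrite mulr_gt0// qint_gt0.
Qed.
Lemma qdfact_gt0 a z : 0 <= a -> 0 < qdfact a z.
Proof.
move=> a0; rewrite /qdfact.
suff : 0 < qdfact_nat a (absz z) /\ 0 < qdfact_nat a (absz z).+1 by case.
elim: (absz z) => //= k [IH IH']; split=> //.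
by rewrite mulr_gt0// qint_gt0//; lia.
Qed.

(* [gnorm y] is the squared norm of the rescaled ket: the model vector
   [delta y] stands for the normalised ket divided by [sqrt (gnorm y)]. *)
Definition gnorm y : R :=
  let: (l, m, n, j) := y in
  [2 * l + 3] * [2 * j + 1] * q ^ (m + n) /
  ([3] * (qfact (j - m) * qfact (j + m)
   * (qdfact 1 (l + j + n) * qdfact 1 (l + j - n))
   * (qdfact 0 (l - j + n) * qdfact 0 (l - j - n)))).

Lemma gnorm0 : gnorm 0 = 1.
Proof.
rewrite /gnorm /qfact /qdfact /= !mulr1 [[1]]divff ?qq_neq0//.
by rewrite !mulr1 divff// qint_neq0.
Qed.

Ltac factor_gt0 :=
  repeat first
    [ exact: exprz_gt0 | exact: qfact_gt0 | exact: qdfact_gt0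
    | by apply: qint_gt0; admlia | apply: mulr_gt0 | rewrite invr_gt0 ].

Lemma gnorm_gt0 y : adm y -> 0 < gnorm y.
Proof.
by case: y => [[[l m] n] j] ay; rewrite /gnorm; factor_gt0.
Qed.

Definition balanced (L M : shift_op) := forall d y,
  d \in [seq p.1 | p <- L] -> adm y -> adm (y + d) ->
  gnorm (y + d) * ocoef M (- d) (y + d) = gnorm y * ocoef L d y.

Lemma balanced_sym L M : (forall d, d \in [seq p.1 | p <- M] ->
    - d \in [seq p.1 | p <- L]) -> balanced L M -> balanced M L.
Proof.
move=> LM bal d y dM ay ayd; have := bal (- d) (y + d) (LM _ dM) ayd.
by rewrite addrK opprK => ->.
Qed.

(** Along a step the factorial arguments move by at most 2 and the double factorial ones by 0 or 2;
    unfolding the longer one lets the common factors cancel. *)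
Ltac fact_arg a b :=
  first [ have -> : a = b by lia
        | rewrite (@qfact_shift a b); [|by admlia|by lia]
        | rewrite (@qfact_shift b a); [|by admlia|by lia]
        | rewrite (@qfact_shift2 a b); [|by admlia|by lia]
        | rewrite (@qfact_shift2 b a); [|by admlia|by lia] ].
Ltac dfact1_arg a b :=
  first [ have -> : a = b by lia
        | rewrite (@qdfact_shift 1 a b); [|by admlia|by lia]
        | rewrite (@qdfact_shift 1 b a); [|by admlia|by lia] ].
Ltac dfact0_arg a b :=
  first [ have -> : a = b by lia
        | rewrite (@qdfact0_shift a b); [|by admlia|by lia]
        | rewrite (@qdfact0_shift b a); [|by admlia|by lia] ].
Ltac factors_neq0 :=
  repeat (apply/andP; split);
  first [ exact: (q_neq0 q0) | exact: (expfz_neq0 _ (q_neq0 q0))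
        | by apply: qint_neq0; admlia
        | by rewrite gt_eqF// qfact_gt0 | by rewrite gt_eqF// qdfact_gt0 ].
Lemma idxD (a b c d a' b' c' d' : int) :
  (a, b, c, d) + (a', b', c', d') = (a + a', b + b', c + c', d + d') :> idx.
Proof. by []. Qed.
Ltac check_edge :=
  rewrite idxD;
  cbn -[GRing.add GRing.mul GRing.opp GRing.zero GRing.one eq_op exprz qint
        GRing.inv intmul GRing.natmul GRing.exp qfact qdfact];
  repeat (match goal with |- context [if ?c then _ else _] =>
     let v := eval vm_compute in c in change c with v end; cbv iota);
  lazymatch goal with
  |- _ / (_ * (qfact ?a1 * qfact ?a2 * (qdfact 1 ?a3 * qdfact 1 ?a4)
               * (qdfact 0 ?a5 * qdfact 0 ?a6))) * _ =
     _ / (_ * (qfact ?b1 * qfact ?b2 * (qdfact 1 ?b3 * qdfact 1 ?b4)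
               * (qdfact 0 ?b5 * qdfact 0 ?b6))) * _ =>
    fact_arg a1 b1; fact_arg a2 b2; dfact1_arg a3 b3; dfact1_arg a4 b4;
    dfact0_arg a5 b5; dfact0_arg a6 b6
  end;
  rewrite ?addr0 !(exprzD q0) ?exprzN ?(exprzD q0) ?exprzN ?expr1z ?expr0z
    ?exprz_nat;
  field; factors_neq0.

Lemma balanced_x0 : balanced (opx0 q) (opx0 q).
Proof.
move=> d [[[l m] n] j]; rewrite [_ \in _]/= !inE.
repeat case/orP; move=> /eqP-> ay ayd.
all: check_edge.
Qed.
Lemma balanced_x1 : balanced (opx1 q) (opx1s q).
Proof.
move=> d [[[l m] n] j]; rewrite [_ \in _]/= !inE.
repeat case/orP; move=> /eqP-> ay ayd.
all: check_edge.
Qed.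
Lemma balanced_x2 : balanced (opx2 q) (opx2s q).
Proof.
move=> d [[[l m] n] j]; rewrite [_ \in _]/= !inE.
repeat case/orP; move=> /eqP-> ay ayd.
all: check_edge.
Qed.

(** [opF1] and [opF2] are the adjoints of [opE1] and [opE2] in the sense of [balanced]; the division
    by [q] in [opF1] absorbs the change of [q^(m + n)] in [gnorm]. *)
Definition opF1 : shift_op (R := R) :=
  [:: ((0, -1, 0, 0), fun '(l, m, n, j) => [j + m] / q)].
Definition opF2 : shift_op (R := R) := [::
  ((0, 1, -1, -1), fun '(l, m, n, j) =>
     [j - m] * [j - m - 1] * [l + j + n + 1] / ([2] * [2 * j + 1]));
  ((0, 1, -1, 1), fun '(l, m, n, j) => [l - j + n] / ([2] * [2 * j + 1]))].

Lemma balanced_E1 : balanced (opE1 q) opF1.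
Proof.
move=> d [[[l m] n] j]; rewrite [_ \in _]/= !inE.
move=> /eqP-> ay ayd; check_edge.
Qed.
Lemma balanced_E2 : balanced (opE2 q) opF2.
Proof.
move=> d [[[l m] n] j]; rewrite [_ \in _]/= !inE.
repeat case/orP; move=> /eqP-> ay ayd.
all: check_edge.
Qed.

End Weights.

Arguments gnorm {R} q y : simpl never.

(** * Every ket is reached from the vacuum *)

Section Preimages.
Variables (R : realType) (q : R).
Hypotheses (q0 : 0 < q) (q1 : q < 1).
Notation V := (idx -> R[i]).
Notation A := (qsphere q).
Local Notation rho := (@rho R q).
Local Notation rhoS := (@rhoS R q).
Local Notation vac := (@vac R).
Local Notation x := (xgen q).
Local Notation gnorm := (gnorm q).
Implicit Types (f g : V) (y d : idx) (a b : A).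

Lemma supported_delta y : adm y -> supported (delta (R := R) y).
Proof. by move=> ay z; rewrite /delta; case: eqVneq => // ->; rewrite ay. Qed.

Lemma rhoSD a b f : supported f -> rhoS (a + b) f = rhoS a f + rhoS b f.
Proof. by move=> sf; rewrite -!rho_star// starD rhoD. Qed.
Lemma rhoSZ (c : R[i]) a f : supported f ->
  rhoS (c *: a) f = Num.conj c *: rhoS a f.
Proof. by move=> sf; rewrite -!rho_star// starZ rhoZ. Qed.
Lemma rhoSM a b f : supported f -> rhoS (a * b) f = rhoS b (rhoS a f).
Proof.
move=> sf; rewrite -!rho_star ?starM ?rhoM//.
exact: supported_rho.
Qed.

(** The identity [<delta y, M g> = <L (delta y), g>] for the inner product weighted by
    [1 / gnorm]. *)
Lemma adjoint_oapp (L M : shift_op (R := R)) g y :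
  uniq [seq p.1 | p <- L] -> uniq [seq p.1 | p <- M] ->
  [seq p.1 | p <- M] =i [seq - p.1 | p <- L] ->
  balanced q L M -> stable L -> supported g -> adm y ->
  ((gnorm y)^-1)%:C * oapp M g y =
  \sum_(d <- [seq p.1 | p <- L]) (ocoef L d y)%:C *
     (((gnorm (y + d))^-1)%:C * g (y + d)).
Proof.
move=> uL uM ML bal sL sg ay.
rewrite (oapp_coef (s := [seq - d | d <- [seq p.1 | p <- L]])).
- rewrite big_map mulr_sumr big_seq [RHS]big_seq; apply: eq_bigr => d dL.
  rewrite opprK; have [ayd|nayd] := boolP (adm (y + d)); last first.
    by rewrite sg// !mulr0.
  rewrite !mulrA -!rmorphM /=; congr (_%:C * _).
  have := bal _ _ dL ay ayd.
  have := gnorm_gt0 q0 q1 ay; have := gnorm_gt0 q0 q1 ayd.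
  move: (gnorm (y + d)) (gnorm y) => u v u0 v0 E.
  apply: (mulfI (x := u * v)); first by rewrite mulf_neq0 ?gt_eqF.
  transitivity (u * ocoef M (- d) (y + d)).
    by field; rewrite gt_eqF.
  by rewrite E; field; rewrite gt_eqF.
- by rewrite map_inj_uniq//; apply: oppr_inj.
- by move=> d; rewrite ML -map_comp.
Qed.

(* [preimage y]: the model vector [delta y] is [a] applied to the vacuum, for
   some [a] such that moreover the adjoint of [a] computes the inner product
   with [delta y]. *)
Definition adjoint_preimage f (phi : V -> R[i]) := exists a,
  rho a vac = f /\ forall g, supported g -> rhoS a g 0 = phi g.

Definition preimage y := adjoint_preimage (delta y)
  (fun g => ((gnorm y)^-1)%:C * g y).

Lemma adjoint_preimage_linear (c : R) f g phi psi :
  adjoint_preimage f phi -> adjoint_preimage g psi ->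
  adjoint_preimage (c%:C *: f + g) (fun h => c%:C * phi h + psi h).
Proof.
move=> [a [af aphi]] [b [bf bpsi]]; exists (c%:C *: a + b).
have sv := @supported_vac R.
split; first by rewrite rhoD// rhoZ// af bf.
move=> h sh; rewrite rhoSD// rhoSZ// -[Num.conj _]/(conjc _) conjc_real.
by rewrite -aphi// -bpsi.
Qed.

(** Preimages are asked for only where the coefficient is nonzero; by stability these terms have
    admissible labels. *)
Lemma adjoint_preimage_sum (s : seq idx) (c : idx -> R) y :
  (forall d, d \in s -> c d != 0 -> preimage (y + d)) ->
  adjoint_preimage (\sum_(d <- s) (c d)%:C *: delta (y + d))
   (fun g => \sum_(d <- s) (c d)%:C * (((gnorm (y + d))^-1)%:C * g (y + d))).
Proof.
elim: s => [|d s IH] pre.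
  exists 0; split=> [|g sg]; rewrite ?big_nil.
    by rewrite -(scale0r 0) rhoZ ?scale0r//; apply: supported_vac.
  by rewrite -[X in rhoS X](scale0r (0 : A)) rhoSZ// rmorph0 scale0r.
have {}IH := IH (fun e es => pre e (mem_behead (s := d :: s) es)).
have -> : (fun g : V => \sum_(d0 <- d :: s) (c d0)%:C *
    (((gnorm (y + d0))^-1)%:C * g (y + d0))) =
  (fun g => (c d)%:C * (((gnorm (y + d))^-1)%:C * g (y + d)) +
     \sum_(d0 <- s) (c d0)%:C * (((gnorm (y + d0))^-1)%:C * g (y + d0))).
  by apply/funext => g; rewrite big_cons.
rewrite big_cons; have [->|cd] := eqVneq (c d) 0.
  rewrite scale0r add0r.
  have -> // : (fun g : V => 0%:C * (((gnorm (y + d))^-1)%:C * g (y + d)) +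
     \sum_(d0 <- s) (c d0)%:C * (((gnorm (y + d0))^-1)%:C * g (y + d0))) =
   (fun g =>
     \sum_(d0 <- s) (c d0)%:C * (((gnorm (y + d0))^-1)%:C * g (y + d0))).
  by apply/funext => g; rewrite mul0r add0r.
by apply: adjoint_preimage_linear => //; apply: pre; rewrite ?inE ?eqxx.
Qed.

(** Solve [u (delta y) = p.2 y * delta (y + p.1) + (lower kets)] for the leading ket. The adjoint
    half follows the same subtraction through [adjoint_oapp]. *)
Lemma preimage_step (u : A) (p : idx * (idx -> R)) (L M : shift_op (R := R)) y :
  (forall f, supported f -> rho u f = oapp (p :: L) f) ->
  (forall f, supported f -> rhoS u f = oapp M f) ->
  uniq [seq r.1 | r <- p :: L] -> uniq [seq r.1 | r <- M] ->
  [seq r.1 | r <- M] =i [seq - r.1 | r <- p :: L] ->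
  balanced q (p :: L) M -> stable (p :: L) -> adm y -> p.2 y != 0 ->
  stable M ->
  (forall d, d \in [seq r.1 | r <- L] -> adm (y + d) -> preimage (y + d)) ->
  preimage y -> preimage (y + p.1).
Proof.
move=> uE uSE upL uM ML bal sL ay py sM preL [a [af aphi]].
have sv := @supported_vac R.
have sd := supported_delta ay.
pose s := [seq r.1 | r <- L].
have cL d : d \in s -> ocoef (p :: L) d y = ocoef L d y.
  move: upL => /= /andP[pL _] dL; case: eqP => // e.
  by move: pL; rewrite e dL.
have [b [bf bphi]] : adjoint_preimage
   (\sum_(d <- s) (ocoef (p :: L) d y)%:C *: delta (y + d))
   (fun g => \sum_(d <- s) (ocoef (p :: L) d y)%:C *
      (((gnorm (y + d))^-1)%:C * g (y + d))).
  apply: adjoint_preimage_sum => d ds c0; apply: preL => //.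
  by apply: contraNT c0 => nay; rewrite sL// inE ds orbT.
have cp : ocoef (p :: L) p.1 y = p.2 y.
  rewrite /= eqxx ocoef_out ?addr0//.
  by move: upL => /= /andP[].
pose c := (p.2 y)^-1.
have c1 : c%:C * (p.2 y)%:C = 1 :> R[i] by rewrite -rmorphM mulVf.
exists (c%:C *: (u * a - b)); split.
  rewrite rhoZ// rhoB// rhoM// uE ?af ?supported_rho// bf.
  have -> : oapp (p :: L) (delta y) =
      \sum_(d <- [seq r.1 | r <- p :: L]) (ocoef (p :: L) d y)%:C *: delta (y + d).
    apply/funext => z; rewrite (oapp_coef (s := [seq r.1 | r <- p :: L]))//.
    rewrite fct_sumE; apply: eq_bigr => d _; rewrite /delta fctE subr_eq.
    by case: eqVneq => [->|_]; rewrite ?addrK // !mulr0 scaler0.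
  by rewrite big_cons cp addrK scalerA c1 scale1r.
move=> g sg.
rewrite rhoSZ// rhoSD// -scaleN1r rhoSZ// rmorphN1 rhoSM//.
rewrite uSE// fctE -[Num.conj _]/(conjc _) conjc_real.
rewrite !fctE aphi ?bphi//; last exact: supported_oapp.
rewrite (adjoint_oapp (L := p :: L))// big_cons cp.
rewrite /*:%R /= mulN1r addrK.
set h := (X in _ * (_ * X) = X).
transitivity (c%:C * (p.2 y)%:C * h); first exact: mulrA.
by rewrite c1 mul1r.
Qed.

Lemma preimage_x0 y : adm y ->
  (forall d, d \in [seq r.1 | r <- behead (opx0 q)] -> adm (y + d) ->
    preimage (y + d)) ->
  preimage y -> preimage (y + (1, 0, 0, 1)).
Proof.
move=> ay pre py.
apply: (@preimage_step (x c0) (head (0, fun=> 0) (opx0 q)) (behead (opx0 q))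
   (opx0 q) y) => //.
- by move=> f sf; rewrite rho_xgen.
- by move=> f sf; rewrite -rho_star// rho_xgen_star.
- by apply/perm_mem; vm_compute.
- exact: balanced_x0.
- exact: stable_x0.
- by case: y {ay pre py} => [[[l m] n] j] /=; coef_neq0 q0 q1.
- exact: stable_x0.
Qed.
Lemma preimage_x1 y : adm y ->
  (forall d, d \in [seq r.1 | r <- behead (opx1 q)] -> adm (y + d) ->
    preimage (y + d)) ->
  preimage y -> preimage (y + (1, 1, 0, 1)).
Proof.
move=> ay pre py.
apply: (@preimage_step (x c1) (head (0, fun=> 0) (opx1 q)) (behead (opx1 q))
   (opx1s q) y) => //.
- by move=> f sf; rewrite rho_xgen.
- by move=> f sf; rewrite -rho_star// rho_xgen_star.
- by apply/perm_mem; vm_compute.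
- exact: balanced_x1.
- exact: stable_x1.
- by case: y {ay pre py} => [[[l m] n] j] /=; coef_neq0 q0 q1.
- exact: stable_x1s.
Qed.
Lemma preimage_x1s y : adm y ->
  (forall d, d \in [seq r.1 | r <- behead (opx1s q)] -> adm (y + d) ->
    preimage (y + d)) ->
  preimage y -> preimage (y + (1, -1, 0, 1)).
Proof.
move=> ay pre py.
apply: (@preimage_step (star (x c1)) (head (0, fun=> 0) (opx1s q))
   (behead (opx1s q)) (opx1 q) y) => //.
- by move=> f sf; rewrite rho_xgen_star.
- by move=> f sf; rewrite -rho_star// starK rho_xgen.
- by apply/perm_mem; vm_compute.
- apply: balanced_sym; [|exact: balanced_x1].
  by move=> d; rewrite !inE; do ?case/orP; move=> /eqP->; vm_compute.
- exact: stable_x1s.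
- by case: y {ay pre py} => [[[l m] n] j] /=; coef_neq0 q0 q1.
- exact: stable_x1.
Qed.
Lemma preimage_x2 y : adm y ->
  (forall d, d \in [seq r.1 | r <- behead (opx2 q)] -> adm (y + d) ->
    preimage (y + d)) ->
  preimage y -> preimage (y + (1, 0, 1, 0)).
Proof.
move=> ay pre py.
apply: (@preimage_step (x c2) (head (0, fun=> 0) (opx2 q)) (behead (opx2 q))
   (opx2s q) y) => //.
- by move=> f sf; rewrite rho_xgen.
- by move=> f sf; rewrite -rho_star// rho_xgen_star.
- by apply/perm_mem; vm_compute.
- exact: balanced_x2.
- exact: stable_x2.
- by case: y {ay pre py} => [[[l m] n] j] /=; coef_neq0 q0 q1.
- exact: stable_x2s.
Qed.
Lemma preimage_x2s y : adm y ->
  (forall d, d \in [seq r.1 | r <- behead (opx2s q)] -> adm (y + d) ->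
    preimage (y + d)) ->
  preimage y -> preimage (y + (1, 0, -1, 0)).
Proof.
move=> ay pre py.
apply: (@preimage_step (star (x c2)) (head (0, fun=> 0) (opx2s q))
   (behead (opx2s q)) (opx2 q) y) => //.
- by move=> f sf; rewrite rho_xgen_star.
- by move=> f sf; rewrite -rho_star// starK rho_xgen.
- by apply/perm_mem; vm_compute.
- apply: balanced_sym; [|exact: balanced_x2].
  by move=> d; rewrite !inE; do ?case/orP; move=> /eqP->; vm_compute.
- exact: stable_x2s.
- by case: y {ay pre py} => [[[l m] n] j] /=; coef_neq0 q0 q1.
- exact: stable_x2.
Qed.

(** The encoding of [nkey], now on labels; it respects the order because [j <= l] on admissible
    ones. *)
Definition lj_key y := (absz y.1.1.1 * absz y.1.1.1 + absz y.2)%N.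

Lemma lt_lj_key y y' : adm y -> adm y' -> lt_lj y y' ->
  (lj_key y < lj_key y')%N.
Proof.
case: y y' => [[[l m] n] j] [[[l' m'] n'] j'] ay ay'.
rewrite /lt_lj /lj_key /= => H.
have jl : (absz j <= absz l)%N by admlia.
have : (absz l < absz l')%N \/ l = l' /\ (absz j < absz j')%N by admlia.
case=> [ll|[-> jj]]; last by rewrite ltn_add2l.
have : ((absz l).+1 * (absz l).+1 <= absz l' * absz l')%N by rewrite leq_mul.
by nia.
Qed.

Lemma preimage_adm y : adm y -> preimage y.
Proof.
have [k] := ubnP (lj_key y); elim: k y => // k IH y; rewrite ltnS => yk ay.
have {}IH y' : adm y' -> lt_lj y' y -> preimage y'.
  by move=> ay' /(lt_lj_key ay' ay) ?; apply: IH => //; apply: leq_trans yk.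
(* The unit is the preimage of the vacuum, its adjoint half being [gnorm 0 = 1]. *)
have vac0 : preimage 0.
  exists 1; have sv := @supported_vac R; split; first by rewrite rho1.
  by move=> g sg; rewrite -rho_star// star1 rho1// gnorm0// invr1 mul1r.
case: y {yk} ay IH => [[[l m] n] j] ay IH.
have pre (p : idx) (s : seq idx) :
   all (fun d : idx => (d.1.1.1 < p.1.1.1) ||
          (d.1.1.1 == p.1.1.1) && (d.2 < p.2)) s ->
   forall d, d \in s -> adm ((l, m, n, j) - p + d) ->
     preimage ((l, m, n, j) - p + d).
  move=> /allP sp d /sp; case: p d {sp} => [[[pl pm] pn] pj] [[[dl dm] dn] dj].
  by move=> /= lt adm_; apply: IH => //; rewrite /lt_lj /=; lia.
have low (p : idx) : p.1.1.1 = 1 -> adm ((l, m, n, j) - p) ->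
    preimage ((l, m, n, j) - p).
  move=> p1 ap; apply: IH => //; rewrite /lt_lj /=; lia.
(* The generator is chosen so that undoing its leading shift gives an admissible label: it brings
   [n] closer to 0, or for [n = 0] and [j > 0] lowers [j] and moves [m] towards 0. *)
case: (ltrgtP n 0) => n0.
- rewrite -[(l, m, n, j)](subrK ((1, 0, -1, 0) : idx)).
  have a : adm ((l, m, n, j) - (1, 0, -1, 0)) by admlia.
  by apply: preimage_x2s => //; [apply: pre|apply: low].
- rewrite -[(l, m, n, j)](subrK ((1, 0, 1, 0) : idx)).
  have a : adm ((l, m, n, j) - (1, 0, 1, 0)) by admlia.
  by apply: preimage_x2 => //; [apply: pre|apply: low].
(* With [n = j = 0] no step shrinks [n] or [j]; as [l] is even, a positive [l] allows a step of [x2]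
   from [(l - 1, 0, -1, 0)]. *)
have [j0|j0] := eqVneq j 0.
  have [l0|l0] := eqVneq l 0.
    have -> // : (l, m, n, j) = 0.
    by rewrite l0 n0 j0; congr (_, _, _, _); admlia.
  rewrite -[(l, m, n, j)](subrK ((1, 0, 1, 0) : idx)).
  have a : adm ((l, m, n, j) - (1, 0, 1, 0)) by admlia.
  by apply: preimage_x2 => //; [apply: pre|apply: low].
case: (ltrgtP m 0) => m0.
- rewrite -[(l, m, n, j)](subrK ((1, -1, 0, 1) : idx)).
  have a : adm ((l, m, n, j) - (1, -1, 0, 1)) by admlia.
  by apply: preimage_x1s => //; [apply: pre|apply: low].
- rewrite -[(l, m, n, j)](subrK ((1, 1, 0, 1) : idx)).
  have a : adm ((l, m, n, j) - (1, 1, 0, 1)) by admlia.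
  by apply: preimage_x1 => //; [apply: pre|apply: low].
rewrite -[(l, m, n, j)](subrK ((1, 0, 0, 1) : idx)).
have a : adm ((l, m, n, j) - (1, 0, 0, 1)) by admlia.
by apply: preimage_x0 => //; [apply: pre|apply: low].
Qed.

End Preimages.

(** * The symmetry transported to the model *)

Section Equivariance.
Variables (R : realType) (q : R).
Hypotheses (q0 : 0 < q) (q1 : q < 1).
Notation V := (idx -> R[i]).
Notation A := (qsphere q).
Local Notation rho := (@rho R q).
Local Notation vac := (@vac R).
Local Notation x := (xgen q).
Local Notation Q := (q%:C : R[i]).
Variable act : uq q -> A -> A.
Hypothesis act_sphere : sphere_action act.
Implicit Types (f g : V) (y d : idx) (a b : A).

Let msa := sphere_module_star_algebra act_sphere.

Definition weight (i : node) y : int :=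
  if i is n1 then y.1.1.2 else y.1.2 - y.1.1.2.
Definition opK (i : node) : shift_op (R := R) :=
  if i is n1 then opK1 q else opK2 q.
Definition opE (i : node) : shift_op (R := R) :=
  if i is n1 then opE1 q else opE2 q.

Lemma oapp_K i f y : oapp (opK i) f y = (q ^ weight i y)%:C * f y.
Proof.
by case: i y => [] [[[l m] n] j]; rewrite /oapp big_seq1 subr0.
Qed.

Lemma oapp_K_comm i (w : int) (L : shift_op (R := R)) f :
  (forall p, p \in [seq p.1 | p <- L] -> weight i p = w) ->
  oapp (opK i) (oapp L f) = (q ^ w)%:C *: oapp L (oapp (opK i) f).
Proof.
move=> wL; apply/funext => y; rewrite oapp_K fctE /oapp.
rewrite mulr_sumr scaler_sumr big_seq [RHS]big_seq; apply: eq_bigr => p pL.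
rewrite -!/(oapp _ _ _) oapp_K /*:%R /= mulrCA [in RHS]mulrCA; congr (_ * _).
rewrite mulrA -rmorphM -exprzD//; congr ((q ^ _)%:C * _).
rewrite -(wL p.1) ?map_f//.
move: p.1 => [[[dl dm] dn] dj]; case: y => [[[l m] n] j].
by case: (i) => /=; lia.
Qed.

Definition gen_weight (i : node) (c : scoord) : int :=
  match i, c with n1, c1 => 1 | n2, c2 => 1 | n2, c1 => - 1 | _, _ => 0 end.

Lemma act_K_gen i c : act (uK q i) (x c) = (q ^ gen_weight i c)%:C *: x c.
Proof.
rewrite (act_K act_sphere).
by case: i c => [] []; rewrite /= ?scale1r// -?exprzN ?expr1z// fmorphV.
Qed.

Lemma uKKinv i : uK q i * uKinv q i = 1.
Proof. by have := pr_rel (ur_KKinv q i); rewrite prM. Qed.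
Lemma uKinvK i : uKinv q i * uK q i = 1.
Proof. by have := pr_rel (ur_KinvK q i); rewrite prM. Qed.
Lemma star_uK i : star (uK q i) = uK q i.
Proof. by have := pr_rel (ur_Kstar q i); rewrite prS. Qed.
Lemma star_uKinv i : star (uKinv q i) = uKinv q i.
Proof.
rewrite -[LHS]mul1r -{1}(uKinvK i) -mulrA -{1}(star_uK i) -starM uKinvK.
by rewrite star1 mulr1.
Qed.

Lemma actZ h c a : act h (c *: a) = c *: act h a.
Proof.
have a0 : act h 0 = 0.
  have := act_linear_r msa (-1) h 0 0; rewrite !scaleN1r oppr0 addr0.
  by rewrite addNr.
by have := act_linear_r msa c h a 0; rewrite !addr0 a0 addr0.
Qed.

Lemma act_Kinv_gen i c :
  act (uKinv q i) (x c) = (q ^ (- gen_weight i c))%:C *: x c.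
Proof.
have qg : (q ^ gen_weight i c)%:C != 0 :> R[i].
  by rewrite fmorph_eq0 expfz_neq0// gt_eqF.
apply: (scalerI qg); rewrite -actZ -act_K_gen -(act_M msa) uKinvK (act_1 msa).
by rewrite scalerA -rmorphM -exprzD// subrr expr0z scale1r.
Qed.

Lemma act_K_star i a : act (uK q i) (star a) = star (act (uKinv q i) a).
Proof. by rewrite (act_star msa _ (ant_K q i)) star_uKinv. Qed.
Lemma act_Kinv_star i a : act (uKinv q i) (star a) = star (act (uK q i) a).
Proof. by rewrite (act_star msa _ (ant_Kinv q i)) star_uK. Qed.

Lemma act_KM i a b : act (uK q i) (a * b) = act (uK q i) a * act (uK q i) b.
Proof. by rewrite (act_mul msa _ _ (cop_K q i)) big_seq1. Qed.
Lemma act_EM i a b : act (uE q i) (a * b) =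
  act (uE q i) a * act (uK q i) b + act (uKinv q i) a * act (uE q i) b.
Proof. by rewrite (act_mul msa _ _ (cop_E q i)) big_cons big_seq1. Qed.

Lemma counit_gen_pr (g : ugen) : counit (gen (uq_rel q) g) = counit_gen R g.
Proof. exact: (@counit_pr R q (SGen R[i] g)). Qed.
Lemma act_K1 i : act (uK q i) 1 = 1.
Proof. by rewrite (act_unit msa) counit_gen_pr scale1r. Qed.
Lemma act_E1 i : act (uE q i) 1 = 0.
Proof. by rewrite (act_unit msa) counit_gen_pr scale0r. Qed.

Definition op_weight (i : node) (c : scoord) (st : bool) : int :=
  if st then - gen_weight i c else gen_weight i c.

Lemma op_weightP i c st p : p \in [seq r.1 | r <- opgen q c st] ->
  weight i p = op_weight i c st.
Proof.
by case: i c st => [] [] []; rewrite !inE; do ?case/orP; move=> /eqP->.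
Qed.

(** The element [K_i] is grouplike, so each letter of a word contributes exactly the weight by which
    its operator shifts labels. *)
Lemma rho_act_K i a : rho (act (uK q i) a) vac = oapp (opK i) (rho a vac).
Proof.
have sv := @supported_vac R.
elim/presented_word_ind: a => [|c a b IHa IHb|c a IH|c a IH].
- rewrite act_K1 rho1//; apply/funext => y; rewrite oapp_K /vac /delta.
  case: eqVneq => [->|]; rewrite ?mulr0// /weight.
  by case: (i); rewrite /= ?subr0 expr0z mulr1.
- rewrite (act_linear_r msa) !rhoD// !rhoZ// IHa IHb.
  by rewrite oapp_linear.
- have sf := supported_rho (q := q) a sv.
  have sK : supported (oapp (opK i) (rho a vac)).
    by rewrite -IH; apply: supported_rho.
  rewrite act_KM act_K_gen rhoM// IH rhoZ// [rho (x c * a) _]rhoM//.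
  rewrite !rho_xgen// (oapp_K_comm (w := gen_weight i c))// => p.
  exact: (@op_weightP _ _ false).
- have sf := supported_rho (q := q) a sv.
  have sK : supported (oapp (opK i) (rho a vac)).
    by rewrite -IH; apply: supported_rho.
  rewrite act_KM act_K_star act_Kinv_gen starZ conjC_real.
  rewrite rhoM// IH rhoZ// [rho (star (x c) * a) _]rhoM// !rho_xgen_star//.
  rewrite (oapp_K_comm (w := - gen_weight i c))// => p.
  exact: (@op_weightP _ _ true).
Qed.

Lemma conjQ n : Num.conj (Q ^+ n) = Q ^+ n.
Proof. by rewrite rmorphXn /= conjC_real. Qed.

(** From [S(E_i) = -q^i E_i]. It turns the given values of [F_i] on the generators into the values
    of [E_i] on their adjoints. *)
Lemma act_E_star i a :
  act (uE q i) (star a) = - (Q ^+ i *: star (act (uF q i) a)).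
Proof.
rewrite (act_star msa _ (ant_E q i)) starN starZ conjQ.
rewrite -scaleN1r scalerA -[(-1) * _ *: _]addr0.
have a0 : act 0 a = 0.
  have := act_linear_l msa (-1) 0 0 a; rewrite !scaleN1r oppr0 addr0.
  by rewrite addNr.
have cQ : Num.conj (-1 * Q ^+ i) = - Q ^+ i.
  by rewrite mulN1r -{2}(conjQ i); apply: (rmorphN Num.conj).
by rewrite (act_linear_l msa) a0 addr0 starZ cQ scaleNr.
Qed.

Local Notation p := (q `^ 2^-1).
(** The factor kept out of the rational model. [E_1] raises [m + n] by one, so the factor
    [q^(m + n)] of [gnorm] yields a half-integer power of [q]; [E_2] leaves [m + n] unchanged. *)
Definition Escale (i : node) : R := if i is n1 then p else 1.

Lemma sqrt_q : p * p = q.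
Proof. by rewrite powR12_sqrt ?ltW// -expr2 sqr_sqrtr// ltW. Qed.

(** The coproduct gives [E(u b) = (E u)(K b) + (K^-1 u)(E b)]; the operator identity among the
    premises is the same rule in the model, with [u'] proportional to [E u]. *)
Lemma rho_act_E_step i u (op op' : shift_op (R := R)) (c w : R[i]) (u' : A) b :
  (forall f, supported f -> rho u f = oapp op f) ->
  (forall f, supported f -> rho u' f = oapp op' f) ->
  act (uE q i) u = c *: u' -> act (uKinv q i) u = w *: u ->
  (forall f, supported f -> (Escale i)%:C *: oapp (opE i) (oapp op f) =
    c *: oapp op' (oapp (opK i) f)
     + w *: oapp op ((Escale i)%:C *: oapp (opE i) f)) ->
  rho (act (uE q i) b) vac = (Escale i)%:C *: oapp (opE i) (rho b vac) ->
  rho (act (uE q i) (u * b)) vac = (Escale i)%:C *: oapp (opE i) (rho (u * b) vac).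
Proof.
move=> uE u'E Eu Ku rel IH; have sv := @supported_vac R.
have sf : supported (rho b vac) by apply: supported_rho.
have sK : supported (oapp (opK i) (rho b vac)).
  by rewrite -rho_act_K; apply: supported_rho.
have sE : supported ((Escale i)%:C *: oapp (opE i) (rho b vac)).
  by rewrite -IH; apply: supported_rho.
rewrite act_EM Eu Ku rhoD// !rhoM// rho_act_K IH.
rewrite [rho (c *: _) _]rhoZ// [rho (w *: _) _]rhoZ//.
by rewrite u'E// uE// [in RHS]uE// rel.
Qed.

Lemma rho_act_E_comm i u (op : shift_op (R := R)) (w : R) b :
  (forall f, supported f -> rho u f = oapp op f) ->
  act (uE q i) u = 0 -> act (uKinv q i) u = w%:C *: u ->
  (forall f, supported f ->
    oapp (opE i) (oapp op f) = w%:C *: oapp op (oapp (opE i) f)) ->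
  rho (act (uE q i) b) vac = (Escale i)%:C *: oapp (opE i) (rho b vac) ->
  rho (act (uE q i) (u * b)) vac =
    (Escale i)%:C *: oapp (opE i) (rho (u * b) vac).
Proof.
move=> uE Eu Ku rel; apply: (rho_act_E_step (c := 0) uE uE _ Ku).
  by rewrite Eu scale0r.
move=> f sf; rewrite rel// scale0r add0r oappZ !scalerA mulrC//.
Qed.

Lemma rho_act_E i a :
  rho (act (uE q i) a) vac = (Escale i)%:C *: oapp (opE i) (rho a vac).
Proof.
have sv := @supported_vac R.
have p0 : p != 0 by rewrite gt_eqF// powR_gt0.
have pq : p^-1 * p^-1 = q^-1 by rewrite -invfM sqrt_q.
have X c f : supported f -> rho (x c) f = oapp (opgen q c false) f.
  by move=> sf; rewrite rho_xgen.
have Xs c f : supported f -> rho (star (x c)) f = oapp (opgen q c true) f.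
  by move=> sf; rewrite rho_xgen_star.
have Kg (c : scoord) (w : R) : w = q ^ (- gen_weight i c) ->
    act (uKinv q i) (x c) = w%:C *: x c.
  by move=> ->; apply: act_Kinv_gen.
have Kgs (c : scoord) (w : R) : w = q ^ gen_weight i c ->
    act (uKinv q i) (star (x c)) = w%:C *: star (x c).
  by move=> ->; rewrite act_Kinv_star act_K_gen starZ conjC_real.
have Hgen c b : rho (act (uE q i) b) vac
     = (Escale i)%:C *: oapp (opE i) (rho b vac) ->
    rho (act (uE q i) (x c * b)) vac =
      (Escale i)%:C *: oapp (opE i) (rho (x c * b) vac).
  move: (act_E act_sphere i c) (X c) => Ec Xc.
  case: i c Ec Xc Kg {Kgs} => [] [] Ec Xc Kg.
  - apply: (rho_act_E_step (w := 1%:C) Xc (X c1) Ec); first exact: Kg.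
    move=> f sf; rewrite -oapp_comp (same_action_oapp sf (rel_E1x0 q0 q1)).
    rewrite oapp_cat oapp_scale !oapp_comp scale1r oappZ scalerDr scalerA.
    by rewrite -rmorphM powRN -pq mulrA divff// mul1r.
  - apply: (rho_act_E_comm (w := q^-1) Xc Ec); first exact: Kg.
    move=> f sf; rewrite -oapp_comp (same_action_oapp sf (rel_E1x1 q0 q1)).
    by rewrite oapp_scale oapp_comp.
  - apply: (rho_act_E_comm (w := 1) Xc Ec); first exact: Kg.
    move=> f sf; rewrite -oapp_comp (same_action_oapp sf (rel_E1x2 q0 q1)).
    by rewrite oapp_comp scale1r.
  - apply: (rho_act_E_comm (w := 1) Xc Ec); first exact: Kg.
    move=> f sf; rewrite -oapp_comp (same_action_oapp sf (rel_E2x0 q0 q1)).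
    by rewrite oapp_comp scale1r.
  - rewrite -[x c2]scale1r in Ec.
    apply: (rho_act_E_step (w := q%:C) Xc (X c2) Ec).
      by apply: Kg; rewrite /= opprK expr1z.
    move=> f sf; rewrite -oapp_comp (same_action_oapp sf (rel_E2x1 q0 q1)).
    by rewrite oapp_cat oapp_scale !oapp_comp !scale1r.
  - apply: (rho_act_E_comm (w := q^-1) Xc Ec); first exact: Kg.
    move=> f sf; rewrite -oapp_comp (same_action_oapp sf (rel_E2x2 q0 q1)).
    by rewrite oapp_scale oapp_comp.
have Hstar c b : rho (act (uE q i) b) vac
     = (Escale i)%:C *: oapp (opE i) (rho b vac) ->
    rho (act (uE q i) (star (x c) * b)) vac =
      (Escale i)%:C *: oapp (opE i) (rho (star (x c) * b) vac).
  move: (act_E_star i (x c)) (Xs c); rewrite (act_F act_sphere) => Ec Xc.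
  case: i c Ec Xc Kgs Hgen {Kg} => [] [] Ec Xc Kg Hgen.
  - by rewrite [star _]star_x0; apply: Hgen.
  - rewrite starZ [star (x c0)]star_x0 scalerA -scaleNr -rmorphM conjC_real in Ec.
    rewrite -rmorphM -rmorphN in Ec.
    apply: (rho_act_E_step (w := q%:C) Xc (X c0) Ec).
      by apply: Kg; rewrite /= expr1z.
    move=> f sf; rewrite -oapp_comp (same_action_oapp sf (rel_E1x1s q0 q1)).
    rewrite oapp_cat !oapp_scale !oapp_comp oappZ scalerDr !scalerA.
    by rewrite -!rmorphM; congr (_%:C *: _ + _%:C *: _); rewrite /=; ring.
  - rewrite star0 scaler0 oppr0 in Ec.
    apply: (rho_act_E_comm (w := 1) Xc Ec); first exact: Kg.
    move=> f sf; rewrite -oapp_comp (same_action_oapp sf (rel_E1x2s q0 q1)).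
    by rewrite oapp_comp scale1r.
  - by rewrite [star _]star_x0; apply: Hgen.
  - rewrite star0 scaler0 oppr0 in Ec.
    apply: (rho_act_E_comm (w := q^-1) Xc Ec); first exact: Kg.
    move=> f sf; rewrite -oapp_comp (same_action_oapp sf (rel_E2x1s q0 q1)).
    by rewrite oapp_scale oapp_comp.
  - have Q2 : (Q ^+ n2 : R[i]) = (q ^+ 2)%:C by rewrite rmorphXn.
    rewrite -scaleNr Q2 -rmorphN in Ec.
    apply: (rho_act_E_step (w := q%:C) Xc (Xs c1) Ec).
      by apply: Kg; rewrite /= expr1z.
    move=> f sf; rewrite -oapp_comp (same_action_oapp sf (rel_E2x2s q0 q1)).
    by rewrite oapp_cat !oapp_scale !oapp_comp !scale1r.
elim/presented_word_ind: a => [|c a b IHa IHb|c a IH|c a IH].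
- rewrite act_E1 rho1// -[X in rho X](scale0r (0 : A)) rhoZ// scale0r /vac.
  (* The model operators kill the vacuum because [[j - m]], [[l - j - n]] and [[j + m]] are all
     [[0]] there. *)
  rewrite oapp_delta; case: (i); rewrite ?big_cons big_nil /=.
    by rewrite subrr qint0 scale0r addr0 scaler0.
  by rewrite !subr0 addr0 qint0 !mul0r !scale0r !addr0 scaler0.
- rewrite (act_linear_r msa) !rhoD// !rhoZ// IHa IHb oapp_linear.
  by rewrite scalerDr !scalerA mulrC.
- exact: Hgen.
- exact: Hstar.
Qed.

End Equivariance.

(** * The kets inside the algebra, and the invariant state on them *)

Section Kets.
Variables (R : realType) (q : R).
Hypotheses (q0 : 0 < q) (q1 : q < 1).
Notation V := (idx -> R[i]).
Notation A := (qsphere q).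
Local Notation rho := (@rho R q).
Local Notation rhoS := (@rhoS R q).
Local Notation vac := (@vac R).
Local Notation x := (xgen q).
Local Notation gnorm := (gnorm q).
Variable act : uq q -> A -> A.
Hypothesis act_sphere : sphere_action act.
Variable phi : {scalar A}.
Hypothesis phi_state : invariant_faithful_state act phi.
Implicit Types (f g : V) (y d : idx) (a b : A).

Let msa := sphere_module_star_algebra act_sphere.
Let sv : supported vac := @supported_vac R.

(** The rescaled ket as an element of the algebra. Choosing it through [preimage_adm] retains the
    adjoint property, and the value 0 elsewhere matches the convention on inadmissible kets. *)
Definition harm y : A :=
  match pselect (adm y) with
  | left ay => projT1 (cid (preimage_adm q0 q1 ay))
  | right _ => 0
  end.

Lemma harmP y : adm y -> rho (harm y) vac = delta y /\
  forall g, supported g -> rhoS (harm y) g 0 = ((gnorm y)^-1)%:C * g y.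
Proof. by rewrite /harm; case: pselect => // ay _; case: cid. Qed.
Lemma harm_nadm y : ~~ adm y -> harm y = 0.
Proof. by rewrite /harm; case: pselect => // ay /negP. Qed.
Lemma rho_harm y : adm y -> rho (harm y) vac = delta y.
Proof. by move/harmP => []. Qed.

Lemma rho_vac_eq a b : rho a vac = rho b vac -> a = b.
Proof.
move=> ab; apply/eqP; rewrite -subr_eq0; apply/eqP.
by apply: (rho_vac_inj q0 q1); rewrite rhoB// ab subrr.
Qed.

Lemma oapp_delta_ocoef (L : shift_op (R := R)) y : uniq [seq p.1 | p <- L] ->
  oapp L (delta y) =
  \sum_(d <- [seq p.1 | p <- L]) (ocoef L d y)%:C *: delta (y + d).
Proof.
move=> uL; apply/funext => z; rewrite (oapp_coef (s := [seq r.1 | r <- L]))//.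
rewrite fct_sumE; apply: eq_bigr => d _; rewrite /delta fctE subr_eq.
by case: eqVneq => [->|_]; rewrite ?addrK // !mulr0 scaler0.
Qed.

Lemma harm_oapp b y (L : shift_op (R := R)) :
  rho b vac = oapp L (delta y) -> uniq [seq p.1 | p <- L] -> stable L ->
  adm y ->
  b = \sum_(d <- [seq p.1 | p <- L]) (ocoef L d y)%:C *: harm (y + d).
Proof.
move=> bL uL sL ay; apply: rho_vac_eq; rewrite bL rho_sum// oapp_delta_ocoef//.
rewrite big_seq [RHS]big_seq; apply: eq_bigr => d dL.
have [ayd|nayd] := boolP (adm (y + d)); first by rewrite rho_harm.
by rewrite sL// !scale0r.
Qed.

Lemma mul_harm u y (L : shift_op (R := R)) :
  (forall f, supported f -> rho u f = oapp L f) ->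
  uniq [seq p.1 | p <- L] -> stable L -> adm y ->
  u * harm y = \sum_(d <- [seq p.1 | p <- L]) (ocoef L d y)%:C *: harm (y + d).
Proof.
move=> uE uL sL ay; apply: harm_oapp => //.
by rewrite rhoM// rho_harm// uE//; apply: supported_delta.
Qed.

Lemma adm0 : adm 0. Proof. by []. Qed.

Lemma harm0 : harm 0 = 1.
Proof. by apply: rho_vac_eq; rewrite rho_harm ?adm0// rho1. Qed.

Lemma uniq_opgen c st : uniq [seq p.1 | p <- opgen q c st].
Proof. by case: c st => [] []. Qed.

Lemma harm_span a : lspan harm a.
Proof.
have mulx u (L : shift_op (R := R)) b :
    (forall f, supported f -> rho u f = oapp L f) ->
    uniq [seq p.1 | p <- L] -> stable L -> lspan harm b -> lspan harm (u * b).
  move=> uE uL sL [s [c [_ ->]]]; rewrite mulr_sumr.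
  under eq_bigr do rewrite -scalerAr.
  apply: lspan_sub => y _; have [ay|nay] := boolP (adm y).
    rewrite (mul_harm uE uL sL ay).
    by apply: (lspan_sub (fun d => (ocoef L d y)%:C)) => d _; apply: lspan_e.
  by rewrite harm_nadm// mulr0; apply: lspan0.
elim/presented_word_ind: a => [|c a b|c a|c a].
- by rewrite -harm0; apply: lspan_e.
- exact: lspan_linear.
- apply: (mulx _ (opgen q c false)); [|exact: uniq_opgen|exact: stable_opgen].
  by move=> f sf; apply: rho_xgen.
- apply: (mulx _ (opgen q c true)); [|exact: uniq_opgen|exact: stable_opgen].
  by move=> f sf; apply: rho_xgen_star.
Qed.

Lemma act_K_harm i y : adm y ->
  act (uK q i) (harm y) = (q ^ weight i y)%:C *: harm y.
Proof.
move=> ay; apply: rho_vac_eq; rewrite rho_act_K// rhoZ// rho_harm//.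
apply/funext => z; rewrite oapp_K fctE /delta.
by case: eqVneq => [->|] //; rewrite mulr0 scaler0.
Qed.

Lemma act_E_harm i y : adm y ->
  act (uE q i) (harm y) = (Escale q i)%:C *:
   \sum_(d <- [seq p.1 | p <- opE q i]) (ocoef (opE q i) d y)%:C *: harm (y + d).
Proof.
move=> ay; have Es : (Escale q i)%:C != 0 :> R[i].
  rewrite fmorph_eq0; case: i => /=; last exact: oner_neq0.
  by rewrite gt_eqF// powR_gt0.
apply: (scalerI (invr_neq0 Es)); rewrite [RHS]scalerK//; apply: harm_oapp => //.
- by rewrite rhoZ// rho_act_E// scalerK// rho_harm.
- by case: (i).
- by case: (i); [apply: stable_E1|apply: stable_E2].
Qed.

Lemma phi_K i a : phi (act (uK q i) a) = phi a.
Proof. by rewrite (phi_invariant phi_state) counit_gen_pr mul1r. Qed.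
Lemma phi_E i a : phi (act (uE q i) a) = 0.
Proof. by rewrite (phi_invariant phi_state) counit_gen_pr mul0r. Qed.

(** [K_i] multiplies the ket by [q^w] with [w <> 0], whereas the state is unchanged under [K_i]. *)
Lemma phi_harm_weight i y : weight i y != 0 -> phi (harm y) = 0.
Proof.
move=> wy; have [ay|nay] := boolP (adm y); last by rewrite harm_nadm// linear0.
have := phi_K i (harm y); rewrite act_K_harm// linearZ /=.
move/eqP; rewrite -subr_eq0 -{2}[phi _]mul1r -mulrBl mulf_eq0.
case/orP => [|/eqP//]; rewrite subr_eq0 -(rmorph1 (real_complex R)).
by rewrite (inj_eq (fmorph_inj _)) (negbTE (exprz_neq1 q0 q1 wy)).
Qed.

(** The ket is a nonzero multiple of the image under [E_1] of the one at [(l, -1, 0, j)], with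
    bracket [[j + 1]], and the state vanishes on such images. *)
Lemma phi_harm_j l j : j != 0 -> phi (harm (l, 0, 0, j)) = 0.
Proof.
move=> j0; have [ay|nay] := boolP (adm (l, 0, 0, j)); last first.
  by rewrite harm_nadm// linear0.
have ay' : adm (l, -1, 0, j) by admlia.
have := phi_E n1 (harm (l, -1, 0, j)).
rewrite act_E_harm// big_seq1 /= !linearZ /=.
rewrite (_ : _ + _ = (l, 0, 0, j)); last by congr (_, _, _, _); rewrite /= addr0.
move/eqP; rewrite !mulf_eq0 !fmorph_eq0 (gt_eqF (powR_gt0 _ q0)) /= addr0.
rewrite (negbTE (qint_neq0 q0 q1 _)) /= => [/eqP//|].
by admlia.
Qed.

Lemma phi_harm y : phi (harm y) = (y == 0)%:R.
Proof.
have [->|y0] := eqVneq y 0; first by rewrite harm0 (phi_1 phi_state).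
have [ay|nay] := boolP (adm y); last by rewrite harm_nadm// linear0.
have [w1|/(phi_harm_weight (i := n1))//] := eqVneq (weight n1 y) 0.
have [w2|/(phi_harm_weight (i := n2))//] := eqVneq (weight n2 y) 0.
case: y y0 ay w1 w2 => [[[l m] n] j] y0 ay /= w1 w2.
have m0 : m = 0 by []; have n0 : n = 0 by lia.
rewrite {}m0 {}n0 {m n w1 w2} in y0 ay *.
have [j0|/phi_harm_j//] := eqVneq j 0; rewrite {}j0 {j} in y0 ay *.
(* Admissibility with [n = j = 0] forces [l] to be even. *)
have l2 : 2 <= l.
  have : l != 0 by apply: contraNneq y0 => ->.
  by admlia.
(* [E_2] sends this ket to a combination of those at [(l, 0, 0, 2)] and [(l, 0, 0, 0)]; the state
   already vanishes on the first, and the coefficient of the second is nonzero. *)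
have ay' : adm (l, 1, -1, 1) by admlia.
have := phi_E n2 (harm (l, 1, -1, 1)).
rewrite act_E_harm// big_cons big_seq1 /= scale1r linearD !linearZ /=.
rewrite (_ : (_ + (_, _, _, 1)) = (l, 0, 0, 2)); last first.
  by congr (_, _, _, _); rewrite /= addr0.
rewrite phi_harm_j// mulr0 add0r.
rewrite (_ : (_ + (_, _, _, -1)) = (l, 0, 0, 0)); last first.
  by congr (_, _, _, _); rewrite /= addr0.
move/eqP; rewrite mulf_eq0 fmorph_eq0 => /orP[|/eqP//].
rewrite /= addr0 => /negPn/negP[].
coef_neq0 q0 q1.
Qed.

(** The state is the vacuum coefficient of [a] on the vacuum vector: both sides are linear and agree
    on the spanning kets. *)
Lemma phiE a : phi a = rho a vac 0.
Proof.
have [s [c [_ ->]]] := harm_span a; rewrite rho_sum// linear_sum fct_sumE.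
apply: eq_bigr => y _; rewrite linearZ /= phi_harm fctE.
have [ay|nay] := boolP (adm y).
  by rewrite rho_harm// /delta eq_sym.
rewrite harm_nadm// -[X in rho X](scale0r (0 : A)) rhoZ// scale0r.
by case: eqVneq nay => [->|]; rewrite ?adm0.
Qed.

(** Here the adjoint half of [preimage] is used: by [phiE] the left side is the vacuum coefficient
    of the adjoint of [harm y] on [delta z]. *)
Lemma phi_harm_harm y z : adm y -> adm z ->
  phi (star (harm y) * harm z) = ((gnorm y)^-1)%:C * (y == z)%:R.
Proof.
move=> ay az; rewrite phiE rhoM// rho_harm// rho_star//;
  last exact: supported_delta.
by rewrite (harmP ay).2//; apply: supported_delta.
Qed.

End Kets.

(** * Half-integer powers and square roots *)

Section Coefficients.
Variables (R : realType) (q : R).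
Hypotheses (q0 : 0 < q) (q1 : q < 1).
Local Notation gnorm := (gnorm q).
Local Notation p := (q `^ 2^-1).
Implicit Types (y d : idx) (z : int).

(** Both sides have the same square, and their product is nonnegative, so they can be opposite only
    when both vanish. *)
Lemma sqrt_coef (n n' r rs t : R) : 0 < n -> 0 < n' -> n' * rs = n * r ->
  t ^+ 2 = r * rs -> 0 <= t * r -> r * Num.sqrt n = t * Num.sqrt n'.
Proof.
move=> n0 n'0 E t2 tr.
have sq : (r * Num.sqrt n) ^+ 2 = (t * Num.sqrt n') ^+ 2.
  rewrite !exprMn !sqr_sqrtr ?ltW// t2 expr2 -!mulrA; congr (_ * _).
  by rewrite mulrC -E mulrC.
have pos : 0 <= (r * Num.sqrt n) * (t * Num.sqrt n').
  by rewrite mulrACA [r * t]mulrC mulr_ge0// mulr_ge0// sqrtr_ge0.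
move/eqP: sq; rewrite eqf_sqr => /orP[/eqP//|/eqP e].
move: pos; rewrite e mulNr oppr_ge0 -expr2 => pos.
have : (t * Num.sqrt n') ^+ 2 == 0 by rewrite eq_le pos sqr_ge0.
by rewrite sqrf_eq0 => /eqP ->; rewrite oppr0.
Qed.

Lemma powR_half z : q `^ (z%:~R + 2^-1) = q ^ z * p.
Proof. by rewrite powRD ?(q_neq0 q0) ?implybT// powR_intmul// ltW. Qed.
Lemma powR_nhalf z : q `^ (z%:~R - 2^-1) = q ^ z / p.
Proof. by rewrite powRD ?(q_neq0 q0) ?implybT// powR_intmul ?powRN// ltW. Qed.
Lemma powR_3half z : q `^ (z%:~R + 3 / 2) = q ^ z * q * p.
Proof.
have -> : z%:~R + 3 / 2 = (z + 1)%:~R + 2^-1 :> R by rewrite intrD; field.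
by rewrite powR_half exprzD// expr1z.
Qed.
Lemma powR_n3half z : q `^ (z%:~R - 3 / 2) = q ^ z / q / p.
Proof.
have -> : z%:~R - 3 / 2 = (z - 1)%:~R - 2^-1 :> R by rewrite intrB; field.
by rewrite powR_nhalf exprzD// exprzN expr1z.
Qed.

End Coefficients.

Ltac unify_qint :=
  repeat match goal with
  | |- context [qint ?q ?a] =>
    match goal with
    | |- context [qint q ?b] =>
      tryif constr_eq a b then fail else
      (let E := fresh in (have E : a = b by ring); rewrite E; clear E)
    end
  end.
Ltac factor_ge0 q0 q1 :=
  lazymatch goal with
  | |- is_true (Order.le _ (GRing.mul _ _)) =>
      apply: mulr_ge0; factor_ge0 q0 q1
  | |- is_true (Order.le _ (GRing.inv _)) =>
      rewrite invr_ge0; factor_ge0 q0 q1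
  | |- is_true (Order.le _ (qint _ _)) => apply: (qint_ge0 q0 q1); admlia
  | |- is_true (Order.le _ (exprz _ _)) => apply: exprz_ge0; exact: ltW
  | |- is_true (Order.le _ (powR _ _)) => exact: powR_ge0
  | |- is_true (Order.le _ (Num.sqrt _)) => exact: sqrtr_ge0
  | |- is_true (Order.le _ _) => exact: ltW
  end.

(** * The coefficients of the theorem along each step *)

Section EdgeCoefficients.
Variables (R : realType) (q : R).
Hypotheses (q0 : 0 < q) (q1 : q < 1).
Local Notation gnorm := (gnorm q).
Local Notation p := (q `^ 2^-1).

Lemma edge_coef (L M : shift_op (R := R)) (d y : idx) (t : R) :
  balanced q L M -> d \in [seq p.1 | p <- L] -> adm y -> adm (y + d) ->
  t ^+ 2 = ocoef L d y * ocoef M (- d) (y + d) -> 0 <= t * ocoef L d y ->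
  ocoef L d y * Num.sqrt (gnorm y) = t * Num.sqrt (gnorm (y + d)).
Proof.
move=> bal dL ay ayd; apply: sqrt_coef; [exact: gnorm_gt0|exact: gnorm_gt0|].
exact: bal.
Qed.

Definition coefs_x0 (y : idx) : seq (idx * R) :=
  let: (l, m, n, j) := y in
  [:: ((1, 0, 0, 1), coefA q j m * coefCp q l j n);
      ((-1, 0, 0, 1), coefA q j m * coefCm q l j n);
      ((1, 0, 0, -1), coefA q (j - 1) m * coefCm q (l + 1) (j - 1) n);
      ((-1, 0, 0, -1), coefA q (j - 1) m * coefCp q (l - 1) (j - 1) n)].
Definition coefs_x1 (y : idx) : seq (idx * R) :=
  let: (l, m, n, j) := y in
  [:: ((1, 1, 0, 1), coefBp q j m * coefCp q l j n);
      ((-1, 1, 0, 1), coefBp q j m * coefCm q l j n);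
      ((1, 1, 0, -1), coefBm q j m * coefCm q (l + 1) (j - 1) n);
      ((-1, 1, 0, -1), coefBm q j m * coefCp q (l - 1) (j - 1) n)].
Definition coefs_x2 (y : idx) : seq (idx * R) :=
  let: (l, m, n, j) := y in
  [:: ((1, 0, 1, 0), coefDp q l j n); ((-1, 0, 1, 0), coefDm q l j n)].
(** The division by [q^(1/2)] compensates [Escale]. *)
Definition coefs_E1 (y : idx) : seq (idx * R) :=
  let: (l, m, n, j) := y in
  [:: ((0, 1, 0, 0), Num.sqrt (qint q (j - m) * qint q (j + m + 1)) / p)].
Definition coefs_E2 (y : idx) : seq (idx * R) :=
  let: (l, m, n, j) := y in
  [:: ((0, -1, 1, 1), Num.sqrt (qint q (j - m + 1) * qint q (j - m + 2))
         * sigma_a q l j n);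
      ((0, -1, 1, -1), Num.sqrt (qint q (j + m) * qint q (j + m - 1))
         * sigma_c q l j n)].

Definition edge_coefs (L : shift_op (R := R)) (ts : seq (idx * R)) (y : idx) :=
  forall r, r \in ts -> adm (y + r.1) ->
  ocoef L r.1 y * Num.sqrt (gnorm y) = r.2 * Num.sqrt (gnorm (y + r.1)).

Ltac unfold_coefs :=
  cbn -[GRing.add GRing.mul GRing.opp GRing.zero GRing.one eq_op exprz qint
        GRing.inv intmul GRing.natmul GRing.exp qfact qdfact powR
        Num.sqrt coefA coefBp coefBm coefCp coefCm coefDp coefDm
        sigma_a sigma_c];
  repeat (match goal with |- context [if ?c then _ else _] =>
     let v := eval vm_compute in c in change c with v end; cbv iota);
  rewrite /coefA /coefBp /coefBm /coefCp /coefCm /coefDp /coefDm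
    /sigma_a /sigma_c
    ?(powR_half q0) ?(powR_nhalf q0) ?(powR_3half q0) ?(powR_n3half q0).
Ltac check_square :=
  rewrite idxD; unfold_coefs;
  rewrite ?exprMn ?sqrrN ?exprMn ?exprVn ?(expr2 p) ?(sqrt_q q0) ?sqr_sqrtr;
  try (factor_ge0 q0 q1); rewrite ?addr0; unify_qint;
  rewrite ?(exprzD q0) ?exprzN ?(exprzD q0) ?exprzN ?expr1z ?expr0z ?exprz_nat;
  field;
  repeat (apply/andP; split);
  first [ exact: (q_neq0 q0) | exact: (expfz_neq0 _ (q_neq0 q0))
        | by apply: (qint_neq0 q0 q1); admlia ].
Ltac check_sign :=
  unfold_coefs; rewrite ?addr0 ?(mulrN, mulNr, opprK); factor_ge0 q0 q1.
Ltac check_coefs bal :=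
  move=> ?; rewrite [_ \in _]/= !inE; do ?case/orP; move=> /eqP->;
  cbn [fst snd] => ?;
  (apply: (edge_coef bal) => //; [check_square|check_sign]).

Lemma edge_coefs_x2 y : adm y -> edge_coefs (opx2 q) (coefs_x2 y) y.
Proof.
case: y => [[[l m] n] j] ay.
check_coefs (balanced_x2 q0 q1).
Qed.
Lemma edge_coefs_x0 y : adm y -> edge_coefs (opx0 q) (coefs_x0 y) y.
Proof.
case: y => [[[l m] n] j] ay.
check_coefs (balanced_x0 q0 q1).
Qed.
Lemma edge_coefs_x1 y : adm y -> edge_coefs (opx1 q) (coefs_x1 y) y.
Proof.
case: y => [[[l m] n] j] ay.
check_coefs (balanced_x1 q0 q1).
Qed.
Lemma edge_coefs_E1 y : adm y -> edge_coefs (opE1 q) (coefs_E1 y) y.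
Proof.
case: y => [[[l m] n] j] ay.
check_coefs (balanced_E1 q0 q1).
Qed.
Lemma edge_coefs_E2 y : adm y -> edge_coefs (opE2 q) (coefs_E2 y) y.
Proof.
case: y => [[[l m] n] j] ay.
check_coefs (balanced_E2 q0 q1).
Qed.
End EdgeCoefficients.

(** * The normalised kets form the required basis *)

Section OrthonormalBasis.
Variables (R : realType) (q : R).
Hypotheses (q0 : 0 < q) (q1 : q < 1).
Notation A := (qsphere q).
Local Notation x := (xgen q).
Local Notation gnorm := (gnorm q).
Variable act : uq q -> A -> A.
Hypothesis act_sphere : sphere_action act.
Variable phi : {scalar A}.
Hypothesis phi_state : invariant_faithful_state act phi.
Implicit Types (y d : idx) (a b : A).
Local Notation harm := (@harm R q q0 q1).

Let msa := sphere_module_star_algebra act_sphere.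

Lemma uKE i : uK q i * uE q i * uKinv q i = (q%:C ^+ i : R[i]) *: uE q i.
Proof. by have := pr_rel (ur_KE q i); rewrite prZ !prM. Qed.

Lemma act_scale_l (c : R[i]) h a : act (c *: h) a = c *: act h a.
Proof.
have a0 : act 0 a = 0.
  have := act_linear_l msa (-1) 0 0 a; rewrite !scaleN1r oppr0 addr0.
  by rewrite addNr.
by rewrite -[_ *: h]addr0 (act_linear_l msa) a0 addr0.
Qed.

Lemma act_F_star (i : node) a :
  (q%:C ^+ i : R[i]) *: act (uF q i) (star a) = - star (act (uE q i) a).
Proof.
have := act_star msa a (ant_star (ant_E q i)).
rewrite starN starZ conjQ starK -scaleNr act_scale_l => <-.
by rewrite scaleNr opprK.
Qed.

Lemma phi_F i a : phi (act (uF q i) a) = 0.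
Proof.
rewrite (phi_invariant phi_state) /uF /uE /gen -prS counit_pr /=.
by rewrite rmorph0 mul0r.
Qed.

(** Invariance of the state under [F_i] and [K_i], combined with the antipode; the factor [q^i] from
    [act_F_star] cancels the one from [K_i E_i K_i^-1]. *)
Lemma phi_F_adjoint (i : node) a b :
  phi (star a * act (uF q i) b) = phi (star (act (uE q i) a) * b).
Proof.
have FM (c e : A) : act (uF q i) (c * e) =
    act (uF q i) c * act (uK q i) e + act (uKinv q i) c * act (uF q i) e.
  rewrite (act_mul msa _ _ (cop_star (cop_E q i))) /= big_cons big_seq1 /=.
  by rewrite star_uK star_uKinv.
have K' c : act (uK q i) (act (uKinv q i) c) = c.
  by rewrite -(act_M msa) uKKinv (act_1 msa).
have Qi : (q%:C ^+ i : R[i]) != 0 by rewrite expf_neq0// fmorph_eq0 gt_eqF.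
(* With [K_i^-1 a] in the first factor, the second term of the coproduct becomes [star a] times
   [F_i b]. *)
have := phi_F i (star (act (uKinv q i) a) * b).
rewrite FM (act_Kinv_star act_sphere) K' linearD /= => /eqP.
rewrite addrC addr_eq0 => /eqP->; apply: (mulfI Qi).
rewrite mulrN -linearZ /= scalerAl act_F_star mulNr linearN opprK.
set e := act (uE q i) _.
(* Writing the first factor as an image under [K_i] lets [K_i] be pulled out of the whole product
   and removed by invariance. *)
have -> : star e = act (uK q i) (star (act (uK q i) e)).
  by rewrite (act_K_star act_sphere) -(act_M msa) uKinvK (act_1 msa).
rewrite -(act_KM act_sphere) (phi_K phi_state) /e -!(act_M msa) uKE.
by rewrite act_scale_l starZ conjQ -scalerAl linearZ.
Qed.

Definition nket y : A := (Num.sqrt (gnorm y))%:C *: harm y.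
Definition sphere_ket (z : label) : A := nket (val z).

Lemma nket_nadm y : ~~ adm y -> nket y = 0.
Proof. by move=> nay; rewrite /nket harm_nadm// scaler0. Qed.

Lemma ket_nket l m n j : ket sphere_ket l m n j = nket (l, m, n, j).
Proof.
rewrite /ket; case: insubP => [z _ zE|nay]; first by rewrite /sphere_ket zE.
by rewrite nket_nadm.
Qed.

Lemma nket_coefs (L : shift_op (R := R)) (ts : seq (idx * R)) y b :
  edge_coefs q L ts y -> [seq r.1 | r <- ts] = [seq r.1 | r <- L] ->
  b = \sum_(d <- [seq r.1 | r <- L]) (ocoef L d y)%:C *: harm (y + d) ->
  (Num.sqrt (gnorm y))%:C *: b = \sum_(r <- ts) (r.2)%:C *: nket (y + r.1).
Proof.
move=> tsP tsL ->; rewrite -tsL big_map scaler_sumr big_seq [RHS]big_seq.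
apply: eq_bigr => r rts; have [ayr|nayr] := boolP (adm (y + r.1)); last first.
  by rewrite nket_nadm// harm_nadm// !scaler0.
by rewrite !scalerA -!rmorphM mulrC tsP.
Qed.

Lemma nket_orthonormal y z : adm y -> adm z ->
  phi (star (nket y) * nket z) = (y == z)%:R.
Proof.
move=> ay az; rewrite /nket starZ conjC_real -presented_scaleAl -presented_scaleAr.
rewrite !linearZ /=.
rewrite (phi_harm_harm q0 q1 act_sphere phi_state)//.
case: eqVneq => [<-|_]; last by rewrite !mulr0.
rewrite mulr1 mulrA -!rmorphM -expr2 sqr_sqrtr ?ltW ?gnorm_gt0//.
by rewrite divff// gt_eqF// gnorm_gt0.
Qed.

Lemma sphere_ket_orthonormal : orthonormal_family (sphere_ip phi) sphere_ket.
Proof.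
move=> y z; rewrite /sphere_ip nket_orthonormal; last exact: (valP z).
  by rewrite (inj_eq val_inj).
exact: (valP y).
Qed.

Lemma sphere_ket_free (s : seq label) (c : label -> R[i]) : uniq s ->
  \sum_(y <- s) c y *: sphere_ket y = 0 -> forall z, z \in s -> c z = 0.
Proof.
move=> us E z zs; have := congr1 (fun a => sphere_ip phi (sphere_ket z) a) E.
rewrite /sphere_ip mulr0 linear0 mulr_sumr linear_sum (bigD1_seq z)//=.
rewrite -presented_scaleAr linearZ /= [phi _]sphere_ket_orthonormal eqxx.
rewrite mulr1 big1 ?addr0//.
move=> y yz; rewrite -presented_scaleAr linearZ /= [phi _]sphere_ket_orthonormal.
by rewrite eq_sym (negbTE yz) mulr0.
Qed.

Lemma sphere_ket_span a : fin_span sphere_ket a.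
Proof.
suff [s [c [_ ->]]] : lspan sphere_ket a by exists s, c.
have [s [c [_ ->]]] := harm_span q0 q1 a.
apply: lspan_sub => y _; have [ay|nay] := boolP (adm y); last first.
  by rewrite harm_nadm//; apply: lspan0.
have n0 : (Num.sqrt (gnorm y))%:C != 0 :> R[i].
  by rewrite fmorph_eq0 gt_eqF// sqrtr_gt0 gnorm_gt0.
rewrite -[harm y](scalerK n0); apply: lspanZ.
exact: (lspan_e sphere_ket (Sub y ay)).
Qed.

Lemma sphere_ket_regular :
  regular_formulas q (fun i a => x i * a) (ket sphere_ket).
Proof.
move=> l m n j ay; rewrite !ket_nket.
have {}ay : adm (l, m, n, j) := ay.
have X (c : scoord) : x c * harm (l, m, n, j) =
    \sum_(d <- [seq r.1 | r <- opgen q c false])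
      (ocoef (opgen q c false) d (l, m, n, j))%:C *: harm ((l, m, n, j) + d).
  apply: mul_harm => //; first by move=> f sf; apply: rho_xgen.
    exact: uniq_opgen.
  exact: stable_opgen.
split.
- rewrite -presented_scaleAr.
  rewrite (nket_coefs (edge_coefs_x0 q0 q1 ay) erefl (X c0)).
  by rewrite /coefs_x0 !big_cons big_nil addr0 !addrA; cbn [fst snd];
     rewrite !idxD !addr0.
- rewrite -presented_scaleAr.
  rewrite (nket_coefs (edge_coefs_x1 q0 q1 ay) erefl (X c1)).
  by rewrite /coefs_x1 !big_cons big_nil addr0 !addrA; cbn [fst snd];
     rewrite !idxD !addr0.
- rewrite -presented_scaleAr.
  rewrite (nket_coefs (edge_coefs_x2 q0 q1 ay) erefl (X c2)).
  by rewrite /coefs_x2 !big_cons big_nil addr0; cbn [fst snd];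
     rewrite !idxD !addr0.
Qed.

Lemma sphere_ket_sigma :
  sigma_formulas q (sphere_ip phi) (fun i => act (uK q i))
    (fun i => act (uE q i)) (fun i => act (uF q i)) sphere_ket.
Proof.
split=> [l m n j ay|i y z]; last exact: phi_F_adjoint.
have {}ay : adm (l, m, n, j) := ay.
have E i (L : shift_op (R := R)) ts :
    opE q i = L -> edge_coefs q L ts (l, m, n, j) ->
    [seq r.1 | r <- ts] = [seq r.1 | r <- L] ->
    act (uE q i) (nket (l, m, n, j)) =
    (Escale q i)%:C *: \sum_(r <- ts) (r.2)%:C *: nket ((l, m, n, j) + r.1).
  move=> iL tsP tsL; rewrite /nket (actZ act_sphere) act_E_harm// scalerA mulrC.
  rewrite -scalerA iL; congr (_ *: _).
  exact: (nket_coefs tsP tsL erefl).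
have K i : act (uK q i) (nket (l, m, n, j)) =
    (q ^ weight i (l, m, n, j))%:C *: nket (l, m, n, j).
  by rewrite /nket (actZ act_sphere) act_K_harm// !scalerA mulrC.
have p0 : q `^ 2^-1 != 0 by rewrite gt_eqF// powR_gt0.
rewrite !ket_nket; split.
- exact: (K n1).
- exact: (K n2).
- rewrite (E n1 (opE1 q) _ erefl (edge_coefs_E1 q0 q1 ay) erefl).
  rewrite /coefs_E1 big_seq1; cbn [fst snd Escale].
  by rewrite idxD !addr0 scalerA -rmorphM mulrC divfK.
- rewrite (E n2 (opE2 q) _ erefl (edge_coefs_E2 q0 q1 ay) erefl).
  rewrite /coefs_E2 big_cons big_seq1; cbn [fst snd Escale].
  by rewrite !idxD !addr0 scale1r.
Qed.

End OrthonormalBasis.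

(** * Extending Lipschitz maps from a dense subspace *)

Section LipschitzExtension.
Local Open Scope classical_set_scope.
Variables (K : numFieldType) (H : completeNormedModType K) (A : lmodType K).
Variable iota : {linear A -> H}.
Hypothesis iota_dense : dense (range iota).
Implicit Types (u v w : H) (a b : A) (f g : H -> H).

Lemma dense_approx v (e : K) : 0 < e -> exists b, `|v - iota b| < e.
Proof.
move=> e0.
have [] := iota_dense (O := interior (ball v e)).
- by exists v; apply: nbhsx_ballx.
- exact: open_interior.
move=> w [/interior_subset + [b _ bw]]; rewrite -bw -ball_normE /= => vb.
by exists b.
Qed.

(** Lipschitz maps rather than bounded linear ones: the linearity of an extension is itself proved
    by comparing maps in one variable at a time, before they are known to be linear. *)
Definition lip f := exists2 M : K, 0 <= M &
  forall u v, `|f u - f v| <= M * `|u - v|.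

Lemma lip_id : lip id.
Proof. by exists 1 => // u v; rewrite mul1r. Qed.
Lemma lip_cst w : lip (fun=> w).
Proof. by exists 0 => // u v; rewrite subrr normr0 mul0r. Qed.
Lemma lip_comp f g : lip f -> lip g -> lip (f \o g).
Proof.
move=> [M M0 fM] [N N0 gN]; exists (M * N); first exact: mulr_ge0.
move=> u v; apply: le_trans (fM _ _) _; rewrite -mulrA.
exact: ler_wpM2l.
Qed.
Lemma lip_linear (c : K) f g : lip f -> lip g -> lip (fun v => c *: f v + g v).
Proof.
move=> [M M0 fM] [N N0 gN]; exists (`|c| * M + N).
  by rewrite addr_ge0// mulr_ge0.
move=> u v; rewrite opprD addrACA -scalerBr mulrDl.
apply: le_trans (ler_normD _ _) _; rewrite normrZ -mulrA lerD//.
exact: ler_wpM2l.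
Qed.

Lemma lip_continuous f : lip f -> continuous f.
Proof.
move=> [M M0 fM] v; apply/cvgrPdist_lt => e e0.
have M1 : 0 < M + 1 by rewrite ltr_wpDl.
near=> u; apply: le_lt_trans (fM _ _) _.
apply: (@le_lt_trans _ _ ((M + 1) * `|v - u|)).
  by rewrite ler_wpM2r// lerDl.
rewrite mulrC -ltr_pdivlMr//.
near: u; have := nbhsx_ballx v _ (divr_gt0 e0 M1).
by rewrite -ball_normE.
Unshelve. all: end_near. Qed.

Lemma lip_eq f g : lip f -> lip g -> (forall b, f (iota b) = g (iota b)) ->
  f = g.
Proof.
move=> [M M0 fM] [N N0 gN] fg; apply/funext => v.
have MN : 0 < M + N + 1 by rewrite ltr_wpDl// addr_ge0.
apply/eqP; rewrite -subr_eq0 -normr_le0; apply/ler_addgt0Pr => e e0.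
have [b vb] := dense_approx v (divr_gt0 e0 MN).
rewrite add0r.
have -> : f v - g v = f v - f (iota b) + (g (iota b) - g v).
  by rewrite -fg addrA subrK.
apply: le_trans (ler_normD _ _) _.
apply: (@le_trans _ _ ((M + N + 1) * `|v - iota b|)).
  rewrite 2!mulrDl mul1r ler_wpDr// lerD//.
  by rewrite [`|v - _|]distrC.
by rewrite mulrC -ler_pdivlMr// ltW.
Qed.

Lemma lip_extension (T : A -> A) (M : K) : 0 <= M ->
  (forall b b', `|iota (T b) - iota (T b')| <= M * `|iota b - iota b'|) ->
  exists f, lip f /\ forall b, f (iota b) = iota (T b).
Proof.
move=> M0 TB.
(* This single estimate characterises the value at [v]: taking [v = iota b] gives the extension
   property, and two nearby points give the Lipschitz bound. *)
have ext v : exists w, forall b, `|w - iota (T b)| <= M * `|v - iota b|.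
  (* The filter of images of points approaching [v]; it is Cauchy by the bound on [T], and proper by
     density. *)
  pose F : set_system H := [set S | exists2 e : K, 0 < e &
    forall b, `|v - iota b| < e -> S (iota (T b))].
  have FF : ProperFilter F.
    split; first by move=> [e e0 Fe]; have [b /Fe] := dense_approx v e0.
    split.
    - by exists 1.
    - move=> S S' [e e0 Se] [e' e'0 Se'].
      have := real_leVge (gtr0_real e0) (gtr0_real e'0).
      case/orP => ee'; [exists e|exists e'] => // b be; split.
      + exact: Se.
      + by apply: Se'; apply: lt_le_trans ee'.
      + by apply: Se; apply: lt_le_trans ee'.
      + exact: Se'.
    - by move=> S S' SS' [e e0 Se]; exists e => // b /Se; apply: SS'.
  have : cvg F.
    apply/cauchy_cvgP; apply: cauchy_exP => e e0.
    (* Two points within [d] of [v] are at most [2 d] apart, hence the factor 2; the added 1 keeps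
       the divisor positive when [M = 0]. *)
    have M1 : 0 < 2 * M + 1 by rewrite ltr_wpDl// mulr_ge0.
    have d0 : 0 < e / (2 * M + 1) by rewrite divr_gt0.
    have [b0 vb0] := dense_approx v d0.
    exists (iota (T b0)), (e / (2 * M + 1)) => // b vb.
    rewrite -ball_normE /=; apply: le_lt_trans (TB _ _) _.
    have : `|iota b0 - iota b| <= 2 * (e / (2 * M + 1)).
      rewrite mulr_natl mulr2n -[iota b0](subrK v) -addrA.
      apply: le_trans (ler_normD _ _) _.
      by rewrite lerD// ltW// distrC.
    move=> h; apply: le_lt_trans (ler_wpM2l M0 h) _.
    rewrite !mulrA ltr_pdivrMr//.
    by have -> : e * (2 * M + 1) = M * 2 * e + e by [ring]; rewrite ltrDl.
  move=> /cvg_ex[w Fw]; exists w => b; apply/ler_addgt0Pr => e e0.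
  have M1 : 0 < M + 1 by rewrite ltr_wpDl.
  have d0 : 0 < e / (M + 1) by rewrite divr_gt0.
  have [d d'0 Fd] := Fw _ (nbhsx_ballx w _ d0).
  have [k [k0 kd ke]] : exists k, [/\ 0 < k, k <= d & k <= e / (M + 1)].
    have := real_leVge (gtr0_real d0) (gtr0_real d'0).
    by case/orP => h; [exists (e / (M + 1))|exists d]; split.
  have [b' vb'] := dense_approx v k0.
  have := Fd b' (lt_le_trans vb' kd); rewrite -ball_normE /= => wb'.
  rewrite -[w](subrK (iota (T b'))) -addrA.
  apply: le_trans (ler_normD _ _) _.
  apply: (@le_trans _ _ (e / (M + 1) + M * (e / (M + 1) + `|v - iota b|))).
    rewrite lerD ?(ltW wb')//; apply: le_trans (TB _ _) _.
    rewrite ler_wpM2l// -[iota b'](subrK v) -addrA.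
    apply: le_trans (ler_normD _ _) _; rewrite lerD// distrC.
    exact: le_trans (ltW vb') ke.
  rewrite mulrDr addrA [X in _ <= X]addrC lerD2r.
  rewrite -[X in X + _]mul1r -mulrDl addrC mulrC divfK// gt_eqF//.
pose f v := projT1 (cid (ext v)).
have fP v b : `|f v - iota (T b)| <= M * `|v - iota b|.
  exact: (projT2 (cid (ext v))).
exists f; split; last first.
  move=> b; apply/eqP; rewrite -subr_eq0 -normr_le0.
  by apply: le_trans (fP _ b) _; rewrite subrr normr0 mulr0.
exists M => // u v; apply/ler_addgt0Pr => e e0.
have M1 : 0 < 2 * M + 1 by rewrite ltr_wpDl// mulr_ge0.
have d0 : 0 < e / (2 * M + 1) by rewrite divr_gt0.
have [b ub] := dense_approx u d0.
rewrite -[f u](subrK (iota (T b))) -addrA.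
apply: le_trans (ler_normD _ _) _.
apply: (@le_trans _ _ (M * (e / (2 * M + 1)) + M * (`|u - v| + e / (2 * M + 1)))).
  rewrite lerD//.
    by apply: le_trans (fP _ _) _; rewrite ler_wpM2l// ltW.
  rewrite distrC; apply: le_trans (fP _ _) _; rewrite ler_wpM2l//.
  have -> : v - iota b = v - u + (u - iota b) by rewrite addrA subrK.
  apply: le_trans (ler_normD _ _) _.
  by rewrite lerD ?(ltW ub)// distrC.
set k := e / _; have -> : M * k + M * (`|u - v| + k) = M * `|u - v| + 2 * M * k.
  by ring.
rewrite lerD2l /k mulrA ler_pdivrMr// mulrC ler_wpM2l ?(ltW e0)//.
by rewrite lerDl.
Qed.

End LipschitzExtension.

(** * Left multiplication is bounded and extends to the completion *)

Section LeftRegular.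
Variables (R : realType) (q : R).
Hypothesis q0 : 0 < q.
Notation A := (qsphere q).
Local Notation x := (xgen q).
Local Notation Q := (q%:C : R[i]).
Variable act : uq q -> A -> A.
Variable phi : {scalar A}.
Hypothesis phi_state : invariant_faithful_state act phi.
Variables (H : completeNormedModType R[i]) (ip : H -> H -> R[i]).
Variable iota : {linear A -> H}.
Hypothesis completion : hilbert_completion phi ip iota.
Implicit Types a b : A.

Lemma iota_norm a : `|iota a| ^+ 2 = phi (star a * a).
Proof. by rewrite -(ip_norm completion) (iota_isometry completion). Qed.

Lemma iota_normM a b : `|iota (a * b)| ^+ 2 = phi (star b * (star a * a) * b).
Proof. by rewrite iota_norm starM !mulrA. Qed.

Definition bounded_mul a := exists2 M : R[i], 0 <= M &
  forall b, `|iota (a * b)| <= M * `|iota b|.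

(** The constant [n] replaces [sqrt n], since [n <= n^2] for natural numbers. *)
Lemma bounded_mul_sqr a (n : nat) :
  (forall b, `|iota (a * b)| ^+ 2 <= n%:R * `|iota b| ^+ 2) -> bounded_mul a.
Proof.
move=> ab; exists n%:R => // b.
rewrite -(@ler_pXn2r _ 2)// ?nnegrE ?mulr_ge0// exprMn.
apply: le_trans (ab b) _; rewrite ler_wpM2r ?exprn_ge0//.
by rewrite -natrX ler_nat; case: (n) => // k; rewrite expnS expn1 leq_pmulr.
Qed.

(** The sphere relation placed between [star b] and [b], under the state. *)
Lemma sphere_norm b :
  `|iota (x c0 * b)| ^+ 2 + `|iota (star (x c1) * b)| ^+ 2
   + `|iota (star (x c2) * b)| ^+ 2 = `|iota b| ^+ 2.
Proof.
rewrite !iota_normM !starK star_x0 -!linearD /= -!mulrDl -!mulrDr sphere_eq.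
by rewrite mulr1 iota_norm.
Qed.

Let N (a : A) : 0 <= `|iota a| ^+ 2. Proof. exact: exprn_ge0. Qed.

Lemma bounded_x0 : bounded_mul (x c0).
Proof.
apply: (@bounded_mul_sqr _ 1) => b; rewrite mul1r -(sphere_norm b) -addrA.
by rewrite lerDl addr_ge0.
Qed.
Lemma bounded_x1s : bounded_mul (star (x c1)).
Proof.
apply: (@bounded_mul_sqr _ 1) => b; rewrite mul1r -(sphere_norm b) addrAC.
by rewrite lerDr addr_ge0.
Qed.
Lemma bounded_x2s : bounded_mul (star (x c2)).
Proof.
apply: (@bounded_mul_sqr _ 1) => b; rewrite mul1r -(sphere_norm b).
by rewrite lerDr addr_ge0.
Qed.

Lemma Q4_ge0 : 0 <= Q ^+ 4.
Proof. by rewrite exprn_ge0// lecR ltW. Qed.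
(** In [star x1 x1 = x1 (star x1) + (1 - q^4) x0^2] each term contributes at most the squared norm
    of [b], whence the constant 2. *)
Lemma bounded_x1 : bounded_mul (x c1).
Proof.
apply: (@bounded_mul_sqr _ 2) => b.
rewrite iota_normM x1s_x1_rel mulrDr mulrDl linearD /=.
rewrite -presented_scaleAr -presented_scaleAl linearZ /=.
have -> : phi (star b * (x c1 * star (x c1)) * b) = `|iota (star (x c1) * b)| ^+ 2.
  by rewrite iota_normM starK.
have -> : phi (star b * (x c0 * x c0) * b) = `|iota (x c0 * b)| ^+ 2.
  by rewrite iota_normM star_x0.
rewrite mulr_natl mulr2n lerD// -[X in _ <= X](sphere_norm b).
  by rewrite addrAC lerDr addr_ge0.
rewrite -addrA; apply: (@le_trans _ _ (`|iota (x c0 * b)| ^+ 2)).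
  by rewrite ler_piMl// gerBl Q4_ge0.
by rewrite lerDl addr_ge0.
Qed.

(** By [x2s_x2] the squared norm drops by [q^4] times the contribution of [z], which is nonnegative
    by [zsqE]. *)
Lemma bounded_x2 : bounded_mul (x c2).
Proof.
apply: (@bounded_mul_sqr _ 1) => b; rewrite mul1r.
rewrite iota_normM x2s_x2 mulrBr mulrBl linearB /= mulr1 -iota_norm.
rewrite -presented_scaleAr -presented_scaleAl linearZ /= gerBl mulr_ge0 ?Q4_ge0//.
rewrite zsqE mulrDr mulrDl linearD /= addr_ge0//.
  by have := N (x c0 * b); rewrite iota_normM star_x0.
by have := N (star (x c1) * b); rewrite iota_normM starK.
Qed.

Lemma bounded_mulM a b : bounded_mul a -> bounded_mul b -> bounded_mul (a * b).
Proof.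
move=> [M M0 aM] [M' M'0 bM]; exists (M * M'); first exact: mulr_ge0.
move=> c; rewrite -mulrA; apply: le_trans (aM _) _; rewrite -mulrA.
exact: ler_wpM2l.
Qed.

Lemma bounded_mulP a : bounded_mul a.
Proof.
elim/presented_word_ind: a => [|c a b [M M0 aM] [N' N0 bN]|[] a|[] a].
- by exists 1 => // b; rewrite !mul1r.
- exists (`|c| * M + N'); first by rewrite addr_ge0// mulr_ge0.
  move=> d; rewrite mulrDl -presented_scaleAl linearD linearZ /= mulrDl.
  apply: le_trans (ler_normD _ _) _; rewrite lerD// normrZ -mulrA.
  exact: ler_wpM2l.
- exact: bounded_mulM bounded_x0.
- exact: bounded_mulM bounded_x1.
- exact: bounded_mulM bounded_x2.
- by rewrite [star _]star_x0; apply: bounded_mulM bounded_x0.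
- exact: bounded_mulM bounded_x1s.
- exact: bounded_mulM bounded_x2s.
Qed.

Lemma left_regular_exists : exists p : A -> H -> H, left_regular iota p.
Proof.
have dns := iota_dense completion.
have ext a : exists f, lip f /\ forall b, f (iota b) = iota (a * b).
  have [M M0 aM] := bounded_mulP a.
  apply: (lip_extension dns (T := fun b => a * b) M0) => b b'.
  by rewrite -!linearB -mulrBr.
pose p a := projT1 (cid (ext a)).
have plip a : lip (p a) := proj1 (projT2 (cid (ext a))).
have pE a b : p a (iota b) = iota (a * b) := proj2 (projT2 (cid (ext a))) b.
exists p; split.
(* Density is used twice: with [u] fixed it reduces [v] to the image of the algebra, and then [u] is
   reduced in the same way. *)
- move=> a c u v; move: v.
  suff h : (fun v => p a (c *: u + v)) = (fun v => c *: p a u + p a v).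
    by move=> v; apply: (congr1 (fun f : H -> H => f v) h).
  have tr w : lip (fun v : H => w + v).
    have := lip_linear 1 (lip_cst w) (@lip_id _ H).
    by congr lip; apply/funext => v; rewrite scale1r.
  apply: (lip_eq dns).
  + exact: lip_comp (plip a) (tr _).
  + exact: lip_comp (tr _) (plip a).
  move=> b; move: u.
  suff h : (fun u => p a (c *: u + iota b)) = (fun u => c *: p a u + p a (iota b)).
    by move=> u; apply: (congr1 (fun f : H -> H => f u) h).
  apply: (lip_eq dns).
  + exact: lip_comp (plip a) (lip_linear c (@lip_id _ H) (lip_cst _)).
  + exact: lip_linear (plip a) (lip_cst _).
  by move=> b'; rewrite -linearP !pE mulrDr -presented_scaleAr linearP.
- by move=> a; apply: lip_continuous.
- move=> v; suff -> : p 1 = id by [].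
  by apply: (lip_eq dns) => // [|b]; [exact: lip_id|rewrite pE mul1r].
- move=> a b v; suff -> : p (a * b) = p a \o p b by [].
  apply: (lip_eq dns) => // [|b']; first exact: lip_comp.
  by rewrite /= !pE mulrA.
- move=> c a b v; suff -> : p (c *: a + b) = (fun v => c *: p a v + p b v) by [].
  apply: (lip_eq dns) => // [|b']; first exact: lip_linear.
  by rewrite !pE mulrDl -presented_scaleAl linearP.
- exact: pE.
Qed.

Lemma ket_iota (e : label -> A) l m n j :
  ket (iota \o e) l m n j = iota (ket e l m n j).
Proof. by rewrite /ket; case: insub => //; rewrite linear0. Qed.

End LeftRegular.

Theorem theorem6p1 (R : realType) (q : R) (q_gt0 : 0 < q) (q_lt1 : q < 1)
    (act : uq q -> qsphere q -> qsphere q) (act_sphere : sphere_action act)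
    (phi : {scalar qsphere q}) (phi_state : invariant_faithful_state act phi) :
  exists e : label -> qsphere q,
  [/\ sigma_formulas q (sphere_ip phi) (fun i => act (uK q i))
        (fun i => act (uE q i)) (fun i => act (uF q i)) e,
      orthonormal_family (sphere_ip phi) e,
      linear_basis e,
      regular_formulas q (fun i a => xgen q i * a) (ket e)
    & forall (H : completeNormedModType R[i]) (ip : H -> H -> R[i])
        (iota : {linear qsphere q -> H}),
      hilbert_completion phi ip iota ->
      [/\ orthonormal_family ip (iota \o e),
          dense (fin_span (iota \o e))
        & exists p : qsphere q -> H -> H,
            left_regular iota p /\
            regular_formulas q (fun i => p (xgen q i)) (ket (iota \o e))]].
Proof.
pose e := sphere_ket q_gt0 q_lt1.
have ortho := sphere_ket_orthonormal q_gt0 q_lt1 act_sphere phi_state.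
have reg := sphere_ket_regular q_gt0 q_lt1.
exists e; split=> //.
- exact: sphere_ket_sigma.
- split; [exact: (sphere_ket_free act_sphere phi_state)|exact: sphere_ket_span].
move=> H ip iota compl; split.
- by move=> y z; rewrite /= (iota_isometry compl) ortho.
- move=> O O0 Oo; have [v [Ov [a _ av]]] := iota_dense compl O0 Oo.
  exists v; split=> //; rewrite -av.
  have [s [c ->]] := sphere_ket_span q_gt0 q_lt1 a.
  by exists s, c; rewrite linear_sum; apply: eq_bigr => y _; rewrite linearZ.
- have [p pP] := left_regular_exists q_gt0 compl.
  exists p; split=> // l m n j ay.
  have [r0 r1 r2] := reg l m n j ay; rewrite !ket_iota !(lr_extends pP).
  rewrite -!linearZ -!linearD /=.
  by split; congr (iota _).
Qed.
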